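(* Let $n\in\mathbb N_0$, $0<|q|<1$, $\beta\in(-1,1)$, $\max\{|a_1|,|a_2|,|a_3|,|a_4|,|t|\}<1$, $x=\cos\theta\in(-1,1)$, where $\mathbf a=\{a_1,a_2,a_3,a_4\}$ and $q$ are such that the orthogonality relation for the Askey-Wilson polynomials recalled in the context holds. Then $$\int_{-1}^1\frac{(t\beta e^{i\theta},t\beta e^{-i\theta};q)_\infty}{(te^{i\theta},te^{-i\theta};q)_\infty}\,p_n(x;\mathbf a|q)\,\frac{w(x;\mathbf a;q)}{\sqrt{1-x^2}}\,dx=2\pi\,h_n(\mathbf a;q)\,c_n(\beta,t,\mathbf a;q),$$ where $$c_n(\beta,t,\mathbf a;q)=\frac{t^n(\beta;q)_n(q^na_1\beta t,q^na_2\beta t,q^na_3\beta t,q^na_1a_2a_3t;q)_\infty}{(q,q^{n-1}a_1a_2a_3a_4;q)_n(a_1t,a_2t,a_3t,q^{2n}a_1a_2a_3\beta t;q)_\infty}\,\Phi_n,$$ $$\Phi_n={}_8\phi_7\left(\begin{array}{c}q^{2n-1}a_1a_2a_3\beta t,\ \pm q^{n+\frac12}(a_1a_2a_3\beta t)^{\frac12},\ q^na_1a_2,\ q^na_1a_3,\ q^na_2a_3,\ \beta t/a_4,\ q^n\beta\\ \pm q^{n-\frac12}(a_1a_2a_3\beta t)^{\frac12},\ q^na_1\beta t,\ q^na_2\beta t,\ q^na_3\beta t,\ q^{2n}a_1a_2a_3a_4,\ q^na_1a_2a_3t\end{array};q,a_4t\right).$$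
   Context: In a list of parameters, $\pm c$ stands for the two entries $c,-c$. $q$-Pochhammer symbols: $(a;q)_0=1$, $(a;q)_n=(1-a)(1-aq)\cdots(1-aq^{n-1})$, $(a;q)_\infty=\prod_{n\ge0}(1-aq^n)$, and $(a_1,\ldots,a_r;q)_n=(a_1;q)_n\cdots(a_r;q)_n$ (also for $n=\infty$). Basic hypergeometric series: ${}_r\phi_s\left(\begin{array}{c}a_1,\ldots,a_r\\ b_1,\ldots,b_s\end{array};q,z\right)=\sum_{k=0}^\infty\frac{(a_1,\ldots,a_r;q)_k}{(q,b_1,\ldots,b_s;q)_k}\left((-1)^kq^{\binom k2}\right)^{1+s-r}z^k$. Askey-Wilson polynomials: $p_n(x;\mathbf a|q)=a_1^{-n}(a_1a_2,a_1a_3,a_1a_4;q)_n\,{}_4\phi_3\left(\begin{array}{c}q^{-n},\ a_1a_2a_3a_4q^{n-1},\ a_1e^{i\theta},\ a_1e^{-i\theta}\\ a_1a_2,\ a_1a_3,\ a_1a_4\end{array};q,q\right)$, $x=\cos\theta$. Weight: $w(x;\mathbf a;q)=\left|\frac{(e^{2i\theta};q)_\infty}{(a_1e^{i\theta},a_2e^{i\theta},a_3e^{i\theta},a_4e^{i\theta};q)_\infty}\right|^2$. Norm: $h_n(\mathbf a;q)=\frac{(a_1a_2a_3a_4q^{n-1};q)_n(a_1a_2a_3a_4q^{2n};q)_\infty}{(q^{n+1},a_1a_2q^n,a_1a_3q^n,a_1a_4q^n,a_2a_3q^n,a_2a_4q^n,a_3a_4q^n;q)_\infty}$. Orthogonality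 relation (known, standard for $0<q<1$ and $a_j$ real or in complex conjugate pairs with $|a_j|<1$): $\int_{-1}^1p_m(x;\mathbf a|q)p_n(x;\mathbf a|q)\frac{w(x;\mathbf a;q)}{\sqrt{1-x^2}}dx=2\pi h_n(\mathbf a;q)\delta_{m,n}$. *)

(* Defs.v *)
(* Stdlib reals with Coquelicot's complex numbers. *)
From Stdlib Require Export Reals List.
From Stdlib Require Import Lra.
From Coquelicot Require Export Coquelicot.
Export ListNotations.

Open Scope C_scope.

(* Componentwise limits and sums: meaningful when both components converge. *)
Definition CLim (u : nat -> C) : C :=
  (real (Lim_seq (fun n => Re (u n))), real (Lim_seq (fun n => Im (u n)))).

Definition CSeries (u : nat -> C) : C :=
  (Series (fun k => Re (u k)), Series (fun k => Im (u k))).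

(* Principal square root. *)
Definition Csqrt (z : C) : C :=
  (sqrt ((Cmod z + Re z) / 2),
   if Rle_dec 0 (Im z) then sqrt ((Cmod z - Re z) / 2)
   else Ropp (sqrt ((Cmod z - Re z) / 2)))%R.

Lemma Csqrt_sqr (z : C) : Csqrt z * Csqrt z = z.
Proof.
destruct z as [x y].
assert (Hx : (Rabs x <= Cmod (x, y))%R) by exact (re_le_Cmod (x, y)).
assert (Hm : (Cmod (x, y) ^ 2 = x ^ 2 + y ^ 2)%R) by exact (Cmod2_alt (x, y)).
unfold Csqrt; simpl Re; simpl Im.
set (r := Cmod (x, y)) in *.
assert (Hp : (0 <= (r + x) / 2)%R) by (revert Hx; unfold Rabs; destruct Rcase_abs; lra).
assert (Hn : (0 <= (r - x) / 2)%R) by (revert Hx; unfold Rabs; destruct Rcase_abs; lra).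
assert (Hpn : (sqrt ((r + x) / 2) * sqrt ((r - x) / 2) = Rabs y / 2)%R).
{ rewrite <- sqrt_mult by assumption.
  replace ((r + x) / 2 * ((r - x) / 2))%R with (Rsqr (y / 2)) by (unfold Rsqr; nra).
  rewrite sqrt_Rsqr_abs; unfold Rdiv.
  rewrite Rabs_mult, (Rabs_pos_eq (/ 2)); lra. }
generalize (sqrt_sqrt _ Hp) (sqrt_sqrt _ Hn); intros Ep En.
destruct (Rle_dec 0 y) as [Hy | Hy]; unfold Cmult; simpl; f_equal.
- lra.
- rewrite Rabs_pos_eq in Hpn; lra.
- lra.
- rewrite Rabs_left in Hpn; lra.
Qed.

Definition Cexpi (theta : R) : C := (cos theta, sin theta).

Fixpoint qpoch (a q : C) (n : nat) : C :=
  match n with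
  | O => 1
  | S m => qpoch a q m * (1 - a * q ^ m)
  end.

Definition qpoch_inf (a q : C) : C := CLim (qpoch a q).

Definition qpochs (l : list C) (q : C) (n : nat) : C :=
  fold_right (fun a acc => qpoch a q n * acc) 1 l.

Definition qpochs_inf (l : list C) (q : C) : C :=
  fold_right (fun a acc => qpoch_inf a q * acc) 1 l.

(* The series r-phi-s for r = length l1, s = length l2 and q <> 0.  The
   exponent 1 + s - r may be negative, so the power is written as a quotient. *)
Definition qphi (l1 l2 : list C) (q z : C) : C :=
  CSeries (fun k =>
    let u := (-1) ^ k * q ^ (k * (k - 1) / 2)%nat in
    qpochs l1 q k / qpochs (q :: l2) q k
    * (u ^ (1 + length l2)%nat / u ^ length l1)
    * z ^ k).

(* Throughout, q ^ (n - 1) and q ^ (2n - 1) with integer exponents are written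
   q ^ n / q and q ^ (2 * n) / q, so that they are right for n = 0. *)

Definition askey_wilson (n : nat) (x : R) (a1 a2 a3 a4 q : C) : C :=
  let theta := acos x in
  / a1 ^ n * qpochs [a1 * a2; a1 * a3; a1 * a4] q n
  * qphi [/ q ^ n; a1 * a2 * a3 * a4 * (q ^ n / q);
          a1 * Cexpi theta; a1 * Cexpi (- theta)]
         [a1 * a2; a1 * a3; a1 * a4] q q.

Definition aw_weight (x : R) (a1 a2 a3 a4 q : C) : R :=
  let theta := acos x in
  let e := Cexpi theta in
  pow (Cmod (qpoch_inf (Cexpi (2 * theta)) q
             / qpochs_inf [a1 * e; a2 * e; a3 * e; a4 * e] q)) 2.

Definition aw_norm (n : nat) (a1 a2 a3 a4 q : C) : C :=
  qpoch (a1 * a2 * a3 * a4 * (q ^ n / q)) q n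
  * qpoch_inf (a1 * a2 * a3 * a4 * q ^ (2 * n)) q
  / qpochs_inf [q ^ (n + 1);
                a1 * a2 * q ^ n; a1 * a3 * q ^ n; a1 * a4 * q ^ n;
                a2 * a3 * q ^ n; a2 * a4 * q ^ n; a3 * a4 * q ^ n] q.

(* The weight vanishes at x = -1 and x = 1 to the order of 1 - x^2, so these are
   proper Riemann integrals of continuous integrands (x / 0 is 0 in R). *)
Definition aw_orthogonality (a1 a2 a3 a4 q : C) : Prop :=
  forall m n : nat,
    is_RInt (V := C_R_NormedModule)
      (fun x : R =>
         askey_wilson m x a1 a2 a3 a4 q * askey_wilson n x a1 a2 a3 a4 q
         * RtoC (aw_weight x a1 a2 a3 a4 q / sqrt (1 - x ^ 2)))
      (-1) 1
      (if Nat.eqb m n then RtoC (2 * PI) * aw_norm n a1 a2 a3 a4 q else RtoC 0).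

Definition Phi (n : nat) (beta t a1 a2 a3 a4 q : C) : C :=
  let s := Csqrt (a1 * a2 * a3 * beta * t) in
  let rq := Csqrt q in
  qphi [q ^ (2 * n) / q * (a1 * a2 * a3 * beta * t);
        q ^ n * rq * s; - (q ^ n * rq * s);
        q ^ n * a1 * a2; q ^ n * a1 * a3; q ^ n * a2 * a3;
        beta * t / a4; q ^ n * beta]
       [q ^ n / rq * s; - (q ^ n / rq * s);
        q ^ n * a1 * beta * t; q ^ n * a2 * beta * t; q ^ n * a3 * beta * t;
        q ^ (2 * n) * a1 * a2 * a3 * a4; q ^ n * a1 * a2 * a3 * t]
       q (a4 * t).

Definition aw_coeff (n : nat) (beta t a1 a2 a3 a4 q : C) : C :=
  t ^ n * qpoch beta q n
  * qpochs_inf [q ^ n * a1 * beta * t; q ^ n * a2 * beta * t;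
                q ^ n * a3 * beta * t; q ^ n * a1 * a2 * a3 * t] q
  / (qpochs [q; q ^ n / q * a1 * a2 * a3 * a4] q n
     * qpochs_inf [a1 * t; a2 * t; a3 * t;
                   q ^ (2 * n) * a1 * a2 * a3 * beta * t] q)
  * Phi n beta t a1 a2 a3 a4 q.

(* Main.v *)
Require Import Defs.
From Stdlib Require Import Lra Lia Arith IndefiniteDescription.

(** Fix s = beta t.  When t = s q^N the kernel is the polynomial
    (s e^(i theta), s e^(-i theta); q)_N.  It expands in the basis
    (a1 e^(i theta), a1 e^(-i theta); q)_k by the q-Saalschuetz sum, and the integral of
    each basis element against p_n is read off the orthogonality relation by inverting the
    expansion of the Askey-Wilson polynomials in the same basis; Watson's transformation
    turns the resulting balanced 4-phi-3 into the terminating case of the 8-phi-7.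
    After multiplication by (a1 t, a2 t, a3 t; q)_oo both sides are, for fixed s <> 0,
    power series in t converging for |t| < 1, and they agree at the points t = s q^N, which
    accumulate at 0: hence they agree for all |t| < 1.  The case s = 0 follows by letting
    s tend to 0 with t fixed. *)

(** * Terminating q-series *)

(** At the points t = s q^N the ratio beta = s/t is q^(-N), outside the range of the theorem; hence
    [s] and [t] are independent parameters of modulus below 1, and beta returns only at the end. The
    integral is a power series in t because 1/(t e^(i theta), t e^(-i theta); q)_oo generates the
    continuous q-Hermite polynomials, which after division by (q; q)_m grow at most linearly in m,
    uniformly in theta. On the other side, regularity in t is arranged factor by factor: t^n (beta;
    q)_n and (a4 t)^j (q^n beta; q)_j are polynomials in t and s, and (q^n a1 a2 a3 t; q)_oo absorbs
    the denominators (q^n a1 a2 a3 t; q)_j. The weight is never examined. It is known only through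
    the orthogonality relation, an assertion about Riemann integrals, so every integrand has to be
    reached from products p_m p_n by linear combinations and uniform limits. The one bound on the
    weight that this requires is the boundedness of Riemann integrable functions. *)

Fixpoint csum (f : nat -> C) (n : nat) : C :=
  match n with
  | O => 0
  | S m => csum f m + f m
  end.

Lemma csum_S (f : nat -> C) (n : nat) : csum f (S n) = csum f n + f n.
Proof. reflexivity. Qed.

Lemma csum_ext (f g : nat -> C) (n : nat) :
  (forall k, (k < n)%nat -> f k = g k) -> csum f n = csum g n.
Proof.
induction n as [|n IH]; intros H; simpl; auto.
rewrite IH, H; auto; lia.
Qed.

Lemma csum_zero (f : nat -> C) (n : nat) :
  (forall k, (k < n)%nat -> f k = 0) -> csum f n = 0.
Proof.
induction n as [|n IH]; intros H; simpl; auto.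
rewrite IH, H by auto with arith. ring.
Qed.

Lemma csum_plus (f g : nat -> C) (n : nat) :
  csum (fun k => f k + g k) n = csum f n + csum g n.
Proof. induction n as [|n IH]; simpl; [ring | rewrite IH; ring]. Qed.

Lemma csum_scal (c : C) (f : nat -> C) (n : nat) :
  csum (fun k => c * f k) n = c * csum f n.
Proof. induction n as [|n IH]; simpl; [ring | rewrite IH; ring]. Qed.

Lemma csum_split (f : nat -> C) (n m : nat) :
  csum f (n + m) = csum f n + csum (fun k => f (n + k)%nat) m.
Proof.
induction m as [|m IH]; simpl.
- rewrite Nat.add_0_r; ring.
- rewrite Nat.add_succ_r; simpl; rewrite IH; ring.
Qed.

Lemma csum_swap (f : nat -> nat -> C) (n m : nat) :
  csum (fun i => csum (f i) m) n = csum (fun j => csum (fun i => f i j) n) m.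
Proof.
induction n as [|n IH]; simpl.
- rewrite csum_zero; auto.
- rewrite IH, csum_plus; auto.
Qed.

Lemma csum_telescope (f G : nat -> C) (n : nat) :
  (forall k, (k < n)%nat -> f k = G (S k) - G k) -> csum f n = G n - G O.
Proof.
induction n as [|n IH]; intros H; simpl; [ring|].
rewrite IH, H by auto with arith. ring.
Qed.

Lemma csum_Sl (f : nat -> C) (n : nat) :
  csum f (S n) = f O + csum (fun k => f (S k)) n.
Proof. change (S n) with (1 + n)%nat. rewrite csum_split; simpl; ring. Qed.

Lemma Cminus_eq0 (x y : C) : x - y = 0 -> x = y.
Proof. intros H. replace x with (x - y + y) by ring. rewrite H; ring. Qed.

Lemma Cmult_cancel (c x y : C) : c <> 0 -> c * x = c * y -> x = y.
Proof.
intros Hc H. replace x with (/ c * (c * x)) by (field; auto).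
rewrite H. field; auto.
Qed.

(** * Finite q-shifted factorials and classical terminating sums *)

Lemma qpoch_S (a q : C) (n : nat) :
  qpoch a q (S n) = qpoch a q n * (1 - a * q ^ n).
Proof. reflexivity. Qed.

Lemma qpoch_add (a q : C) (n m : nat) :
  qpoch a q (n + m) = qpoch a q n * qpoch (a * q ^ n) q m.
Proof.
induction m as [|m IH].
- rewrite Nat.add_0_r; simpl; ring.
- rewrite Nat.add_succ_r, !qpoch_S, IH, Cpow_add_r; ring.
Qed.

Lemma qpoch_Sl (a q : C) (n : nat) :
  qpoch a q (S n) = (1 - a) * qpoch (a * q) q n.
Proof.
change (S n) with (1 + n)%nat. rewrite qpoch_add, Cpow_1_r.
simpl. ring.
Qed.

Lemma qpoch_neq0 (a q : C) (n : nat) :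
  (forall i, (i < n)%nat -> 1 - a * q ^ i <> 0) -> qpoch a q n <> 0.
Proof.
induction n as [|n IH]; intros H; simpl.
- apply C1_nz.
- apply Cmult_neq_0; [apply IH; auto | apply H; auto].
Qed.

Lemma Cinv_pow_S (q : C) (j : nat) : q <> 0 -> / q ^ S j * q = / q ^ j.
Proof.
intros Hq. rewrite Cpow_S. field. split; auto. apply Cpow_nz; auto.
Qed.

Lemma qpoch_inv_pow_S (q : C) (j k : nat) : q <> 0 ->
  qpoch (/ q ^ S j) q (S k) = (1 - / q ^ S j) * qpoch (/ q ^ j) q k.
Proof. intros Hq. rewrite qpoch_Sl, Cinv_pow_S; auto. Qed.

Lemma qpoch_inv_pow_zero (q : C) (j k : nat) : q <> 0 -> (j < k)%nat ->
  qpoch (/ q ^ j) q k = 0.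
Proof.
intros Hq H. replace k with (S j + (k - S j))%nat by lia.
rewrite qpoch_add, qpoch_S, Cinv_l by (apply Cpow_nz; auto). ring.
Qed.

(* With u = q^(-n) the right-hand side vanishes: this is the case of q-Chu-Vandermonde that
   inverts the Askey-Wilson expansion. *)
Lemma balanced_partial_sum (u v q : C) (n : nat) :
  (forall k, 1 - q * q ^ k <> 0) -> (forall k, 1 - u * v * q * q ^ k <> 0) ->
  csum (fun k => qpoch u q k * qpoch v q k * q ^ k
                 / (qpoch q q k * qpoch (u * v * q) q k)) (S n)
  = qpoch (u * q) q n * qpoch (v * q) q n
    / (qpoch q q n * qpoch (u * v * q) q n).
Proof.
intros Hq Hz. induction n as [|n IH].
- simpl. field.
- rewrite csum_S, IH. clear IH. cbv beta.
  rewrite (qpoch_Sl u), (qpoch_Sl v), !qpoch_S, Cpow_S.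
  assert (qpoch q q n <> 0) by (apply qpoch_neq0; auto).
  assert (qpoch (u * v * q) q n <> 0) by (apply qpoch_neq0; auto).
  specialize (Hq n). specialize (Hz n).
  field; auto.
Qed.

(** The q-Saalschuetz sum: a 3-phi-2 with upper parameters q^(-j), A q^j, X and lower ones cX, bX,
    balanced by [A * q = b * c * X]. Naming X instead of writing Aq/(bc) keeps b = 0 and c = 0
    admissible, which occurs when a2 or a3 vanishes. The proof is creative telescoping in j: the
    right-hand side dictates the ratio [Nn / Dn] of consecutive sums, and [G] certifies it
    termwise. *)
Lemma saalschutz_well_poised (b c X A q : C) (j : nat) :
  q <> 0 -> A * q = b * c * X ->
  (forall k, 1 - q * q ^ k <> 0) ->
  (forall k, 1 - c * X * q ^ k <> 0) -> (forall k, 1 - b * X * q ^ k <> 0) ->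

  csum (fun k => qpoch (/ q ^ j) q k * qpoch (A * q ^ j) q k * qpoch X q k * q ^ k
                 / (qpoch q q k * qpoch (c * X) q k * qpoch (b * X) q k)) (S j)
  = qpoch b q j * qpoch c q j * X ^ j / (qpoch (c * X) q j * qpoch (b * X) q j).
Proof.
intros Hq0 HA Hq Hc Hb.
set (T := fun j k => qpoch (/ q ^ j) q k * qpoch (A * q ^ j) q k).
set (w := fun k => qpoch X q k * q ^ k
                 / (qpoch q q k * qpoch (c * X) q k * qpoch (b * X) q k)).
assert (E : forall n, csum (fun k => T j k * w k) n =
 csum (fun k => qpoch (/ q ^ j) q k * qpoch (A * q ^ j) q k * qpoch X q k * q ^ k
                 / (qpoch q q k * qpoch (c * X) q k * qpoch (b * X) q k)) n).
{ intros n. apply csum_ext. intros. unfold T, w. unfold Cdiv. ring. }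
rewrite <- E. clear E.
assert (Pq : forall k, qpoch q q k <> 0) by (intros; apply qpoch_neq0; auto).
assert (Pc : forall k, qpoch (c * X) q k <> 0) by (intros; apply qpoch_neq0; auto).
assert (Pb : forall k, qpoch (b * X) q k <> 0) by (intros; apply qpoch_neq0; auto).
induction j as [|j IH].
- unfold T, w; simpl. field.
(* The sum for j is prolonged by its vanishing term k = j + 1, so that both sums in the recurrence
   have the same range. *)
- assert (Hj : T j (S j) = 0).
  { unfold T. rewrite qpoch_inv_pow_zero; auto. ring. }
  assert (IH' : csum (fun k => T j k * w k) (S (S j)) =
     qpoch b q j * qpoch c q j * X ^ j / (qpoch (c * X) q j * qpoch (b * X) q j)).
  { rewrite <- IH. rewrite (csum_S _ (S j)), Hj. ring. }
  clear IH Hj.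
  set (Dn := (1 - c * X * q ^ j) * (1 - b * X * q ^ j)).
  set (Nn := X * (1 - b * q ^ j) * (1 - c * q ^ j)).
  (* Telescoping certificate, written with its index shifted by one, hence the separate value at 0.
     It vanishes at the upper end because (q^(-j); q)_(j+1) = 0. *)
  set (G := fun k => match k with O => RtoC 0 | S k =>
     (1 - A * q ^ (S (j + j))) * (qpoch (/ q ^ j) q k * qpoch (A * q ^ S j) q k)
      * qpoch X q (S k) / (qpoch q q k * qpoch (c * X) q k * qpoch (b * X) q k) end).
  assert (HT : csum (fun k => Dn * (T (S j) k * w k) + (- Nn) * (T j k * w k)) (S (S j))
               = G (S (S j)) - G O).
  { apply csum_telescope. intros k _. destruct k as [|k].
    - unfold Dn, Nn, T, w, G; simpl.
      rewrite Cpow_add_r.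
      replace (A * (q * (q ^ j * q ^ j))) with (b * c * X * q ^ j * q ^ j)
        by (rewrite <- HA; ring).
      field.
    - unfold Dn, Nn, T, w, G.
      rewrite (qpoch_inv_pow_S q j k Hq0).
      rewrite (qpoch_Sl (A * q ^ j)).
      replace (A * q ^ j * q) with (A * q ^ S j) by (rewrite Cpow_S; ring).
      rewrite !qpoch_S, !Cpow_S, Cpow_add_r.
      assert (q ^ j <> 0) by (apply Cpow_nz; auto).
      generalize (Pq k) (Pc k) (Pb k) (Hq k) (Hb k) (Hc k).
      assert (EA : A = b * c * X / q) by (rewrite <- HA; field; auto).
      rewrite EA.
      generalize (qpoch (/ q ^ j) q k) (qpoch (b * c * X / q * (q * q ^ j)) q k)
        (qpoch X q k) (qpoch q q k) (qpoch (c * X) q k) (qpoch (b * X) q k).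
      intros. field. repeat split; auto. }
  assert (HG : G (S (S j)) = 0).
  { unfold G. rewrite qpoch_inv_pow_zero; auto. unfold Cdiv; ring. }
  rewrite HG in HT. rewrite csum_plus, !csum_scal, IH' in HT.
  unfold Dn, Nn in HT. simpl G in HT.
  generalize (Pc j) (Pb j) (Hb j) (Hc j). intros.
  apply (Cmult_cancel ((1 - c * X * q ^ j) * (1 - b * X * q ^ j))).
  { apply Cmult_neq_0; auto. }
  apply Cminus_eq0. transitivity (0 - 0 : C); [|ring]. rewrite <- HT.
  rewrite !qpoch_S, Cpow_S. field; auto.
Qed.

(** The terminating very-well-poised 6-phi-5 sum, with Y = Aq/(de); then eY = Aq/d and dY = Aq/e are
    available without dividing by d or e. Same telescoping scheme as for the Saalschuetz sum, now in
    the length M. *)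
Lemma six_phi_five (A d e Y q : C) (M : nat) :
  q <> 0 -> A * q = d * e * Y ->
  (forall k, 1 - q * q ^ k <> 0) ->
  (forall k, 1 - e * Y * q ^ k <> 0) -> (forall k, 1 - d * Y * q ^ k <> 0) ->
  (forall k, 1 - A * q * q ^ k <> 0) ->
  csum (fun k => (1 - A * q ^ (2 * k)) * qpoch A q k * qpoch d q k * qpoch e q k
                 * qpoch (/ q ^ M) q k * (Y * q ^ M) ^ k
                 / (qpoch q q k * qpoch (e * Y) q k * qpoch (d * Y) q k
                    * qpoch (A * q * q ^ M) q k)) (S M)
  = (1 - A) * qpoch (A * q) q M * qpoch Y q M
    / (qpoch (e * Y) q M * qpoch (d * Y) q M).
Proof.
intros Hq0 HA Hq He Hd HA1.
assert (HA1' : forall m k, 1 - A * q * q ^ m * q ^ k <> 0).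
{ intros m k. generalize (HA1 (m + k)%nat). rewrite Cpow_add_r.
  intros H E. apply H. rewrite <- E. ring. }
assert (Pq : forall k, qpoch q q k <> 0) by (intros; apply qpoch_neq0; auto).
assert (Pe : forall k, qpoch (e * Y) q k <> 0) by (intros; apply qpoch_neq0; auto).
assert (Pd : forall k, qpoch (d * Y) q k <> 0) by (intros; apply qpoch_neq0; auto).
assert (PA : forall m k, qpoch (A * q * q ^ m) q k <> 0)
  by (intros; apply qpoch_neq0; auto).
assert (EA : A = d * e * Y / q) by (rewrite <- HA; field; auto).
set (w := fun k => (1 - A * q ^ (2 * k)) * qpoch A q k * qpoch d q k * qpoch e q k
                 / (qpoch q q k * qpoch (e * Y) q k * qpoch (d * Y) q k)).
set (F := fun j k => w k * (qpoch (/ q ^ j) q k * (Y * q ^ j) ^ k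
                    / qpoch (A * q * q ^ j) q k)).
assert (E : forall n, csum (fun k => (1 - A * q ^ (2 * k)) * qpoch A q k * qpoch d q k * qpoch e q k
                 * qpoch (/ q ^ M) q k * (Y * q ^ M) ^ k
                 / (qpoch q q k * qpoch (e * Y) q k * qpoch (d * Y) q k
                    * qpoch (A * q * q ^ M) q k)) n = csum (F M) n).
{ intros n. apply csum_ext. intros k _. unfold F, w. field. auto. }
rewrite E. clear E.
induction M as [|M IH].
- unfold F, w; simpl. field.
- assert (HM : F M (S M) = 0).
  { unfold F. rewrite qpoch_inv_pow_zero; auto. unfold Cdiv; ring. }
  assert (IH' : csum (F M) (S (S M)) = (1 - A) * qpoch (A * q) q M * qpoch Y q M
    / (qpoch (e * Y) q M * qpoch (d * Y) q M)).
  { rewrite csum_S, HM, IH. ring. }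
  clear IH HM.
  set (Dn := (1 - e * Y * q ^ M) * (1 - d * Y * q ^ M)).
  set (Nn := (1 - A * q * q ^ M) * (1 - Y * q ^ M)).
  set (G := fun k => match k with O => RtoC 0 | S k =>
     Y * q ^ M * qpoch (/ q ^ M) q k * (Y * q ^ M) ^ k
     * qpoch A q (S k) * qpoch d q (S k) * qpoch e q (S k)
     / (qpoch (A * q * q ^ S M) q k
        * qpoch q q k * qpoch (e * Y) q k * qpoch (d * Y) q k) end).
  assert (HT : csum (fun k => Dn * F (S M) k + (- Nn) * F M k) (S (S M))
               = G (S (S M)) - G O).
  { apply csum_telescope. intros k _.
    destruct k as [|k].
    - generalize (HA1 M) (HA1 (S M)). rewrite Cpow_S. intros H1 H2.
      unfold Dn, Nn, F, w, G; simpl.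
      rewrite EA in *.
      field. repeat split; auto; intros E0;
       solve [apply H2; rewrite <- E0; field; auto | apply H1; rewrite <- E0; field; auto].
    - unfold Dn, Nn, F, w, G.
      rewrite (qpoch_inv_pow_S q M k Hq0).
      assert (PAk := PA (S M) k). assert (HM0 := HA1 M). assert (HM1 := HA1 (S M)).
      assert (HAM := HA1' (S M) k).
      assert (HAM2 := HA1' (S (S M)) k).
            rewrite (qpoch_Sl (A * q * q ^ M) q k).
      replace (A * q * q ^ M * q) with (A * q * q ^ S M) by (rewrite Cpow_S; ring).
      replace (2 * S k)%nat with (S (S (k + k))) by lia.
      rewrite !qpoch_S.
      assert (H0 : q ^ M <> 0) by (apply Cpow_nz; auto).
      rewrite !Cpow_mult_l, !Cpow_S, !Cpow_mult_l.
      rewrite !Cpow_S in HM1, HAM, HAM2.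
      rewrite Cpow_add_r.
      generalize (Pq k) (Pd k) (Pe k) (Hq k) (Hd k) (He k) .
      revert PAk. rewrite !Cpow_S.
      rewrite EA in *.
      generalize (qpoch (/ q ^ M) q k) (qpoch (d * e * Y / q * q * (q * q ^ M)) q k)
        (qpoch (d * e * Y / q) q k) (qpoch d q k) (qpoch e q k)
        (qpoch q q k) (qpoch (e * Y) q k) (qpoch (d * Y) q k).
      intros.
      field. repeat split; auto; intros E0;
       solve [apply HAM; rewrite <- E0; field; auto | apply HM1; rewrite <- E0; field; auto
             | apply HM0; rewrite <- E0; field; auto]. }
  assert (HG : G (S (S M)) = 0).
  { unfold G. rewrite (qpoch_inv_pow_zero q M (S M)); auto. unfold Cdiv; ring. }
  rewrite HG in HT. rewrite csum_plus, !csum_scal, IH' in HT.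
  unfold Dn, Nn in HT. simpl G in HT.
  generalize (Pe M) (Pd M) (Hd M) (He M). intros.
  apply (Cmult_cancel ((1 - e * Y * q ^ M) * (1 - d * Y * q ^ M))).
  { apply Cmult_neq_0; auto. }
  apply Cminus_eq0. transitivity (0 - 0 : C); [|ring]. rewrite <- HT.
  rewrite !qpoch_S. field; auto.
Qed.

(** The usual formula for (q^(-N); q)_k as a quotient (q; q)_N / (q; q)_(N-k), with N = k + i. The
    sign and the power of q with a binomial exponent are hidden in (q^(-k); q)_k, which carries the
    same ones. *)
Lemma qpoch_inv_pow_shift (q : C) (k i : nat) :
  q <> 0 -> (forall k, 1 - q * q ^ k <> 0) ->
  qpoch (/ q ^ (k + i)) q k * q ^ (k * i) * qpoch q q i * qpoch q q k
  = qpoch (/ q ^ k) q k * qpoch q q (k + i).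
Proof.
intros Hq0 Hq. induction i as [|i IH].
- rewrite Nat.add_0_r, Nat.mul_0_r. simpl. ring.
- assert (Hp : forall n, q ^ n <> 0) by (intros; apply Cpow_nz; auto).
  rewrite Nat.add_succ_r, (qpoch_S q q (k + i)), qpoch_S, Nat.mul_succ_r, Cpow_add_r.
  transitivity ((1 - q * q ^ (k + i)) * (qpoch (/ q ^ k) q k * qpoch q q (k + i)));
    [|ring].
  rewrite <- IH. clear IH.
  assert (E := qpoch_inv_pow_S q (k + i) k Hq0). rewrite qpoch_S in E.
  apply (Cmult_cancel (1 - / q ^ S (k + i) * q ^ k)).
  + replace (1 - / q ^ S (k + i) * q ^ k) with (- (1 - q * q ^ i) / (q * q ^ i)).
    * intros H. apply (Hq i).
      transitivity (- (- (1 - q * q ^ i) / (q * q ^ i)) * (q * q ^ i)).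
      { field. auto. }
      rewrite H. ring.
    * rewrite Cpow_S, Cpow_add_r. field. auto.
  + transitivity (qpoch (/ q ^ S (k + i)) q k * (1 - / q ^ S (k + i) * q ^ k)
      * (q ^ (k * i) * q ^ k) * (qpoch q q i * (1 - q * q ^ i)) * qpoch q q k); [ring|].
    rewrite E. rewrite Cpow_S, Cpow_add_r. field. auto.
Qed.

(** In the applications (q^(-k); q)_k occurs squared, so its sign disappears and this relation
    suffices to eliminate it. *)
Lemma qpoch_inv_pow_sqr (q : C) (k : nat) : q <> 0 ->
  qpoch (/ q ^ k) q k * qpoch (/ q ^ k) q k * q ^ k * q ^ (k * k)
  = qpoch q q k * qpoch q q k.
Proof.
intros Hq0. induction k as [|k IH]; [simpl; ring|].
assert (q ^ k <> 0) by (apply Cpow_nz; auto).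
rewrite qpoch_inv_pow_S, qpoch_S by auto.
replace (S k * S k)%nat with (k * k + (k + S k))%nat by lia.
rewrite !Cpow_add_r, Cpow_S.
transitivity ((1 - q * q ^ k) * (1 - q * q ^ k) * (qpoch (/ q ^ k) q k * qpoch (/ q ^ k) q k * q ^ k * q ^ (k * k))).
- field. auto.
- rewrite IH. ring.
Qed.

(** The inner sum of Watson's transformation. The extra factor (q^(-j); q)_k (A q^j; q)_k kills the
    terms j < k; putting j = k + i and using (A; q)_j (A q^j; q)_k = (A; q)_(2k) (A q^(2k); q)_i
    gives a 6-phi-5 of length m with A q^(2k), d q^k, e q^k and the same Y. *)
Lemma shifted_six_phi_five (A d e Y q : C) (k m : nat) :
  q <> 0 -> A * q = d * e * Y ->
  (forall k, 1 - q * q ^ k <> 0) ->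
  (forall k, 1 - e * Y * q ^ k <> 0) -> (forall k, 1 - d * Y * q ^ k <> 0) ->
  (forall k, 1 - A * q * q ^ k <> 0) ->
  csum (fun j => (1 - A * q ^ (2 * j)) * qpoch A q j * qpoch d q j * qpoch e q j
                 * qpoch (/ q ^ (k + m)) q j * (Y * q ^ (k + m)) ^ j
                 / (qpoch q q j * qpoch (e * Y) q j * qpoch (d * Y) q j
                    * qpoch (A * q * q ^ (k + m)) q j)
                 * (qpoch (/ q ^ j) q k * qpoch (A * q ^ j) q k)) (S (k + m))
  * q ^ k
  = (1 - A) * qpoch (A * q) q (k + m) / (qpoch (e * Y) q (k + m) * qpoch (d * Y) q (k + m))
    * qpoch q q (k + m) / qpoch q q m * qpoch Y q m * Y ^ k * qpoch d q k * qpoch e q k.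
Proof.
intros Hq0 HA Hq He Hd HA1.
assert (Hp : forall n, q ^ n <> 0) by (intros; apply Cpow_nz; auto).
assert (Pq : forall k, qpoch q q k <> 0) by (intros; apply qpoch_neq0; auto).
assert (Pe : forall k, qpoch (e * Y) q k <> 0) by (intros; apply qpoch_neq0; auto).
assert (Pd : forall k, qpoch (d * Y) q k <> 0) by (intros; apply qpoch_neq0; auto).
assert (Hshift : forall x m, (forall k, 1 - x * q ^ k <> 0) ->
   forall k, 1 - x * q ^ m * q ^ k <> 0).
{ intros x m0 H k0. generalize (H (m0 + k0)%nat). rewrite Cpow_add_r.
  intros H1 E. apply H1. rewrite <- E. ring. }
assert (T2' : forall x, A * q * q ^ (2 * k) * q ^ m * q ^ x = A * q * q ^ (2 * k + m) * q ^ x)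
  by (intros; rewrite (Cpow_add_r q (2 * k)); ring).
assert (PA : forall m k, qpoch (A * q * q ^ m) q k <> 0)
  by (intros; apply qpoch_neq0; intros; apply Hshift; auto).
replace (S (k + m)) with (k + S m)%nat by lia. rewrite csum_split.
rewrite csum_zero.
2:{ intros j Hj. rewrite (qpoch_inv_pow_zero q j k); auto. ring. }
(* The part of the term j = k + i that does not depend on i. *)
set (K := qpoch d q k * qpoch e q k * qpoch A q (k + k) * qpoch (/ q ^ (k + m)) q k
   * (Y * q ^ (k + m)) ^ k / (qpoch (e * Y) q k * qpoch (d * Y) q k
       * qpoch (A * q * q ^ (k + m)) q k) * (qpoch (/ q ^ k) q k / qpoch q q k)).
assert (S1 := six_phi_five (A * q ^ (2 * k)) (d * q ^ k) (e * q ^ k) Y q m Hq0).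
assert (T1 : forall x, x * q ^ k * Y = x * Y * q ^ k) by (intros; ring).
rewrite !T1 in S1.
assert (T2 : A * q ^ (2 * k) * q = A * q * q ^ (2 * k)) by ring.
specialize (S1 ltac:(replace (2 * k)%nat with (k + k)%nat by lia; rewrite Cpow_add_r;
   transitivity (A * q * (q ^ k * q ^ k)); [ring| rewrite HA; ring]) Hq
   (Hshift _ k He) (Hshift _ k Hd) ltac:(rewrite T2; apply Hshift; auto)).
rewrite T2 in S1.
rewrite (csum_ext _ (fun i => K * ((1 - A * q ^ (2 * k) * q ^ (2 * i)) * qpoch (A * q ^ (2 * k)) q i *
          qpoch (d * q ^ k) q i * qpoch (e * q ^ k) q i *
          qpoch (/ q ^ m) q i * (Y * q ^ m) ^ i /
          (qpoch q q i * qpoch (e * Y * q ^ k) q i *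
           qpoch (d * Y * q ^ k) q i *
           qpoch (A * q * q ^ (2 * k) * q ^ m) q i)))).
- rewrite csum_scal, S1. unfold K.
  rewrite !(qpoch_add (e * Y)), !(qpoch_add (d * Y)).
  assert (EA : qpoch A q (k + k) * (1 - A * q ^ (2 * k)) * qpoch (A * q * q ^ (2 * k)) q m
     = (1 - A) * qpoch (A * q) q (k + m) * qpoch (A * q * q ^ (k + m)) q k).
  { rewrite <- Cmult_assoc with (x := 1 - A), <- qpoch_add, <- qpoch_Sl.
    replace (2 * k)%nat with (k + k)%nat by lia.
    rewrite <- qpoch_S. replace (A * q * q ^ (k + k)) with (A * q ^ (S (k + k))) by (rewrite Cpow_S; ring).
    rewrite <- qpoch_add. f_equal. lia. }
  assert (E1 := qpoch_inv_pow_shift q k m Hq0 Hq).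
  assert (E2 := qpoch_inv_pow_sqr q k Hq0).
  assert (E3 : qpoch (/ q ^ (k + m)) q k
     = qpoch (/ q ^ k) q k * qpoch q q (k + m) / (q ^ (k * m) * qpoch q q m * qpoch q q k)).
  { rewrite <- E1. field. auto. }
  rewrite E3.
  assert (E4 : (1 - A) * qpoch (A * q) q (k + m) =
    qpoch A q (k + k) * (1 - A * q ^ (2 * k)) * qpoch (A * q * q ^ (2 * k)) q m
      / qpoch (A * q * q ^ (k + m)) q k).
  { rewrite EA. field. apply PA. }
  rewrite E4.
  rewrite Cpow_mult_l, Cpow_add_r, Cpow_mult_l, <- !Cpow_mult_r.
  rewrite (Nat.mul_comm m k).
  assert (PAk := PA (k + m)%nat k). rewrite Cpow_add_r in PAk.
  generalize (Pe k) (Pd k) (Pq k) (Pq m).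
  assert (Pe' : qpoch (e * Y * q ^ k) q m <> 0) by (apply qpoch_neq0; intros; apply Hshift; auto).
  assert (Pd' : qpoch (d * Y * q ^ k) q m <> 0) by (apply qpoch_neq0; intros; apply Hshift; auto).
  intros.
  set (sg := qpoch (/ q ^ k) q k) in *.
  apply Cminus_eq0.
  (* The two sides agree only modulo the relation for [sg] squared; their difference is exhibited as
     a multiple of that relation, which [field] can check. *)
  lazymatch goal with |- @eq C (Cminus ?L ?R) _ =>
    transitivity (R * ((sg * sg * q ^ k * q ^ (k * k)) / (qpoch q q k * qpoch q q k) - 1)) end.
  + field. repeat split; auto.
  + rewrite E2. field. repeat split; auto.
- intros i _. unfold K.
  replace (2 * (k + i))%nat with (2 * k + 2 * i)%nat by lia.
  assert (E1 := qpoch_inv_pow_shift q k i Hq0 Hq).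
  assert (E2 : qpoch (/ q ^ (k + i)) q k
     = qpoch (/ q ^ k) q k * qpoch q q (k + i) / (q ^ (k * i) * qpoch q q i * qpoch q q k)).
  { rewrite <- E1. field. auto. }
  assert (E3 : qpoch A q (k + i) * qpoch (A * q ^ (k + i)) q k
     = qpoch A q (k + k) * qpoch (A * q ^ (2 * k)) q i).
  { replace (2 * k)%nat with (k + k)%nat by lia.
    rewrite <- !qpoch_add. f_equal. lia. }
  rewrite (qpoch_add (/ q ^ (k + m))), (qpoch_add d), (qpoch_add e), (qpoch_add (e * Y)),
    (qpoch_add (d * Y)), (qpoch_add (A * q * q ^ (k + m))).
  replace (/ q ^ (k + m) * q ^ k) with (/ q ^ m) by (rewrite Cpow_add_r; field; auto).
  replace (A * q * q ^ (k + m) * q ^ k) with (A * q * q ^ (2 * k) * q ^ m)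
    by (replace (2 * k)%nat with (k + k)%nat by lia; rewrite !Cpow_add_r; ring).
  rewrite E2.
  transitivity ((1 - A * q ^ (2 * k + 2 * i)) * (qpoch A q (k + i) * qpoch (A * q ^ (k + i)) q k)
    * (qpoch d q k * qpoch (d * q ^ k) q i) * (qpoch e q k * qpoch (e * q ^ k) q i) *
   (qpoch (/ q ^ (k + m)) q k * qpoch (/ q ^ m) q i) * (Y * q ^ (k + m)) ^ (k + i) /
   (qpoch (e * Y) q k * qpoch (e * Y * q ^ k) q i *
    (qpoch (d * Y) q k * qpoch (d * Y * q ^ k) q i) *
    (qpoch (A * q * q ^ (k + m)) q k * qpoch (A * q * q ^ (2 * k) * q ^ m) q i)) *
   (qpoch (/ q ^ k) q k / (q ^ (k * i) * qpoch q q i * qpoch q q k))).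
  + field. repeat split; auto; apply qpoch_neq0; intros; auto; rewrite T2'; auto.
  + rewrite E3.
    rewrite !Cpow_mult_l, !(Cpow_add_r (q ^ (k + m))), (Cpow_add_r Y), Cpow_add_r.
    replace ((q ^ (k + m)) ^ i) with (q ^ (k * i) * (q ^ m) ^ i)
      by (rewrite Cpow_add_r, Cpow_mult_l, Cpow_mult_r; ring).
    field. repeat split; auto; apply qpoch_neq0; intros; auto; rewrite T2'; auto.
Qed.

(** Bailey's argument: the part of the very-well-poised term containing b and c is expanded by the
    Saalschuetz sum, the summations are interchanged, and the inner one is a shifted 6-phi-5. The
    balanced side is written with factors of length M - k rather than as a 4-phi-3; this avoids the
    parameter q^(1-M)/Y and is the shape in which the connection coefficients arrive. *)
Lemma watson (A b c d e X Y q : C) (M : nat) :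
  q <> 0 -> A * q = b * c * X -> A * q = d * e * Y -> 1 - A <> 0 ->
  (forall k, 1 - q * q ^ k <> 0) ->
  (forall k, 1 - c * X * q ^ k <> 0) -> (forall k, 1 - b * X * q ^ k <> 0) ->
  (forall k, 1 - e * Y * q ^ k <> 0) -> (forall k, 1 - d * Y * q ^ k <> 0) ->
  (forall k, 1 - A * q * q ^ k <> 0) ->
  qpoch q q M
  * csum (fun k => qpoch (c * X * q ^ k) q (M - k) * qpoch Y q (M - k) * Y ^ k
                   * qpoch d q k * qpoch e q k * qpoch X q k
                   / (qpoch q q (M - k) * qpoch q q k * qpoch (b * X) q k)) (S M)
  = qpoch (c * X) q M * qpoch (e * Y) q M * qpoch (d * Y) q M / qpoch (A * q) q M
    * csum (fun j => (1 - A * q ^ (2 * j)) / (1 - A) * qpoch A q j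
              * qpoch d q j * qpoch e q j * qpoch b q j * qpoch c q j * qpoch (/ q ^ M) q j
              / (qpoch q q j * qpoch (e * Y) q j * qpoch (d * Y) q j
                 * qpoch (c * X) q j * qpoch (b * X) q j * qpoch (A * q * q ^ M) q j)
              * (X * Y * q ^ M) ^ j) (S M).
Proof.
intros Hq0 HA HA' HA0 Hq Hc Hb He Hd HA1.
assert (Pq : forall k, qpoch q q k <> 0) by (intros; apply qpoch_neq0; auto).
assert (Pe : forall k, qpoch (e * Y) q k <> 0) by (intros; apply qpoch_neq0; auto).
assert (Pd : forall k, qpoch (d * Y) q k <> 0) by (intros; apply qpoch_neq0; auto).
assert (Pc : forall k, qpoch (c * X) q k <> 0) by (intros; apply qpoch_neq0; auto).
assert (Pb : forall k, qpoch (b * X) q k <> 0) by (intros; apply qpoch_neq0; auto).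
assert (PA : forall k, qpoch (A * q) q k <> 0) by (intros; apply qpoch_neq0; auto).
assert (PA1 : forall k, qpoch (A * q * q ^ M) q k <> 0).
{ intros k E. apply (PA (M + k)%nat). rewrite qpoch_add, E. ring. }
set (F := fun j => (1 - A * q ^ (2 * j)) * qpoch A q j * qpoch d q j * qpoch e q j
                 * qpoch (/ q ^ M) q j * (Y * q ^ M) ^ j
                 / (qpoch q q j * qpoch (e * Y) q j * qpoch (d * Y) q j
                    * qpoch (A * q * q ^ M) q j)).
set (T := fun j k => qpoch (/ q ^ j) q k * qpoch (A * q ^ j) q k).
set (w := fun k => qpoch X q k / (qpoch q q k * qpoch (c * X) q k * qpoch (b * X) q k)).
rewrite (csum_ext (fun j => (1 - A * q ^ (2 * j)) / (1 - A) * _ * _ * _ * _ * _ * _ / _ * _)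
  (fun j => csum (fun k => / (1 - A) * (w k * (F j * T j k * q ^ k))) (S M))).
2:{ intros j Hj.
  transitivity (/ (1 - A) * (F j * csum (fun k => qpoch (/ q ^ j) q k * qpoch (A * q ^ j) q k * qpoch X q k * q ^ k
                 / (qpoch q q k * qpoch (c * X) q k * qpoch (b * X) q k)) (S M))).
  (* The Saalschuetz sum stops at k = j; the added terms up to M vanish and make the range square,
     so that [csum_swap] applies. *)
  - replace (S M) with (S j + (M - j))%nat by lia.
    rewrite csum_split, (saalschutz_well_poised b c X A q j Hq0 HA Hq Hc Hb), csum_zero.
    + unfold F. replace (X * Y * q ^ M) with (X * (Y * q ^ M)) by ring.
      rewrite (Cpow_mult_l X). field. repeat split; auto.
    + intros k _. rewrite (qpoch_inv_pow_zero q j); [unfold Cdiv; ring| auto | lia].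
  - rewrite <- !csum_scal. apply csum_ext. intros k _. unfold w, T. field. auto. }
rewrite csum_swap, <- !csum_scal. apply csum_ext. intros k Hk.
rewrite csum_scal, csum_scal.
assert (S1 := shifted_six_phi_five A d e Y q k (M - k) Hq0 HA' Hq He Hd HA1).
replace (k + (M - k))%nat with M in S1 by lia.
change (csum (fun j => F j * T j k) (S M) * q ^ k = (1 - A) * qpoch (A * q) q M / (qpoch (e * Y) q M * qpoch (d * Y) q M)
    * qpoch q q M / qpoch q q (M - k) * qpoch Y q (M - k) * Y ^ k * qpoch d q k * qpoch e q k) in S1.
rewrite (csum_ext _ (fun j => q ^ k * (F j * T j k))) by (intros; ring).
rewrite csum_scal, (Cmult_comm (q ^ k)), S1.
replace (qpoch (c * X) q M) with (qpoch (c * X) q k * qpoch (c * X * q ^ k) q (M - k))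
  by (rewrite <- qpoch_add; f_equal; lia).
unfold w. field. repeat split; auto.
Qed.

(** * Change of basis: connection coefficients and inversion of the Askey-Wilson expansion *)

Definition connection_coeff (s a q : C) (N k : nat) : C :=
  qpoch q q N / (qpoch q q k * qpoch q q (N - k))
  * qpoch (a * s * q ^ k) q (N - k) * qpoch (s / a) q (N - k) * (s / a) ^ k.

(** Induction on N. Since z z' = 1, the new factor (1 - s z q^N)(1 - s z' q^N) equals (s/a) q^(N-k)
    (1 - a z q^k)(1 - a z' q^k) + (1 - (s/a) q^(N-k))(1 - a s q^(N+k)) for every k: the first part
    raises the k-th basis element to the next one, the second is a scalar. *)
Lemma base_connection (s a q z z' : C) (N : nat) :
  a <> 0 -> z * z' = 1 -> (forall k, 1 - q * q ^ k <> 0) ->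
  qpoch (s * z) q N * qpoch (s * z') q N
  = csum (fun k => connection_coeff s a q N k * (qpoch (a * z) q k * qpoch (a * z') q k)) (S N).
Proof.
intros Ha Hz Hq.
assert (Pq : forall k, qpoch q q k <> 0) by (intros; apply qpoch_neq0; auto).
set (phi := fun k => qpoch (a * z) q k * qpoch (a * z') q k).
change (qpoch (s * z) q N * qpoch (s * z') q N
  = csum (fun k => connection_coeff s a q N k * phi k) (S N)).
induction N as [|N IH].
- unfold connection_coeff, phi; simpl. field. auto.
- set (u := fun k => connection_coeff s a q N k * (s / a * q ^ (N - k))).
  set (v := fun k => connection_coeff s a q N k * ((1 - s / a * q ^ (N - k)) * (1 - a * s * q ^ (N + k)))).
  (* Collecting by basis index, the new coefficient at k is u(k-1) + v(k). A partial sum has not yet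
     received u(n) at index n + 1, hence the correction term. *)
  assert (E : forall n, (n <= N)%nat ->
    csum (fun k => connection_coeff s a q (S N) k * phi k) (S n)
    = csum (fun k => u k * phi (S k) + v k * phi k) (S n) - u n * phi (S n)).
  { induction n as [|n IHn]; intros Hn.
    - simpl csum. unfold u, v, phi, connection_coeff.
      rewrite !Nat.sub_0_r, Nat.add_0_r. rewrite !qpoch_S. simpl.
      generalize (Pq N) (Hq N). intros.
      replace (a * s * 1) with (a * s) by ring.
      field. auto.
    - rewrite csum_S, IHn by lia. rewrite (csum_S _ (S n)).
      enough (connection_coeff s a q (S N) (S n) = u n + v (S n)) as -> by ring.
      unfold u, v, connection_coeff.
      remember (N - S n)%nat as l eqn:Hl.
      replace (S N - S n)%nat with (S l) by lia.
      replace (N - n)%nat with (S l) by lia.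
      replace N with (S n + l)%nat by lia.
      rewrite (qpoch_Sl (a * s * q ^ n)).
      replace (a * s * q ^ n * q) with (a * s * q ^ S n) by (rewrite Cpow_S; ring).
      rewrite !qpoch_S.
      generalize (Pq (S n + l)%nat) (Pq l) (Pq n) (Hq l) (Hq n) (Hq (S n + l)%nat). intros.
      replace (S n + l + S n)%nat with (S (S (n + n + l)))%nat by lia.
      replace (S n + l)%nat with (S (n + l)) by lia.
      rewrite !Cpow_S, !Cpow_add_r. field. auto. }
  rewrite csum_S, E by auto.
  replace (connection_coeff s a q (S N) (S N)) with (u N).
  2:{ unfold u, connection_coeff. rewrite !Nat.sub_diag. simpl.
      generalize (Pq N) (Hq N). intros. field. auto. }
  transitivity (csum (fun k => u k * phi (S k) + v k * phi k) (S N)); [|ring].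
  rewrite !qpoch_S.
  transitivity ((1 - s * z * q ^ N) * (1 - s * z' * q ^ N) * (qpoch (s * z) q N * qpoch (s * z') q N)); [ring|].
  rewrite IH, <- csum_scal. apply csum_ext. intros k Hk.
  unfold u, v, phi. rewrite !qpoch_S.
  replace (q ^ (N + k)) with (q ^ k * q ^ k * q ^ (N - k))
    by (rewrite <- !Cpow_add_r; f_equal; lia).
  replace (q ^ N) with (q ^ k * q ^ (N - k))
    by (rewrite <- Cpow_add_r; f_equal; lia).
  apply Cminus_eq0.
  match goal with |- @eq C (Cminus ?L ?R) _ =>
    transitivity (connection_coeff s a q N k * (qpoch (a * z) q k * qpoch (a * z') q k)
     * (s * s * q ^ k * q ^ k * q ^ (N - k) * q ^ (N - k)  - s * a * q ^ k * q ^ k * q ^ (N - k)) * (z * z' - 1)) end.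
  + field. auto.
  + rewrite Hz. ring.
Qed.

Definition aw_base_coeff (a b c d q : C) (m k : nat) : C :=
  / a ^ m * (qpoch (a * b) q m * qpoch (a * c) q m * qpoch (a * d) q m)
  * (qpoch (/ q ^ m) q k * qpoch (a * b * c * d * (q ^ m / q)) q k
     / (qpoch q q k * (qpoch (a * b) q k * qpoch (a * c) q k * qpoch (a * d) q k))
     * q ^ k).

Definition aw_inverse_norm (a b c d q : C) (n : nat) : C :=
  a ^ n / (qpoch (a * b) q n * qpoch (a * c) q n * qpoch (a * d) q n
           * (q ^ n * qpoch (/ q ^ n) q n * qpoch (a * b * c * d * (q ^ n / q)) q n)).

(** The coefficient of p_n in the k-th basis element, that is, the inverse of the triangular matrix
    [aw_base_coeff]. The test is there because k - n truncates to 0. [aw_inverse_norm] is what makes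
    the diagonal of the product equal to 1; its factor (q^(-n); q)_n is left unevaluated to avoid
    signs. *)
Definition aw_inverse_coeff (a b c d q : C) (k n : nat) : C :=
  if Nat.ltb k n then 0 else
  aw_inverse_norm a b c d q n
  * (qpoch (a * b) q k * qpoch (a * c) q k * qpoch (a * d) q k) * qpoch q q k
  / (qpoch q q (k - n) * qpoch (a * b * c * d * q ^ (2 * n)) q (k - n)).

Lemma qpoch_inv_pow_neq0 (q : C) (n : nat) :
  q <> 0 -> (forall k, 1 - q * q ^ k <> 0) -> qpoch (/ q ^ n) q n <> 0.
Proof.
intros Hq0 Hq E. assert (H := qpoch_inv_pow_sqr q n Hq0).
rewrite E in H. assert (Pq : qpoch q q n <> 0) by (apply qpoch_neq0; auto).
apply (Cmult_neq_0 _ _ Pq Pq). rewrite <- H. ring.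
Qed.

(** For m = n + r and k = n + i the sum becomes the balanced one in q^(-r) and [v]. For r > 0 its
    value contains (q^(1-r); q)_r = 0; for r = 0 one term remains. *)
Lemma aw_inversion (a b c d q : C) (m n : nat) :
  q <> 0 -> a <> 0 ->
  (forall k, 1 - q * q ^ k <> 0) ->
  (forall k, 1 - a * b * q ^ k <> 0) -> (forall k, 1 - a * c * q ^ k <> 0) ->
  (forall k, 1 - a * d * q ^ k <> 0) -> (forall k, 1 - a * b * c * d * q ^ k <> 0) ->
  csum (fun k => aw_base_coeff a b c d q m k * aw_inverse_coeff a b c d q k n) (S m)
  = if Nat.eqb m n then 1 else 0.
Proof.
intros Hq0 Ha Hq Hb Hc Hd HD.
assert (Hp : forall n, q ^ n <> 0) by (intros; apply Cpow_nz; auto).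
assert (Pq : forall k, qpoch q q k <> 0) by (intros; apply qpoch_neq0; auto).
assert (Pb : forall k, qpoch (a * b) q k <> 0) by (intros; apply qpoch_neq0; auto).
assert (Pc : forall k, qpoch (a * c) q k <> 0) by (intros; apply qpoch_neq0; auto).
assert (Pd : forall k, qpoch (a * d) q k <> 0) by (intros; apply qpoch_neq0; auto).
assert (HD2 : forall i k, 1 - a * b * c * d * q ^ i * q ^ k <> 0).
{ intros i k E. apply (HD (i + k)%nat). rewrite Cpow_add_r, <- E. ring. }
assert (PDn : qpoch (a * b * c * d * (q ^ n / q)) q n <> 0).
(* For n = 0 the parameter involves 1/q and 1 - abcd/q could vanish, but the product is empty; for n
   > 0 only nonnegative powers of q remain. The same case distinction recurs below. *)
{ destruct n as [|n']; [apply C1_nz|]. apply qpoch_neq0. intros i _.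
  rewrite Cpow_S. intros E. apply (HD2 n' i). rewrite <- E. field. auto. }
assert (Pi := qpoch_inv_pow_neq0 q n Hq0 Hq).
destruct (Nat.lt_ge_cases m n) as [Hmn|Hmn].
- rewrite (proj2 (Nat.eqb_neq m n)) by lia.
  apply csum_zero. intros k Hk. unfold aw_inverse_coeff.
  rewrite (proj2 (Nat.ltb_lt k n)) by lia. ring.
- remember (m - n)%nat as r eqn:Hr. replace m with (n + r)%nat by lia.
  clear Hmn Hr. replace (S (n + r)) with (n + S r)%nat by lia.
  rewrite csum_split, csum_zero.
  2:{ intros k Hk. unfold aw_inverse_coeff.
      rewrite (proj2 (Nat.ltb_lt k n)) by lia. ring. }
  set (v := a * b * c * d * (q ^ (n + r) / q) * q ^ n).
  assert (Hv : / q ^ r * v * q = a * b * c * d * q ^ (2 * n)).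
  { unfold v. replace (2 * n)%nat with (n + n)%nat by lia. rewrite !Cpow_add_r. field. auto. }
  assert (S1 := balanced_partial_sum (/ q ^ r) v q r Hq ltac:(rewrite Hv; apply HD2)).
  rewrite Hv in S1.
  rewrite (csum_ext _ (fun i => / a ^ (n + r) * (qpoch (a * b) q (n + r) * qpoch (a * c) q (n + r) * qpoch (a * d) q (n + r))
    * (qpoch (/ q ^ (n + r)) q n * qpoch (a * b * c * d * (q ^ (n + r) / q)) q n) * q ^ n
    * aw_inverse_norm a b c d q n
    * (qpoch (/ q ^ r) q i * qpoch v q i * q ^ i / (qpoch q q i * qpoch (a * b * c * d * q ^ (2 * n)) q i)))).
  + rewrite csum_scal, S1. destruct r as [|r].
    * rewrite !Nat.add_0_r, Nat.eqb_refl. unfold aw_inverse_norm. simpl qpoch.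
      assert (a ^ n <> 0) by (apply Cpow_nz; auto). field.
      repeat split; auto.
    * rewrite (proj2 (Nat.eqb_neq (n + S r) n)) by lia.
      rewrite Cinv_pow_S, (qpoch_inv_pow_zero q r (S r)); auto. unfold Cdiv. ring.
  + intros i _. unfold aw_inverse_coeff, aw_base_coeff.
    rewrite (proj2 (Nat.ltb_ge (n + i) n)) by lia.
    replace (n + i - n)%nat with i by lia.
    rewrite (qpoch_add (/ q ^ (n + r))), (qpoch_add (a * b * c * d * (q ^ (n + r) / q))).
    replace (/ q ^ (n + r) * q ^ n) with (/ q ^ r) by (rewrite Cpow_add_r; field; auto).
    fold v. rewrite (Cpow_add_r q n i).
    assert (qpoch (a * b * c * d * q ^ (2 * n)) q i <> 0) by (apply qpoch_neq0; auto).
    assert (a ^ (n + r) <> 0) by (apply Cpow_nz; auto).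
    field. repeat split; auto.
Qed.

(** The homogeneous form of t^n (s/t; q)_n: a polynomial in t and s, meaningful at t = 0 and at s =
    0. *)
Fixpoint qprod (t s q : C) (n : nat) : C :=
  match n with
  | O => 1
  | S m => qprod t s q m * (t - s * q ^ m)
  end.

Lemma qprod_scaled (t r q : C) (n : nat) :
  qprod t (t * r) q n = t ^ n * qpoch r q n.
Proof.
induction n as [|n IH]; simpl; [ring|]. rewrite IH; ring.
Qed.

(** The part of the j-th term of Phi_n that depends on t only through s = beta t, with d = a4. The
    two pairs of parameters with square roots have become (1 - A q^(2j))/(1 - A). *)
Definition vwp_coeff (n : nat) (s a b c d q : C) (j : nat) : C :=
  let A := q ^ (2 * n) / q * (a * b * c * s) in
  (1 - A * q ^ (2 * j)) / (1 - A) * qpoch A q j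
  * qpoch (a * b * q ^ n) q j * qpoch (a * c * q ^ n) q j
  * qpoch (b * c * q ^ n) q j * qpoch (s / d) q j
  / (qpoch q q j * qpoch (c * s * q ^ n) q j * qpoch (b * s * q ^ n) q j
     * qpoch (a * s * q ^ n) q j * qpoch (a * b * c * d * q ^ (2 * n)) q j).

(** Up to the factor h_n, the left-hand side is the integral of p_n against the polynomial kernel at
    t = s q^(n+M). Only k >= n contributes, and these terms form the balanced side of [watson] with
    length M. *)
Lemma connection_sum (n M : nat) (s a b c d q : C) :
  let N := (n + M)%nat in
  let t := s * q ^ N in
  let A := q ^ (2 * n) / q * (a * b * c * s) in
  q <> 0 -> a <> 0 -> d <> 0 -> 1 - A <> 0 ->
  (forall k, 1 - q * q ^ k <> 0) ->
  (forall k, 1 - a * b * q ^ k <> 0) -> (forall k, 1 - a * c * q ^ k <> 0) ->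
  (forall k, 1 - a * d * q ^ k <> 0) -> (forall k, 1 - a * b * c * d * q ^ k <> 0) ->
  (forall k, 1 - a * s * q ^ k <> 0) -> (forall k, 1 - b * s * q ^ k <> 0) ->
  (forall k, 1 - c * s * q ^ k <> 0) -> (forall k, 1 - a * b * c * s * q ^ k <> 0) ->
  csum (fun k => connection_coeff s a q N k * aw_inverse_coeff a b c d q k n) (S N)
  = qprod t s q n / (qpoch q q n * qpoch (a * b * c * d * (q ^ n / q)) q n)
    * (qpoch (a * s * q ^ n) q M * qpoch (b * s * q ^ n) q M * qpoch (c * s * q ^ n) q M
       / qpoch (A * q) q M)
    * csum (fun j => vwp_coeff n s a b c d q j
                     * ((d * t) ^ j * qpoch (/ q ^ M) q j / qpoch (A * q * q ^ M) q j)) (S M).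
Proof.
intros N t A Hq0 Ha Hd0 HA0 Hq Hb Hc Hd HD Has Hbs Hcs Habcs.
assert (Hp : forall n, q ^ n <> 0) by (intros; apply Cpow_nz; auto).
assert (Pq : forall k, qpoch q q k <> 0) by (intros; apply qpoch_neq0; auto).
assert (Hshift : forall x m, (forall k, 1 - x * q ^ k <> 0) ->
   forall k, 1 - x * q ^ m * q ^ k <> 0).
{ intros x m0 H k0. generalize (H (m0 + k0)%nat). rewrite Cpow_add_r.
  intros H1 E. apply H1. rewrite <- E. ring. }
assert (PD : forall j, qpoch (a * b * c * d * q ^ (2 * n)) q j <> 0)
  by (intros; apply qpoch_neq0; auto).
assert (Pbn : qpoch (a * b) q n <> 0) by (intros; apply qpoch_neq0; auto).
assert (Pcn : qpoch (a * c) q n <> 0) by (intros; apply qpoch_neq0; auto).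
assert (Pdn : qpoch (a * d) q n <> 0) by (intros; apply qpoch_neq0; auto).
assert (PDn : qpoch (a * b * c * d * (q ^ n / q)) q n <> 0).
{ destruct n as [|n']; [apply C1_nz|]. apply qpoch_neq0. intros i _.
  rewrite Cpow_S. intros E. apply (Hshift _ n' HD i). rewrite <- E. field. auto. }
assert (Pi := qpoch_inv_pow_neq0 q n Hq0 Hq).
assert (EA : A * q = a * b * c * s * q ^ (2 * n)) by (unfold A; field; auto).
assert (HA1 : forall k, 1 - A * q * q ^ k <> 0) by (rewrite EA; auto).
assert (E2n : q ^ (2 * n) = q ^ n * q ^ n).
{ replace (2 * n)%nat with (n + n)%nat by lia. apply Cpow_add_r. }
(* The parameters are read off the product of coefficients at k = n + i: Y = s/a and cX = a s q^n
   come from the connection coefficient; d, e and X from (ab, ac, ad; q)_k split at n; bX = abcd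
   q^(2n) from the denominator of the inverse coefficient. *)
assert (W := watson A (b * c * q ^ n) (s / d) (a * b * q ^ n) (a * c * q ^ n)
   (a * d * q ^ n) (s / a) q M Hq0
   ltac:(rewrite EA, E2n; field; auto) ltac:(rewrite EA, E2n; field; auto) HA0 Hq).
replace (s / d * (a * d * q ^ n)) with (a * s * q ^ n) in W by (field; auto).
replace (b * c * q ^ n * (a * d * q ^ n)) with (a * b * c * d * q ^ (2 * n)) in W by (rewrite E2n; ring).
replace (a * c * q ^ n * (s / a)) with (c * s * q ^ n) in W by (field; auto).
replace (a * b * q ^ n * (s / a)) with (b * s * q ^ n) in W by (field; auto).
replace (a * d * q ^ n * (s / a) * q ^ M) with (d * t) in W
  by (unfold t, N; rewrite Cpow_add_r; field; auto).
specialize (W (Hshift _ n Has) (Hshift _ (2 * n)%nat HD) (Hshift _ n Hcs) (Hshift _ n Hbs) HA1).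
transitivity (qprod t s q n / (qpoch q q n * qpoch (a * b * c * d * (q ^ n / q)) q n)
  * (qpoch (a * s * q ^ n) q M * qpoch (c * s * q ^ n) q M * qpoch (b * s * q ^ n) q M / qpoch (A * q) q M
    * csum (fun j => (1 - A * q ^ (2 * j)) / (1 - A) * qpoch A q j
              * qpoch (a * b * q ^ n) q j * qpoch (a * c * q ^ n) q j * qpoch (b * c * q ^ n) q j * qpoch (s / d) q j * qpoch (/ q ^ M) q j
              / (qpoch q q j * qpoch (c * s * q ^ n) q j * qpoch (b * s * q ^ n) q j
                 * qpoch (a * s * q ^ n) q j * qpoch (a * b * c * d * q ^ (2 * n)) q j * qpoch (A * q * q ^ M) q j)
              * (d * t) ^ j) (S M))).
2:{ rewrite Cmult_assoc. f_equal.
    - unfold Cdiv. ring.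
    - apply csum_ext. intros j _. unfold vwp_coeff. fold A.
      field. repeat split; auto; apply qpoch_neq0; intros; auto.
    }
rewrite <- W.
replace (S N) with (n + S M)%nat by (unfold N; lia).
rewrite csum_split, csum_zero.
2:{ intros k Hk. unfold aw_inverse_coeff.
    rewrite (proj2 (Nat.ltb_lt k n)) by lia. ring. }
rewrite <- !csum_scal. transitivity (csum (fun i => connection_coeff s a q N (n + i) * aw_inverse_coeff a b c d q (n + i) n) (S M)); [ring|].
apply csum_ext. intros i Hi.
unfold connection_coeff, aw_inverse_coeff, aw_inverse_norm.
rewrite (proj2 (Nat.ltb_ge (n + i) n)) by lia.
replace (N - (n + i))%nat with (M - i)%nat by (unfold N; lia).
replace (n + i - n)%nat with i by lia.
rewrite !(qpoch_add (a * b)), !(qpoch_add (a * c)), !(qpoch_add (a * d)).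
replace (a * s * q ^ (n + i)) with (a * s * q ^ n * q ^ i) by (rewrite Cpow_add_r; ring).
(* Here s = t q^(-N), so the homogeneous product is t^n (q^(-N); q)_n; this is matched below with
   the (q; q)_N of the connection coefficient. *)
assert (Et : qprod t s q n = s ^ n * (q ^ (n * n) * q ^ (n * M)) * qpoch (/ q ^ N) q n).
{ replace (q ^ (n * n) * q ^ (n * M)) with ((q ^ N) ^ n)
    by (rewrite <- Cpow_mult_r, <- Cpow_add_r; f_equal; unfold N; lia).
  rewrite <- Cpow_mult_l. fold t. rewrite <- qprod_scaled. f_equal.
  unfold t. field. auto. }
assert (E1 := qpoch_inv_pow_shift q n M Hq0 Hq). fold N in E1.
assert (E3 := qpoch_inv_pow_sqr q n Hq0).
assert (E4 : qpoch q q N = qpoch (/ q ^ N) q n * q ^ (n * M) * qpoch q q M * qpoch q q n / qpoch (/ q ^ n) q n).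
{ rewrite E1. field. auto. }
rewrite Et, E4.
rewrite !(Cpow_add_r (s / a)).
assert (Esa : (s / a) ^ n = s ^ n / a ^ n).
{ unfold Cdiv. rewrite Cpow_mult_l, Cpow_inv by auto. reflexivity. }
rewrite Esa.
assert (Han : a ^ n <> 0) by (apply Cpow_nz; auto).
apply Cminus_eq0.
set (sg := qpoch (/ q ^ n) q n) in *.
match goal with |- @eq C (Cminus ?L ?R) _ =>
    transitivity (R * ((qpoch q q n * qpoch q q n) / (sg * sg * q ^ n * q ^ (n * n)) - 1)) end.
- field. repeat split; auto.
- rewrite E3. field. auto.
Qed.

(** * Limits and series of complex numbers *)

(** Genuine convergence. [CLim] and [CSeries] take default values on divergent input, so all limits
    are handled through [Ccv] and transferred by [CLim_eq] and [CSeries_eq]. *)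
Definition Ccv (u : nat -> C) (l : C) : Prop :=
  forall eps : R, (0 < eps)%R ->
  exists N, forall n, (N <= n)%nat -> (Cmod (u n - l) < eps)%R.

Lemma Cmod_minus_sym (x y : C) : Cmod (x - y) = Cmod (y - x).
Proof. rewrite <- Cmod_opp. f_equal. ring. Qed.

Lemma Cmod_tri3 (x y z : C) : (Cmod (x - z) <= Cmod (x - y) + Cmod (y - z))%R.
Proof. replace (x - z) with ((x - y) + (y - z)) by ring. apply Cmod_triangle. Qed.

Lemma Cmod_le_diff (x y : C) : (Cmod x <= Cmod y + Cmod (x - y))%R.
Proof. replace x with (y + (x - y)) at 1 by ring. apply Cmod_triangle. Qed.

Lemma Ccv_unique (u : nat -> C) (l l' : C) : Ccv u l -> Ccv u l' -> l = l'.
Proof.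
intros H H'. apply Cminus_eq0. apply Cmod_eq_0.
destruct (Rle_lt_or_eq_dec _ _ (Cmod_ge_0 (l - l'))) as [Hl|Hl]; auto.
destruct (H (Cmod (l - l') / 2)%R) as [N HN]; [lra|].
destruct (H' (Cmod (l - l') / 2)%R) as [N' HN']; [lra|].
specialize (HN (N + N')%nat ltac:(lia)). specialize (HN' (N + N')%nat ltac:(lia)).
assert (T := Cmod_tri3 l (u (N + N')%nat) l'). rewrite (Cmod_minus_sym l (u _)) in T. lra.
Qed.

Lemma Ccv_const (c : C) : Ccv (fun _ => c) c.
Proof.
intros eps He. exists O. intros n _. replace (c - c) with (RtoC 0) by ring.
rewrite Cmod_0; auto.
Qed.

Lemma Ccv_ext (u v : nat -> C) (l : C) : (forall n, u n = v n) -> Ccv u l -> Ccv v l.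
Proof.
intros E H eps He. destruct (H eps He) as [N HN]. exists N. intros n Hn.
rewrite <- E. auto.
Qed.

Lemma Ccv_plus (u v : nat -> C) (l m : C) :
  Ccv u l -> Ccv v m -> Ccv (fun n => u n + v n) (l + m).
Proof.
intros H H' eps He.
destruct (H (eps / 2)%R) as [N HN]; [lra|]. destruct (H' (eps / 2)%R) as [N' HN']; [lra|].
exists (N + N')%nat. intros n Hn.
replace (u n + v n - (l + m)) with ((u n - l) + (v n - m)) by ring.
assert (T := Cmod_triangle (u n - l) (v n - m)).
specialize (HN n ltac:(lia)). specialize (HN' n ltac:(lia)). lra.
Qed.

Lemma Ccv_bounded (u : nat -> C) (l : C) : Ccv u l ->
  exists N, forall n, (N <= n)%nat -> (Cmod (u n) <= Cmod l + 1)%R.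
Proof.
intros H. destruct (H 1%R) as [N HN]; [lra|]. exists N. intros n Hn.
specialize (HN n Hn). assert (T := Cmod_le_diff (u n) l). lra.
Qed.

Lemma Ccv_mult (u v : nat -> C) (l m : C) :
  Ccv u l -> Ccv v m -> Ccv (fun n => u n * v n) (l * m).
Proof.
intros H H' eps He.
destruct (Ccv_bounded u l H) as [N0 HN0].
assert (Hl := Cmod_ge_0 l). assert (Hm := Cmod_ge_0 m).
destruct (H (eps / 2 / (Cmod m + 1))%R) as [N HN].
{ apply Rdiv_lt_0_compat; lra. }
destruct (H' (eps / 2 / (Cmod l + 1))%R) as [N' HN'].
{ apply Rdiv_lt_0_compat; lra. }
exists (N0 + N + N')%nat. intros n Hn.
specialize (HN0 n ltac:(lia)). specialize (HN n ltac:(lia)). specialize (HN' n ltac:(lia)).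
replace (u n * v n - l * m) with (u n * (v n - m) + (u n - l) * m) by ring.
eapply Rle_lt_trans; [apply Cmod_triangle|]. rewrite !Cmod_mult.
apply Rlt_le_trans with (eps / 2 + eps / 2)%R; [|lra].
apply Rplus_lt_le_compat.
- apply Rle_lt_trans with ((Cmod l + 1) * Cmod (v n - m))%R.
  + apply Rmult_le_compat_r; auto. apply Cmod_ge_0.
  + replace (eps / 2)%R with ((Cmod l + 1) * (eps / 2 / (Cmod l + 1)))%R by (field; lra).
    apply Rmult_lt_compat_l; lra.
- apply Rle_trans with (eps / 2 / (Cmod m + 1) * Cmod m)%R.
  + apply Rmult_le_compat_r; lra.
  + apply Rle_trans with (eps / 2 / (Cmod m + 1) * (Cmod m + 1))%R.
    * apply Rmult_le_compat_l; [|lra]. apply Rlt_le, Rdiv_lt_0_compat; lra.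
    * right. field. lra.
Qed.

Lemma Ccv_scal (c : C) (u : nat -> C) (l : C) : Ccv u l -> Ccv (fun n => c * u n) (c * l).
Proof. intros H. apply Ccv_mult; auto. apply Ccv_const. Qed.

Lemma Ccv_minus (u v : nat -> C) (l m : C) :
  Ccv u l -> Ccv v m -> Ccv (fun n => u n - v n) (l - m).
Proof.
intros H H'. apply (Ccv_ext (fun n => u n + (-1) * v n)); [intros; ring|].
replace (l - m) with (l + (-1) * m) by ring. apply Ccv_plus; auto. apply Ccv_scal; auto.
Qed.

Lemma Ccv_inv (u : nat -> C) (l : C) : l <> 0 -> (forall n, u n <> 0) ->
  Ccv u l -> Ccv (fun n => / u n) (/ l).
Proof.
intros Hl Hu H eps He.
assert (Hl' : (0 < Cmod l)%R) by (apply Cmod_gt_0; auto).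
destruct (H (Cmod l / 2)%R) as [N0 HN0]; [lra|].
destruct (H (eps * (Cmod l * Cmod l / 2))%R) as [N HN].
{ apply Rmult_lt_0_compat; auto. assert (0 < Cmod l * Cmod l)%R by (apply Rmult_lt_0_compat; auto). lra. }
exists (N0 + N)%nat. intros n Hn.
specialize (HN0 n ltac:(lia)). specialize (HN n ltac:(lia)).
assert (Hun : (Cmod l / 2 <= Cmod (u n))%R).
{ assert (T := Cmod_le_diff l (u n)). rewrite Cmod_minus_sym in T. lra. }
assert (Hun' : (0 < Cmod (u n))%R) by (apply Cmod_gt_0; auto).
replace (/ u n - / l) with ((l - u n) / (u n * l)) by (field; auto).
rewrite Cmod_div, Cmod_mult, Cmod_minus_sym by (apply Cmod_gt_0; rewrite Cmod_mult; apply Rmult_lt_0_compat; auto).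
apply Rle_lt_trans with (Cmod (u n - l) / (Cmod l / 2 * Cmod l))%R.
- apply Rmult_le_compat_l; [apply Cmod_ge_0|].
  apply Rinv_le_contravar; [apply Rmult_lt_0_compat; lra|].
  apply Rmult_le_compat_r; lra.
- apply Rmult_lt_reg_r with (Cmod l / 2 * Cmod l)%R; [apply Rmult_lt_0_compat; lra|].
  unfold Rdiv at 1. rewrite Rmult_assoc, Rinv_l, Rmult_1_r; [lra|].
  apply Rgt_not_eq. apply Rmult_lt_0_compat; lra.
Qed.

Lemma Ccv_S (u : nat -> C) (l : C) : Ccv u l -> Ccv (fun n => u (S n)) l.
Proof.
intros H eps He. destruct (H eps He) as [N HN]. exists N. intros; apply HN; lia.
Qed.

Lemma Ccv_of_S (u : nat -> C) (l : C) : Ccv (fun n => u (S n)) l -> Ccv u l.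
Proof.
intros H eps He. destruct (H eps He) as [N HN]. exists (S N). intros n Hn.
destruct n; [lia|]. apply HN; lia.
Qed.

Lemma Ccv_shift (u : nat -> C) (m : nat) (l : C) : Ccv u l -> Ccv (fun n => u (m + n)%nat) l.
Proof.
intros H eps He. destruct (H eps He) as [N HN]. exists N. intros; apply HN; lia.
Qed.

Lemma Ccv_Cmod_le (u : nat -> C) (l : C) (B : R) :
  (forall n, (Cmod (u n) <= B)%R) -> Ccv u l -> (Cmod l <= B)%R.
Proof.
intros HB H. destruct (Rle_dec (Cmod l) B) as [|Hn]; auto.
destruct (H (Cmod l - B)%R) as [N HN]; [lra|]. specialize (HN N ltac:(lia)).
assert (T := Cmod_le_diff l (u N)). rewrite Cmod_minus_sym in T. specialize (HB N). lra.
Qed.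

Lemma Ccv_Cmod_ge (u : nat -> C) (l : C) (B : R) :
  (forall n, (B <= Cmod (u n))%R) -> Ccv u l -> (B <= Cmod l)%R.
Proof.
intros HB H. destruct (Rle_dec B (Cmod l)) as [|Hn]; auto.
destruct (H (B - Cmod l)%R) as [N HN]; [lra|]. specialize (HN N ltac:(lia)).
assert (T := Cmod_le_diff (u N) l). specialize (HB N). lra.
Qed.

Lemma Ccv_squeeze (u : nat -> C) (l : C) (eps : nat -> R) :
  (forall n, (Cmod (u n - l) <= eps n)%R) -> Un_cv eps 0 -> Ccv u l.
Proof.
intros Hu He e Hpos. destruct (He e Hpos) as [N HN]. exists N. intros n Hn.
specialize (HN n Hn). specialize (Hu n). unfold Rdist in HN.
rewrite Rminus_0_r in HN. assert (T := Rle_abs (eps n)). lra.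
Qed.

Lemma Cmod_le_Rabs (z : C) : (Cmod z <= Rabs (Re z) + Rabs (Im z))%R.
Proof.
destruct z as [x y]. simpl.
replace ((x, y) : C) with (RtoC x + Ci * RtoC y).
- eapply Rle_trans; [apply Cmod_triangle|]. rewrite Cmod_mult, !Cmod_R, Cmod_Ci. lra.
- unfold Ci, RtoC, Cplus, Cmult; simpl; f_equal; ring.
Qed.

Lemma im_le_Cmod (z : C) : (Rabs (Im z) <= Cmod z)%R.
Proof.
destruct z as [x y]. eapply Rle_trans; [|apply Rmax_Cmod]. apply Rmax_r.
Qed.

Lemma Ccv_Re_Im (u : nat -> C) (l : C) :
  Ccv u l -> is_lim_seq (fun n => Re (u n)) (Re l) /\ is_lim_seq (fun n => Im (u n)) (Im l).
Proof.
intros H. split; apply is_lim_seq_spec; intros eps.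
- destruct (H eps (cond_pos eps)) as [N HN]. exists N. intros n Hn.
  eapply Rle_lt_trans; [|apply (HN n Hn)].
  replace (Re (u n) - Re l)%R with (Re (u n - l)) by (unfold Cminus, Re; simpl; ring).
  apply re_le_Cmod.
- destruct (H eps (cond_pos eps)) as [N HN]. exists N. intros n Hn.
  eapply Rle_lt_trans; [|apply (HN n Hn)].
  replace (Im (u n) - Im l)%R with (Im (u n - l)) by (unfold Cminus, Im; simpl; ring).
  apply im_le_Cmod.
Qed.

Lemma CLim_eq (u : nat -> C) (l : C) : Ccv u l -> CLim u = l.
Proof.
intros H. destruct (Ccv_Re_Im u l H) as [H1 H2]. unfold CLim.
rewrite (is_lim_seq_unique _ _ H1), (is_lim_seq_unique _ _ H2). simpl.
symmetry. apply surjective_pairing.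
Qed.

Lemma Re_csum (u : nat -> C) (n : nat) : Re (csum u (S n)) = sum_n (fun k => Re (u k)) n.
Proof.
induction n as [|n IH].
- rewrite sum_O. f_equal. rewrite csum_S. change (csum u 0) with (RtoC 0). ring.
- rewrite sum_Sn, <- IH. reflexivity.
Qed.

Lemma Im_csum (u : nat -> C) (n : nat) : Im (csum u (S n)) = sum_n (fun k => Im (u k)) n.
Proof.
induction n as [|n IH].
- rewrite sum_O. f_equal. rewrite csum_S. change (csum u 0) with (RtoC 0). ring.
- rewrite sum_Sn, <- IH. reflexivity.
Qed.

Lemma CSeries_eq (u : nat -> C) (l : C) : Ccv (csum u) l -> CSeries u = l.
Proof.
intros H. apply Ccv_S, Ccv_Re_Im in H. destruct H as [H1 H2].
apply (is_lim_seq_ext _ _ _ (Re_csum u)) in H1.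
apply (is_lim_seq_ext _ _ _ (Im_csum u)) in H2.
unfold CSeries, Series.
rewrite (is_lim_seq_unique _ _ H1), (is_lim_seq_unique _ _ H2). simpl.
symmetry. apply surjective_pairing.
Qed.

Lemma Ccv_cauchy (u : nat -> C) :
  (forall eps : R, (0 < eps)%R -> exists N, forall n m, (N <= n)%nat ->
     (Cmod (u (n + m)%nat - u n) < eps)%R) ->
  exists l, Ccv u l.
Proof.
intros H.
assert (HR : forall f : C -> R, (forall x y, (Rabs (f x - f y) <= Cmod (x - y))%R) ->
   exists l, Un_cv (fun n => f (u n)) l).
{ intros f Hf.
  enough (Hc : Cauchy_crit (fun n => f (u n))).
  { destruct (Rcomplete.R_complete _ Hc) as [l Hl]. exists l; auto. }
  intros eps He. destruct (H (eps / 2)%R) as [N HN]; [lra|]. exists N. intros n m Hn Hm.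
  unfold Rdist. eapply Rle_lt_trans; [apply Hf|].
  assert (E1 := HN N (n - N)%nat ltac:(lia)). assert (E2 := HN N (m - N)%nat ltac:(lia)).
  replace (N + (n - N))%nat with n in E1 by lia.
  replace (N + (m - N))%nat with m in E2 by lia.
  assert (T := Cmod_tri3 (u n) (u N) (u m)). rewrite (Cmod_minus_sym (u N)) in T. lra. }
destruct (HR Re) as [x Hx].
{ intros a b. replace (Re a - Re b)%R with (Re (a - b)) by (unfold Cminus, Re; simpl; ring).
  apply re_le_Cmod. }
destruct (HR Im) as [y Hy].
{ intros a b. replace (Im a - Im b)%R with (Im (a - b)) by (unfold Cminus, Im; simpl; ring).
  apply im_le_Cmod. }
exists (x, y). intros eps He.
destruct (Hx (eps / 2)%R) as [N HN]; [lra|]. destruct (Hy (eps / 2)%R) as [N' HN']; [lra|].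
exists (N + N')%nat. intros n Hn.
specialize (HN n ltac:(lia)). specialize (HN' n ltac:(lia)).
eapply Rle_lt_trans; [apply Cmod_le_Rabs|]. unfold Rdist in *.
replace (Re (u n - (x, y))) with (Re (u n) - x)%R by (unfold Cminus, Re; simpl; ring).
replace (Im (u n - (x, y))) with (Im (u n) - y)%R by (unfold Cminus, Im; simpl; ring).
lra.
Qed.

(** * Dominated series *)

Fixpoint rsum (f : nat -> R) (n : nat) : R :=
  match n with
  | O => 0%R
  | S m => (rsum f m + f m)%R
  end.

Definition summable (M : nat -> R) : Prop :=
  (forall k, (0 <= M k)%R) /\ exists B, forall n, (rsum M n <= B)%R.

Lemma rsum_S (f : nat -> R) (n : nat) : rsum f (S n) = (rsum f n + f n)%R.
Proof. reflexivity. Qed.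

Lemma rsum_split (f : nat -> R) (n m : nat) :
  rsum f (n + m) = (rsum f n + rsum (fun k => f (n + k)%nat) m)%R.
Proof.
induction m as [|m IH]; simpl.
- rewrite Nat.add_0_r; ring.
- rewrite Nat.add_succ_r; simpl; rewrite IH; ring.
Qed.

Lemma rsum_le (f g : nat -> R) (n : nat) :
  (forall k, (f k <= g k)%R) -> (rsum f n <= rsum g n)%R.
Proof. intros H. induction n as [|n IH]; simpl; [lra | specialize (H n); lra]. Qed.

Lemma rsum_scal (c : R) (f : nat -> R) (n : nat) :
  rsum (fun k => (c * f k)%R) n = (c * rsum f n)%R.
Proof. induction n as [|n IH]; simpl; [ring | rewrite IH; ring]. Qed.

Lemma rsum_ge0 (f : nat -> R) (n : nat) : (forall k, (0 <= f k)%R) -> (0 <= rsum f n)%R.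
Proof. intros H. induction n as [|n IH]; simpl; [lra | specialize (H n); lra]. Qed.

Lemma summable_scal (c : R) (M : nat -> R) :
  (0 <= c)%R -> summable M -> summable (fun k => (c * M k)%R).
Proof.
intros Hc [HM [B HB]]. split.
- intros k. apply Rmult_le_pos; auto.
- exists (c * B)%R. intros n. rewrite rsum_scal. apply Rmult_le_compat_l; auto.
Qed.

Lemma summable_tail (M : nat -> R) : summable M -> forall eps : R, (0 < eps)%R ->
  exists N, forall n m, (N <= n)%nat -> (rsum (fun k => M (n + k)%nat) m < eps)%R.
Proof.
intros [HM [B HB]] eps He.
assert (Hg : Un_growing (rsum M)) by (intros n; simpl; specialize (HM n); lra).
assert (Hb : has_ub (rsum M)) by (exists B; intros x [i ->]; apply HB).
destruct (growing_cv (rsum M) Hg Hb) as [l Hl].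
destruct (CV_Cauchy (rsum M) (exist _ l Hl) eps He) as [N HN].
  exists N. intros n m Hn.
  specialize (HN (n + m)%nat n ltac:(lia) ltac:(lia)). unfold Rdist in HN.
  rewrite rsum_split in HN.
  replace (rsum M n + rsum (fun k => M (n + k)%nat) m - rsum M n)%R
    with (rsum (fun k => M (n + k)%nat) m) in HN by ring.
  assert (T := Rle_abs (rsum (fun k => M (n + k)%nat) m)). lra.
Qed.

Lemma Cmod_csum (u : nat -> C) (M : nat -> R) (n : nat) :
  (forall k, (Cmod (u k) <= M k)%R) -> (Cmod (csum u n) <= rsum M n)%R.
Proof.
intros H. induction n as [|n IH]; simpl.
- rewrite Cmod_0. lra.
- eapply Rle_trans; [apply Cmod_triangle|]. specialize (H n). lra.
Qed.

Lemma csum_cv (u : nat -> C) (M : nat -> R) :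
  summable M -> (forall k, (Cmod (u k) <= M k)%R) -> exists l, Ccv (csum u) l.
Proof.
intros HM Hu. apply Ccv_cauchy. intros eps He.
destruct (summable_tail M HM eps He) as [N HN]. exists N. intros n m Hn.
rewrite csum_split.
replace (csum u n + csum (fun k => u (n + k)%nat) m - csum u n)
  with (csum (fun k => u (n + k)%nat) m) by ring.
eapply Rle_lt_trans; [|apply (HN n m Hn)]. apply Cmod_csum; auto.
Qed.

Lemma csum_limit_tail (u : nat -> C) (M : nat -> R) (l : C) (N : nat) (e : R) :
  (forall k, (Cmod (u k) <= M k)%R) -> Ccv (csum u) l ->
  (forall m, (rsum (fun k => M (N + k)%nat) m <= e)%R) ->
  (Cmod (l - csum u N) <= e)%R.
Proof.
intros Hu Hl He.
apply (Ccv_Cmod_le (fun m => csum u (N + m) - csum u N)).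
- intros m. rewrite csum_split.
  replace (csum u N + csum (fun k => u (N + k)%nat) m - csum u N)
   with (csum (fun k => u (N + k)%nat) m) by ring.
  eapply Rle_trans; [|apply (He m)]. apply Cmod_csum; auto.
- apply Ccv_minus; [|apply Ccv_const]. apply (Ccv_shift (csum u)); auto.
Qed.

Lemma Ccv_csum (u : nat -> nat -> C) (v : nat -> C) (n : nat) :
  (forall k, Ccv (fun K => u K k) (v k)) -> Ccv (fun K => csum (u K) n) (csum v n).
Proof.
intros H. induction n as [|n IH]; simpl.
- apply Ccv_const.
- apply Ccv_plus; auto.
Qed.

(** Dominated convergence for series: past some N the tails of all the series, limit included, are
    small uniformly in K, and the first N terms converge one by one. *)
Lemma tannery (u : nat -> nat -> C) (v U : nat -> C) (M : nat -> R) :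
  summable M -> (forall K k, (Cmod (u K k) <= M k)%R) ->
  (forall k, Ccv (fun K => u K k) (v k)) ->
  (forall K, Ccv (csum (u K)) (U K)) ->
  exists V, Ccv (csum v) V /\ Ccv U V.
Proof.
intros HM Hu Hv HU.
assert (Hvb : forall k, (Cmod (v k) <= M k)%R).
{ intros k. apply (Ccv_Cmod_le (fun K => u K k)); auto. }
destruct (csum_cv v M HM Hvb) as [V HV]. exists V. split; auto.
intros eps He. destruct (summable_tail M HM (eps / 3)%R) as [N HN]; [lra|].
destruct (Ccv_csum u v N Hv (eps / 3)%R) as [K0 HK]; [lra|].
exists K0. intros K HK0. specialize (HK K HK0).
assert (T1 := csum_limit_tail (u K) M (U K) N (eps / 3) (Hu K) (HU K)
   (fun m => Rlt_le _ _ (HN N m (le_n N)))).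
assert (T2 := csum_limit_tail v M V N (eps / 3) Hvb HV
   (fun m => Rlt_le _ _ (HN N m (le_n N)))).
assert (T3 := Cmod_tri3 (U K) (csum (u K) N) V).
assert (T4 := Cmod_tri3 (csum (u K) N) (csum v N) V).
rewrite (Cmod_minus_sym (csum v N)) in T4. lra.
Qed.

Lemma rsum_pow (r : R) (n : nat) : (0 <= r < 1)%R -> (rsum (fun k => r ^ k)%R n <= / (1 - r))%R.
Proof.
intros Hr.
assert (E : (rsum (fun k => r ^ k)%R n = (1 - r ^ n) / (1 - r))%R).
{ induction n as [|n IH]; simpl; [field; lra|]. rewrite IH. field. lra. }
rewrite E. unfold Rdiv. rewrite <- (Rmult_1_l (/ (1 - r))) at 2.
apply Rmult_le_compat_r.
- apply Rlt_le, Rinv_0_lt_compat; lra.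
- assert (0 <= r ^ n)%R by (apply pow_le; lra). lra.
Qed.

Lemma summable_pow (r : R) : (0 <= r < 1)%R -> summable (fun k => (r ^ k)%R).
Proof.
intros Hr. split.
- intros k. apply pow_le; lra.
- exists (/ (1 - r))%R. intros; apply rsum_pow; auto.
Qed.

(** * Infinite q-shifted factorials and power series *)

Lemma one_minus_neq0 (z : C) : (Cmod z < 1)%R -> 1 - z <> 0.
Proof.
intros H E. apply Cminus_eq0 in E. rewrite <- E, Cmod_1 in H. lra.
Qed.

Lemma Cmod_mul_pow_le (a q : C) (k : nat) : (Cmod q < 1)%R -> (Cmod (a * q ^ k) <= Cmod a)%R.
Proof.
intros Hq. rewrite Cmod_mult, Cmod_pow.
assert (H := Cmod_ge_0 q). assert (H1 : (Cmod q ^ k <= 1)%R).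
{ rewrite <- (pow1 k). apply pow_incr; lra. }
rewrite <- (Rmult_1_r (Cmod a)) at 2. apply Rmult_le_compat_l; auto. apply Cmod_ge_0.
Qed.

Lemma one_minus_pow_neq0 (a q : C) : (Cmod q < 1)%R -> (Cmod a < 1)%R ->
  forall k, 1 - a * q ^ k <> 0.
Proof.
intros Hq Ha k. apply one_minus_neq0. eapply Rle_lt_trans; [apply Cmod_mul_pow_le|]; auto.
Qed.

Lemma geometric_weight_le (x r : R) (n : nat) : (0 <= x)%R -> (0 <= r < 1)%R ->
  (x * rsum (fun k => r ^ k)%R n <= x / (1 - r))%R.
Proof. intros Hx Hr. apply Rmult_le_compat_l; auto. apply rsum_pow; auto. Qed.

Lemma exp_le (x y : R) : (x <= y)%R -> (exp x <= exp y)%R.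
Proof. intros [H| ->]; [left; apply exp_increasing; auto | right; auto]. Qed.

Lemma qpoch_bound_partial (a q : C) (n : nat) :
  (Cmod (qpoch a q n) <= exp (Cmod a * rsum (fun k => Cmod q ^ k)%R n))%R.
Proof.
induction n as [|n IH]; simpl.
- rewrite Cmod_1, Rmult_0_r, exp_0. lra.
- rewrite Cmod_mult, Rmult_plus_distr_l, exp_plus.
  apply Rmult_le_compat; auto using Cmod_ge_0.
  eapply Rle_trans; [apply Cmod_triangle|]. rewrite Cmod_1, Cmod_opp, Cmod_mult, Cmod_pow.
  apply exp_ineq1_le.
Qed.

Lemma qpoch_bound (a q : C) (n : nat) : (Cmod q < 1)%R ->
  (Cmod (qpoch a q n) <= exp (Cmod a / (1 - Cmod q)))%R.
Proof.
intros Hq. eapply Rle_trans; [apply qpoch_bound_partial|]. apply exp_le.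
apply geometric_weight_le; [apply Cmod_ge_0|]. split; auto. apply Cmod_ge_0.
Qed.

Lemma qpoch_near_one (a q : C) (n : nat) : (Cmod q < 1)%R ->
  (Cmod (qpoch a q n - 1) <= exp (Cmod a / (1 - Cmod q)) * (Cmod a / (1 - Cmod q)))%R.
Proof.
intros Hq. assert (Hq0 := Cmod_ge_0 q).
apply Rle_trans with (exp (Cmod a / (1 - Cmod q)) * (Cmod a * rsum (fun k => Cmod q ^ k)%R n))%R.
- induction n as [|n IH]; simpl.
  + replace (1 - 1) with (RtoC 0) by ring. rewrite Cmod_0, !Rmult_0_r. lra.
  + replace (qpoch a q n * (1 - a * q ^ n) - 1)
      with ((qpoch a q n - 1) + - (qpoch a q n * (a * q ^ n))) by ring.
    eapply Rle_trans; [apply Cmod_triangle|]. rewrite Rmult_plus_distr_l, Rmult_plus_distr_l.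
    apply Rplus_le_compat; auto. rewrite Cmod_opp, Cmod_mult.
    apply Rmult_le_compat; auto using Cmod_ge_0, qpoch_bound.
    rewrite Cmod_mult, Cmod_pow. lra.
- apply Rmult_le_compat_l; [left; apply exp_pos|].
  apply geometric_weight_le; [apply Cmod_ge_0 | lra].
Qed.

(** A lower bound for |(a; q)_n| valid for all n and all |a| <= rho < 1: each factor is at least 1 -
    rho |q|^k >= exp(- rho |q|^k / (1 - rho)), and the exponents form a geometric series. *)
Definition qpoch_lower (rho : R) (q : C) : R := exp (- (rho / (1 - rho) / (1 - Cmod q))).

Lemma one_minus_ge_exp (x rho : R) : (0 <= x <= rho)%R -> (rho < 1)%R ->
  (exp (- (x / (1 - rho))) <= 1 - x)%R.
Proof.
intros Hx Hr. rewrite exp_Ropp.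
assert (H := exp_ineq1_le (x / (1 - rho))).
assert (0 <= x / (1 - rho))%R by (apply Rdiv_le_0_compat; lra).
apply Rle_trans with (/ (1 + x / (1 - rho)))%R.
- apply Rinv_le_contravar; lra.
- apply Rmult_le_reg_l with (1 + x / (1 - rho))%R; [lra|].
  rewrite Rinv_r by lra.
  replace ((1 + x / (1 - rho)) * (1 - x))%R with (1 + x * (rho - x) / (1 - rho))%R by (field; lra).
  assert (0 <= x * (rho - x) / (1 - rho))%R; [|lra].
  apply Rdiv_le_0_compat; [|lra]. apply Rmult_le_pos; lra.
Qed.

Lemma qpoch_lower_bound (rho : R) (a q : C) (n : nat) :
  (Cmod q < 1)%R -> (Cmod a <= rho)%R -> (rho < 1)%R ->
  (qpoch_lower rho q <= Cmod (qpoch a q n))%R.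
Proof.
intros Hq Ha Hr. assert (Hq0 := Cmod_ge_0 q). assert (Ha0 := Cmod_ge_0 a).
apply Rle_trans with (exp (- (rho / (1 - rho) * rsum (fun k => Cmod q ^ k)%R n))).
- apply exp_le. apply Ropp_le_contravar. apply geometric_weight_le; [|lra].
  apply Rdiv_le_0_compat; lra.
- induction n as [|n IH]; simpl.
  + rewrite Cmod_1, Rmult_0_r, Ropp_0, exp_0. lra.
  + rewrite Rmult_plus_distr_l, Ropp_plus_distr, exp_plus, Cmod_mult.
    apply Rmult_le_compat; auto; try (left; apply exp_pos).
    assert (H1 : (Cmod (a * q ^ n) <= rho * Cmod q ^ n)%R).
    { rewrite Cmod_mult, Cmod_pow. apply Rmult_le_compat_r; auto. apply pow_le; lra. }
    assert (H2 : (rho * Cmod q ^ n <= rho)%R).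
    { rewrite <- (Rmult_1_r rho) at 2. apply Rmult_le_compat_l; [lra|].
      rewrite <- (pow1 n). apply pow_incr; lra. }
    apply Rle_trans with (1 - rho * Cmod q ^ n)%R.
    * replace (rho / (1 - rho) * Cmod q ^ n)%R with (rho * Cmod q ^ n / (1 - rho))%R by (field; lra).
      apply one_minus_ge_exp; auto. split; auto. apply Rmult_le_pos; [lra|apply pow_le; lra].
    * assert (T := Cmod_le_diff 1 (1 - a * q ^ n)).
      replace (1 - (1 - a * q ^ n)) with (a * q ^ n) in T by ring.
      rewrite Cmod_1 in T. lra.
Qed.

Lemma qpoch_lower_pos (rho : R) (q : C) : (0 < qpoch_lower rho q)%R.
Proof. apply exp_pos. Qed.

(** Writes the product as a series dominated by a geometric one. Both the existence of (a; q)_oo and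
    its power series expansion in a parameter are drawn from it. *)
Lemma csum_qpoch_diff (a q : C) (n : nat) :
  qpoch a q n = 1 + csum (fun k => - (qpoch a q k * (a * q ^ k))) n.
Proof.
induction n as [|n IH]; simpl; [ring|].
transitivity (qpoch a q n + - (qpoch a q n * (a * q ^ n))); [ring|].
rewrite IH at 1. ring.
Qed.

Lemma qpoch_cv (a q : C) : (Cmod q < 1)%R -> Ccv (qpoch a q) (qpoch_inf a q).
Proof.
intros Hq. assert (Hq0 := Cmod_ge_0 q).
destruct (csum_cv (fun k => - (qpoch a q k * (a * q ^ k)))
  (fun k => (exp (Cmod a / (1 - Cmod q)) * Cmod a * Cmod q ^ k)%R)) as [l Hl].
- apply summable_scal; [|apply summable_pow; lra].
  apply Rmult_le_pos; [left; apply exp_pos | apply Cmod_ge_0].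
- intros k. rewrite Cmod_opp, !Cmod_mult, Cmod_pow, Rmult_assoc.
  apply Rmult_le_compat_r; auto using qpoch_bound.
  apply Rmult_le_pos; [apply Cmod_ge_0 | apply pow_le; auto].
- assert (H : Ccv (qpoch a q) (1 + l)).
  { apply (Ccv_ext (fun n => 1 + csum (fun k => - (qpoch a q k * (a * q ^ k))) n)).
    - intros n. symmetry. apply csum_qpoch_diff.
    - apply Ccv_plus; auto. apply Ccv_const. }
  unfold qpoch_inf. rewrite (CLim_eq _ _ H). auto.
Qed.

Lemma qpoch_inf_bound (a q : C) : (Cmod q < 1)%R ->
  (Cmod (qpoch_inf a q) <= exp (Cmod a / (1 - Cmod q)))%R.
Proof.
intros Hq. apply (Ccv_Cmod_le (qpoch a q)); [|apply qpoch_cv; auto].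
intros; apply qpoch_bound; auto.
Qed.

Lemma qpoch_inf_near_one (a q : C) : (Cmod q < 1)%R ->
  (Cmod (qpoch_inf a q - 1) <= exp (Cmod a / (1 - Cmod q)) * (Cmod a / (1 - Cmod q)))%R.
Proof.
intros Hq. apply (Ccv_Cmod_le (fun n => qpoch a q n - 1)).
- intros; apply qpoch_near_one; auto.
- apply Ccv_minus; [apply qpoch_cv; auto | apply Ccv_const].
Qed.

Lemma qpoch_inf_lower_bound (rho : R) (a q : C) :
  (Cmod q < 1)%R -> (Cmod a <= rho)%R -> (rho < 1)%R ->
  (qpoch_lower rho q <= Cmod (qpoch_inf a q))%R.
Proof.
intros Hq Ha Hr. apply (Ccv_Cmod_ge (qpoch a q)); [|apply qpoch_cv; auto].
intros; apply qpoch_lower_bound; auto.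
Qed.

Lemma qpoch_inf_neq0 (a q : C) : (Cmod q < 1)%R -> (Cmod a < 1)%R -> qpoch_inf a q <> 0.
Proof.
intros Hq Ha E. assert (H := qpoch_inf_lower_bound (Cmod a) a q Hq (Rle_refl _) Ha).
rewrite E, Cmod_0 in H. assert (T := qpoch_lower_pos (Cmod a) q). lra.
Qed.

Lemma qpoch_inf_split (a q : C) (n : nat) : (Cmod q < 1)%R ->
  qpoch_inf a q = qpoch a q n * qpoch_inf (a * q ^ n) q.
Proof.
intros Hq. apply (Ccv_unique (fun m => qpoch a q (n + m))).
- apply Ccv_shift, qpoch_cv; auto.
- apply (Ccv_ext (fun m => qpoch a q n * qpoch (a * q ^ n) q m)).
  + intros m. symmetry. apply qpoch_add.
  + apply Ccv_scal, qpoch_cv; auto.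
Qed.

(** * Power series with absolutely summable coefficients *)

Lemma Cmod_cv (u : nat -> C) (l : C) : Ccv u l -> is_lim_seq (fun n => Cmod (u n)) (Cmod l).
Proof.
intros H. apply is_lim_seq_spec. intros eps.
destruct (H eps (cond_pos eps)) as [N HN]. exists N. intros n Hn.
eapply Rle_lt_trans; [|apply (HN n Hn)].
assert (T1 := Cmod_le_diff (u n) l). assert (T2 := Cmod_le_diff l (u n)).
rewrite (Cmod_minus_sym l (u n)) in T2. apply Rabs_le. lra.
Qed.

Lemma rsum_Cmod_limit (u : nat -> nat -> C) (l : nat -> C) (w : nat -> R) (K : nat) (B : R) :
  (forall m, Ccv (fun n => u n m) (l m)) ->
  (forall n, (rsum (fun m => Cmod (u n m) * w m) K <= B)%R) ->
  (rsum (fun m => Cmod (l m) * w m) K <= B)%R.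
Proof.
intros Hl HB.
assert (H : is_lim_seq (fun n => rsum (fun m => Cmod (u n m) * w m)%R K)
                       (rsum (fun m => Cmod (l m) * w m)%R K)).
{ clear HB. induction K as [|K IH]; simpl.
  - apply is_lim_seq_const.
  - apply is_lim_seq_plus'; auto. apply is_lim_seq_mult'.
    + apply Cmod_cv; auto.
    + apply is_lim_seq_const. }
apply (is_lim_seq_le _ (fun _ => B) (Finite _) (Finite B) HB H). apply is_lim_seq_const.
Qed.

(* The l1 norm is submultiplicative, so this class is closed under products and normally
   convergent sums without any appeal to Cauchy's theorem. *)
Definition l1_analytic (r M : R) (f : C -> C) : Prop :=
  exists a : nat -> C, (forall K, (rsum (fun m => Cmod (a m) * r ^ m) K <= M)%R) /\
    forall t, (Cmod t <= r)%R -> Ccv (csum (fun m => a m * t ^ m)) (f t).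

Lemma l1_term_bound (r M : R) (a : nat -> C) : (0 < r)%R ->
  (forall K, (rsum (fun m => Cmod (a m) * r ^ m) K <= M)%R) ->
  forall m, (Cmod (a m) <= M / r ^ m)%R.
Proof.
intros Hr Ha m. specialize (Ha (S m)). simpl in Ha.
assert (0 <= rsum (fun m => Cmod (a m) * r ^ m) m)%R.
{ apply rsum_ge0. intros k. apply Rmult_le_pos; [apply Cmod_ge_0 | apply pow_le; lra]. }
assert (0 < r ^ m)%R by (apply pow_lt; auto).
apply Rmult_le_reg_r with (r ^ m)%R; auto.
unfold Rdiv. rewrite Rmult_assoc, Rinv_l, Rmult_1_r; lra.
Qed.

Lemma rsum_plus (f g : nat -> R) (n : nat) :
  rsum (fun k => (f k + g k)%R) n = (rsum f n + rsum g n)%R.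
Proof. induction n as [|n IH]; simpl; [ring | rewrite IH; ring]. Qed.

(** The coefficients of the sum are the sums of the coefficients, which converge because the m-th
    coefficient of [f k] is at most M k / r^m; the norm bound passes to them since it concerns
    finitely many coefficients at a time. *)
Lemma l1_analytic_series (r B : R) (M : nat -> R) (f : nat -> C -> C) (g : C -> C) :
  (0 < r)%R -> (forall k, (0 <= M k)%R) -> (forall n, (rsum M n <= B)%R) ->
  (forall k, l1_analytic r (M k) (f k)) ->
  (forall t, (Cmod t <= r)%R -> Ccv (csum (fun k => f k t)) (g t)) ->
  l1_analytic r B g.
Proof.
intros Hr HM HB Hf Hg.
destruct (functional_choice _ Hf) as [a Ha].
assert (Hpos : forall m, (0 < r ^ m)%R) by (intros; apply pow_lt; auto).
assert (Hcv : forall m, exists l, Ccv (csum (fun k => a k m)) l).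
{ intros m. apply (csum_cv _ (fun k => (/ r ^ m * M k)%R)).
  - apply summable_scal; [left; apply Rinv_0_lt_compat; auto|].
    split; auto. exists B; auto.
  - intros k. destruct (Ha k) as [Hk _]. rewrite Rmult_comm. apply (l1_term_bound r); auto. }
destruct (functional_choice _ Hcv) as [l Hl].
exists l. split.
- intros K. apply (rsum_Cmod_limit (fun n m => csum (fun k => a k m) n) l); auto.
  intros n. apply Rle_trans with (rsum M n); auto.
  apply Rle_trans with (rsum (fun k => rsum (fun m => Cmod (a k m) * r ^ m)%R K) n).
  + clear - Hr Hpos. induction n as [|n IH]; simpl.
    * right. induction K as [|K IH]; simpl; auto. rewrite IH, Cmod_0. ring.
    * eapply Rle_trans; [|apply Rplus_le_compat_r, IH].
      rewrite <- rsum_plus. apply rsum_le. intros m. rewrite <- Rmult_plus_distr_r.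
      apply Rmult_le_compat_r; [left; auto|]. apply Cmod_triangle.
  + apply rsum_le. intros k. apply Ha.
- intros t Ht.
  (* Interchange of the two summations: the truncation degree K is the parameter that tends to
     infinity, and the sum over k is the dominated one. *)
  destruct (tannery (fun K k => csum (fun m => a k m * t ^ m) K) (fun k => f k t)
    (csum (fun m => l m * t ^ m)) M) as [V [HV HU]].
  + split; auto. exists B; auto.
  + intros K k. destruct (Ha k) as [Hk _]. specialize (Hk K).
    eapply Rle_trans; [|apply Hk]. apply Cmod_csum. intros m.
    rewrite Cmod_mult, Cmod_pow. apply Rmult_le_compat_l; [apply Cmod_ge_0|].
    apply pow_incr. split; [apply Cmod_ge_0 | auto].
  + intros k. apply Ha; auto.
  + intros K. apply (Ccv_ext (fun n => csum (fun m => csum (fun k => a k m) n * t ^ m) K)).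
    * intros n. rewrite csum_swap. apply csum_ext. intros m _.
      rewrite Cmult_comm, <- csum_scal. apply csum_ext; intros; ring.
    * apply (Ccv_csum (fun n m => csum (fun k => a k m) n * t ^ m)). intros m.
      apply Ccv_mult; [apply Hl | apply Ccv_const].
  + rewrite (Ccv_unique _ _ _ (Hg t Ht) HV). auto.
Qed.

Lemma l1_analytic_ext (r M : R) (f g : C -> C) :
  (forall t, (Cmod t <= r)%R -> f t = g t) -> l1_analytic r M f -> l1_analytic r M g.
Proof.
intros E [a [H1 H2]]. exists a. split; auto. intros t Ht. rewrite <- E; auto.
Qed.

Lemma l1_analytic_weaken (r M M' : R) (f : C -> C) :
  (M <= M')%R -> l1_analytic r M f -> l1_analytic r M' f.
Proof.
intros E [a [H1 H2]]. exists a. split; auto. intros K. specialize (H1 K). lra.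
Qed.

Lemma l1_analytic_scal (r M : R) (c : C) (f : C -> C) :
  l1_analytic r M f -> l1_analytic r (Cmod c * M) (fun t => c * f t).
Proof.
intros [a [H1 H2]]. exists (fun m => c * a m). split.
- intros K. apply Rle_trans with (rsum (fun m => Cmod c * (Cmod (a m) * r ^ m))%R K).
  + apply rsum_le. intros m. rewrite Cmod_mult. lra.
  + rewrite rsum_scal. apply Rmult_le_compat_l; auto. apply Cmod_ge_0.
- intros t Ht. apply (Ccv_ext (fun n => c * csum (fun m => a m * t ^ m) n)).
  + intros n. rewrite <- csum_scal. apply csum_ext; intros; ring.
  + apply Ccv_scal; auto.
Qed.

Lemma l1_analytic_plus (r M M' : R) (f g : C -> C) :
  l1_analytic r M f -> l1_analytic r M' g -> l1_analytic r (M + M') (fun t => f t + g t).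
Proof.
intros [a [H1 H2]] [b [H3 H4]]. 
destruct (Rle_dec 0 r) as [Hr|Hr].
- exists (fun m => a m + b m). split.
  + intros K. apply Rle_trans with (rsum (fun m => Cmod (a m) * r ^ m + Cmod (b m) * r ^ m)%R K).
    * apply rsum_le. intros m. rewrite <- Rmult_plus_distr_r.
      apply Rmult_le_compat_r; [apply pow_le; auto | apply Cmod_triangle].
    * rewrite rsum_plus. apply Rplus_le_compat; auto.
  + intros t Ht. apply (Ccv_ext (fun n => csum (fun m => a m * t ^ m) n + csum (fun m => b m * t ^ m) n)).
    * intros n. rewrite <- csum_plus. apply csum_ext; intros; ring.
    * apply Ccv_plus; auto.
(* For r < 0 no t is concerned; the empty sums K = 0 in the hypotheses give M and M' nonnegative. *)
- exists (fun _ => 0). split.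
  + intros K. specialize (H1 O). specialize (H3 O). simpl in *.
    replace (rsum _ K) with 0%R; [lra|]. induction K as [|K IH]; simpl; auto.
    rewrite <- IH, Cmod_0. ring.
  + intros t Ht. assert (T := Cmod_ge_0 t). lra.
Qed.

Lemma l1_analytic_shift (r M : R) (f : C -> C) : (0 <= r)%R ->
  l1_analytic r M f -> l1_analytic r (r * M) (fun t => t * f t).
Proof.
intros Hr [a [H1 H2]]. exists (fun m => match m with O => RtoC 0 | S m => a m end). split.
- intros [|K]; simpl.
  + specialize (H1 O). simpl in H1. apply Rmult_le_pos; auto.
  + replace (rsum _ K + _)%R with (r * rsum (fun m => Cmod (a m) * r ^ m) K)%R.
    * apply Rmult_le_compat_l; auto.
    * induction K as [|K IH]; simpl; [rewrite Cmod_0; ring|]. rewrite <- IH. ring.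
- intros t Ht. apply Ccv_of_S.
  apply (Ccv_ext (fun n => t * csum (fun m => a m * t ^ m) n)).
  + intros n. rewrite csum_Sl, <- csum_scal. simpl. rewrite Cmult_0_l, Cplus_0_l.
    apply csum_ext; intros; simpl; ring.
  + apply Ccv_scal; auto.
Qed.

Lemma l1_analytic_const (r : R) (c : C) : l1_analytic r (Cmod c) (fun _ => c).
Proof.
exists (fun m => match m with O => c | S _ => RtoC 0 end). split.
- intros [|K]; [apply Cmod_ge_0|]. right.
  induction K as [|K IH]; simpl in *; [ring|]. rewrite IH, Cmod_0. ring.
- intros t _. apply Ccv_of_S. apply (Ccv_ext (fun _ => c)); [|apply Ccv_const].
  intros n. rewrite csum_Sl, csum_zero; [simpl; ring|]. intros; ring.
Qed.

Lemma l1_analytic_monomial_mult (r M : R) (c : C) (k : nat) (f : C -> C) : (0 <= r)%R ->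
  l1_analytic r M f -> l1_analytic r (Cmod c * r ^ k * M) (fun t => c * t ^ k * f t).
Proof.
intros Hr Hf.
assert (H : l1_analytic r (r ^ k * M) (fun t => t ^ k * f t)).
{ induction k as [|k IH].
  - simpl. rewrite Rmult_1_l. apply (l1_analytic_ext _ _ f); auto. intros; ring.
  - simpl. rewrite Rmult_assoc.
    apply (l1_analytic_ext _ _ (fun t => t * (t ^ k * f t))); [intros; ring|].
    apply l1_analytic_shift; auto. }
rewrite Rmult_assoc. apply (l1_analytic_ext _ _ (fun t => c * (t ^ k * f t))); [intros; ring|].
apply l1_analytic_scal; auto.
Qed.

(** Instead of a Cauchy product, f g is summed as the normally convergent series of the functions
    a_k t^k g(t). *)
Lemma l1_analytic_mult (r M M' : R) (f g : C -> C) : (0 < r)%R -> (0 <= M')%R ->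
  l1_analytic r M f -> l1_analytic r M' g -> l1_analytic r (M * M') (fun t => f t * g t).
Proof.
intros Hr HM' [a [H1 H2]] Hg.
apply (l1_analytic_series r (M * M') (fun k => Cmod (a k) * r ^ k * M')%R
   (fun k t => a k * t ^ k * g t)); auto.
- intros k. apply Rmult_le_pos; auto. apply Rmult_le_pos; [apply Cmod_ge_0 | apply pow_le; lra].
- intros n. apply Rle_trans with (M' * rsum (fun k => Cmod (a k) * r ^ k) n)%R.
  + rewrite <- rsum_scal. apply rsum_le. intros; lra.
  + rewrite Rmult_comm. apply Rmult_le_compat_r; auto.
- intros k. apply l1_analytic_monomial_mult; auto. lra.
- intros t Ht. apply (Ccv_ext (fun n => csum (fun m => a m * t ^ m) n * g t)).
  + intros n. rewrite Cmult_comm, <- csum_scal. apply csum_ext; intros; ring.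
  + apply Ccv_mult; auto. apply Ccv_const.
Qed.

Lemma l1_analytic_affine (r : R) (c0 c1 : C) : (0 <= r)%R ->
  l1_analytic r (Cmod c0 + Cmod c1 * r) (fun t => c0 + c1 * t).
Proof.
intros Hr. apply l1_analytic_plus; [apply l1_analytic_const|].
apply l1_analytic_scal.
apply (l1_analytic_ext _ _ (fun t => t * 1)); [intros; ring|].
replace r with (r * Cmod 1)%R at 2 by (rewrite Cmod_1; ring).
apply l1_analytic_shift; auto. apply l1_analytic_const.
Qed.

Lemma l1_analytic_qpoch (r : R) (c q : C) (n : nat) : (0 < r)%R -> (Cmod q < 1)%R ->
  l1_analytic r (exp (Cmod c * r / (1 - Cmod q))) (fun t => qpoch (c * t) q n).
Proof.
intros Hr Hq.
apply l1_analytic_weaken with (exp (Cmod c * r * rsum (fun k => Cmod q ^ k)%R n)).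
{ apply exp_le, geometric_weight_le.
  - apply Rmult_le_pos; [apply Cmod_ge_0 | lra].
  - split; auto. apply Cmod_ge_0. }
induction n as [|n IH]; simpl.
- rewrite Rmult_0_r, exp_0. apply (l1_analytic_weaken _ (Cmod 1)); [rewrite Cmod_1; lra | apply l1_analytic_const].
- rewrite Rmult_plus_distr_l, exp_plus.
  apply l1_analytic_mult; auto; [left; apply exp_pos|].
  apply l1_analytic_weaken with (Cmod 1 + Cmod (- (c * q ^ n)) * r)%R.
  + rewrite Cmod_1, Cmod_opp, Cmod_mult, Cmod_pow.
    eapply Rle_trans; [|apply exp_ineq1_le]. lra.
  + apply (l1_analytic_ext _ _ (fun t => 1 + - (c * q ^ n) * t)); [intros; ring|].
    apply l1_analytic_affine; lra.
Qed.

Lemma l1_analytic_qpoch_inf (r : R) (c q : C) : (0 < r)%R -> (Cmod q < 1)%R ->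
  l1_analytic r (1 + exp (Cmod c * r / (1 - Cmod q)) * (Cmod c * r / (1 - Cmod q)))
    (fun t => qpoch_inf (c * t) q).
Proof.
intros Hr Hq. assert (Hq0 := Cmod_ge_0 q). assert (Hc := Cmod_ge_0 c).
assert (He := exp_pos (Cmod c * r / (1 - Cmod q))).
assert (Hcr : (0 <= Cmod c * r)%R) by (apply Rmult_le_pos; lra).
apply (l1_analytic_ext _ _ (fun t => 1 + (qpoch_inf (c * t) q - 1))); [intros; ring|].
apply l1_analytic_plus; [apply (l1_analytic_weaken _ (Cmod 1)); [rewrite Cmod_1; lra | apply l1_analytic_const]|].
apply (l1_analytic_series r _
  (fun k => (exp (Cmod c * r / (1 - Cmod q)) * (Cmod c * r) * Cmod q ^ k)%R)
  (fun k t => - (qpoch (c * t) q k * (c * t * q ^ k)))); auto.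
- intros k. apply Rmult_le_pos; [|apply pow_le; auto].
  apply Rmult_le_pos; auto. lra.
- intros n. rewrite rsum_scal, Rmult_assoc. apply Rmult_le_compat_l; [lra|].
  apply geometric_weight_le; auto.
- intros k.
  apply (l1_analytic_ext _ _ (fun t => (- c * q ^ k) * t ^ 1 * qpoch (c * t) q k)); [intros; simpl; ring|].
  apply l1_analytic_weaken with (Cmod (- c * q ^ k) * r ^ 1 * exp (Cmod c * r / (1 - Cmod q)))%R.
  + rewrite Cmod_mult, Cmod_opp, Cmod_pow, pow_1. right; ring.
  + apply l1_analytic_monomial_mult; [lra|]. apply l1_analytic_qpoch; auto.
- intros t _. apply (Ccv_ext (fun n => qpoch (c * t) q n - 1)).
  + intros n. rewrite csum_qpoch_diff at 1. ring.
  + apply Ccv_minus; [apply qpoch_cv; auto | apply Ccv_const].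
Qed.

(** Identity theorem at the origin, by strong induction: once the coefficients below m vanish,
    dividing the series at u_N by u_N^m gives |a_m| <= |u_N| M / r^(m+1), and u_N tends to 0 without
    being 0. *)
Lemma l1_analytic_coeffs_zero (r M : R) (a : nat -> C) (u : nat -> C) :
  (0 < r)%R -> (forall K, (rsum (fun m => Cmod (a m) * r ^ m) K <= M)%R) ->
  (forall N, (Cmod (u N) <= r)%R) -> (forall N, u N <> 0) -> Ccv u 0 ->
  (forall N, Ccv (csum (fun m => a m * u N ^ m)) 0) -> forall m, a m = 0.
Proof.
intros Hr Ha Hur Hu0 Hu Hz m. induction m as [m IH] using lt_wf_ind.
assert (HM : (0 <= M)%R) by (apply (Ha O)).
assert (Hpos : forall m, (0 < r ^ m)%R) by (intros; apply pow_lt; auto).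
assert (Hb : forall N, (Cmod (a m) <= Cmod (u N) * (M / r ^ S m))%R).
{ intros N. set (t := u N).
  apply (Ccv_Cmod_le (fun K => a m - csum (fun i => a (m + i)%nat * t ^ i) (S K))).
  - intros K. rewrite csum_Sl, Nat.add_0_r.
    replace (a m - (a m * t ^ 0 + csum (fun k => a (m + S k)%nat * t ^ S k) K))
      with (- csum (fun k => a (m + S k)%nat * t ^ S k) K) by (simpl; ring).
    rewrite Cmod_opp.
    eapply Rle_trans; [apply (Cmod_csum _ (fun k => Cmod t / r ^ S m * (Cmod (a (m + S k)%nat) * r ^ (m + S k)))%R)|].
    + intros k. rewrite Cmod_mult, Cmod_pow. simpl. rewrite pow_add. simpl.
      replace (Cmod t / (r * r ^ m) * (Cmod (a (m + S k)%nat) * (r ^ m * (r * r ^ k))))%R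
        with (Cmod (a (m + S k)%nat) * (Cmod t * r ^ k))%R.
      * apply Rmult_le_compat_l; [apply Cmod_ge_0|]. apply Rmult_le_compat_l; [apply Cmod_ge_0|].
        apply pow_incr. split; [apply Cmod_ge_0 | apply Hur].
      * field. split; apply Rgt_not_eq; solve [apply Hpos | lra].
    + rewrite rsum_scal. unfold Rdiv. rewrite Rmult_assoc. apply Rmult_le_compat_l; [apply Cmod_ge_0|].
      rewrite Rmult_comm. apply Rmult_le_compat_r; [left; apply Rinv_0_lt_compat; auto|].
      eapply Rle_trans; [|apply (Ha (S m + K)%nat)]. rewrite rsum_split.
      assert (0 <= rsum (fun m0 => Cmod (a m0) * r ^ m0) (S m))%R.
      { apply rsum_ge0. intros k. apply Rmult_le_pos; [apply Cmod_ge_0 | left; auto]. }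
      assert (E : forall n, (rsum (fun k => Cmod (a (m + S k)%nat) * r ^ (m + S k)) n
         = rsum (fun k => Cmod (a (S m + k)%nat) * r ^ (S m + k)) n)%R).
      { induction n as [|n IHn]; simpl rsum; auto. rewrite IHn.
        replace (m + S n)%nat with (S m + n)%nat by lia. reflexivity. }
      rewrite E. lra.
  - replace (a m) with (a m - 0) at 1 by ring. apply Ccv_minus; [apply Ccv_const|].
    apply (Ccv_ext (fun K => / t ^ m * csum (fun j => a j * t ^ j) (m + S K))).
    + intros K. rewrite csum_split, csum_zero.
      * rewrite Cplus_0_l, <- csum_scal. apply csum_ext. intros i _. rewrite Cpow_add_r. field.
        apply Cpow_nz. apply Hu0.
      * intros k Hk. rewrite IH; auto. ring.
    + replace (RtoC 0) with (/ t ^ m * 0) by ring. apply Ccv_scal.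
      apply (Ccv_S (fun K => csum (fun j => a j * t ^ j) (m + K))).
      apply (Ccv_shift (csum (fun j => a j * t ^ j))). apply Hz. }
apply Cmod_eq_0. apply Rle_antisym; [|apply Cmod_ge_0].
apply Rnot_lt_le. intros Hlt.
destruct (Hu (Cmod (a m) / (M / r ^ S m + 1))%R) as [N HN].
{ apply Rdiv_lt_0_compat; auto. assert (0 <= M / r ^ S m)%R by (apply Rdiv_le_0_compat; auto). lra. }
specialize (HN N (le_n N)). specialize (Hb N).
replace (u N - 0) with (u N) in HN by ring.
assert (H0 : (0 <= M / r ^ S m)%R) by (apply Rdiv_le_0_compat; auto).
assert (Hb' : (Cmod (a m) <= Cmod (u N) * (M / r ^ S m + 1))%R).
{ assert (T := Cmod_ge_0 (u N)). lra. }
apply (Rmult_lt_compat_r (M / r ^ S m + 1)) in HN; [|lra].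
unfold Rdiv at 2 in HN. rewrite Rmult_assoc, Rinv_l in HN; lra.
Qed.

Lemma l1_analytic_identity (r M : R) (f : C -> C) (u : nat -> C) :
  (0 < r)%R -> l1_analytic r M f ->
  (forall N, (Cmod (u N) <= r)%R) -> (forall N, u N <> 0) -> Ccv u 0 ->
  (forall N, f (u N) = 0) -> forall t, (Cmod t <= r)%R -> f t = 0.
Proof.
intros Hr [a [Ha Hf]] Hur Hu0 Hu Hz t Ht.
assert (E : forall m, a m = 0).
{ apply (l1_analytic_coeffs_zero r M a u); auto.
  intros N. rewrite <- (Hz N). apply Hf; auto. }
apply (Ccv_unique (csum (fun m => a m * t ^ m))); auto.
apply (Ccv_ext (fun _ => 0)); [|apply Ccv_const].
intros n. symmetry. apply csum_zero. intros k _. rewrite E. ring.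
Qed.

(** * Weighted integrals *)

(** [W] stands for the weight divided by sqrt(1 - x^2) and stays abstract until the final
    theorem. *)
Definition wint (W : R -> R) (f : R -> C) (l : C) : Prop :=
  is_RInt (V := C_R_NormedModule) (fun x => f x * RtoC (W x)) (-1) 1 l.

Lemma wint_ext (W : R -> R) (f g : R -> C) (l : C) :
  (forall x, (-1 <= x <= 1)%R -> f x = g x) -> wint W f l -> wint W g l.
Proof.
intros E H. unfold wint. eapply is_RInt_ext; [|exact H].
intros x Hx. rewrite Rmin_left, Rmax_right in Hx by lra.
cbv beta. rewrite E; auto. lra.
Qed.

Lemma wint_plus (W : R -> R) (f g : R -> C) (l m : C) :
  wint W f l -> wint W g m -> wint W (fun x => f x + g x) (l + m).
Proof.
intros H H'. unfold wint.
apply (is_RInt_ext (V := C_R_NormedModule) (fun x => plus (f x * RtoC (W x)) (g x * RtoC (W x)))).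
- intros x _. change (f x * RtoC (W x) + g x * RtoC (W x) = (f x + g x) * RtoC (W x)). ring.
- apply (is_RInt_plus (V := C_R_NormedModule)); auto.
Qed.

(** The integral is taken in [C] as a real normed module, so a complex factor mixes the two
    components and is treated componentwise. *)
Lemma wint_scal (W : R -> R) (c : C) (f : R -> C) (l : C) :
  wint W f l -> wint W (fun x => c * f x) (c * l).
Proof.
intros H. unfold wint in *.
assert (H1 := is_RInt_fct_extend_fst _ _ _ _ H).
assert (H2 := is_RInt_fct_extend_snd _ _ _ _ H).
destruct c as [u v]. destruct l as [l1 l2]. simpl in H1, H2.
apply (is_RInt_fct_extend_pair (U := R_NormedModule) (V := R_NormedModule)).
- apply (is_RInt_ext (fun x => minus (scal u (fst (f x * RtoC (W x)))) (scal v (snd (f x * RtoC (W x)))))).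
  + intros x _. unfold minus, plus, opp, scal; simpl. unfold mult; simpl. ring.
  + apply (is_RInt_minus (V := R_NormedModule)); apply (is_RInt_scal (V := R_NormedModule)); auto.
- apply (is_RInt_ext (fun x => plus (scal u (snd (f x * RtoC (W x)))) (scal v (fst (f x * RtoC (W x)))))).
  + intros x _. unfold minus, plus, opp, scal; simpl. unfold mult; simpl. ring.
  + apply (is_RInt_plus (V := R_NormedModule)); apply (is_RInt_scal (V := R_NormedModule)); auto.
Qed.

Lemma wint_csum (W : R -> R) (f : nat -> R -> C) (l : nat -> C) (n : nat) :
  wint W (fun _ => 0) 0 -> (forall k, (k < n)%nat -> wint W (f k) (l k)) ->
  wint W (fun x => csum (fun k => f k x) n) (csum l n).
Proof.
intros H0 H. induction n as [|n IH]; simpl; auto.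
apply wint_plus; auto.
Qed.

Lemma wint_unique (W : R -> R) (f : R -> C) (l m : C) : wint W f l -> wint W f m -> l = m.
Proof.
intros H H'. unfold wint in *.
apply (is_RInt_unique (V := C_R_CompleteNormedModule)) in H.
apply (is_RInt_unique (V := C_R_CompleteNormedModule)) in H'.
rewrite <- H, <- H'. reflexivity.
Qed.

Lemma norm_C_R (z : C) : norm (V := C_R_NormedModule) z = Cmod z.
Proof.
destruct z as [x y]. unfold norm; simpl. unfold prod_norm, Cmod; simpl.
f_equal. unfold norm; simpl. unfold abs; simpl.
replace (Rabs x * (Rabs x * 1))%R with (Rsqr (Rabs x)) by (unfold Rsqr; ring).
replace (Rabs y * (Rabs y * 1))%R with (Rsqr (Rabs y)) by (unfold Rsqr; ring).
rewrite <- !Rsqr_abs. unfold Rsqr. ring.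
Qed.

Lemma wint_bound (W : R -> R) (B e : R) (f : R -> C) (l : C) :
  (forall x, (-1 <= x <= 1)%R -> (Rabs (W x) <= B)%R) ->
  (forall x, (-1 <= x <= 1)%R -> (Cmod (f x) <= e)%R) ->
  wint W f l -> (Cmod l <= 2 * (e * B))%R.
Proof.
intros HW Hf H. rewrite <- norm_C_R.
replace (2 * (e * B))%R with ((1 - -1) * (e * B))%R by ring.
apply (norm_RInt_le_const (V := C_R_NormedModule) (fun x => f x * RtoC (W x)) (-1) 1 l (e * B)); [lra | | exact H].
intros x Hx. rewrite norm_C_R, Cmod_mult, Cmod_R.
apply Rmult_le_compat; auto using Cmod_ge_0, Rabs_pos.
Qed.

(** A Riemann integrable function is bounded. Since p_0 = 1, the orthogonality relation itself
    supplies the integrability of the weight, hence the bound needed for uniform limits. *)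
Lemma wint_weight_bounded (W : R -> R) (l : C) : wint W (fun _ => 1) l ->
  exists B, (0 <= B)%R /\ forall x, (-1 <= x <= 1)%R -> (Rabs (W x) <= B)%R.
Proof.
intros H. destruct (ex_RInt_ub (V := C_R_NormedModule) (fun x => 1 * RtoC (W x)) (-1) 1) as [B HB].
{ exists l. exact H. }
assert (HB' : forall x, (-1 <= x <= 1)%R -> (Rabs (W x) <= B)%R).
{ intros x Hx. rewrite Rmin_left, Rmax_right in HB by lra.
  specialize (HB x Hx). rewrite norm_C_R, Cmult_1_l, Cmod_R in HB. auto. }
exists B. split; auto. apply Rle_trans with (Rabs (W 0)); [apply Rabs_pos|]. apply HB'. lra.
Qed.

Lemma wint_uniform_limit (W : R -> R) (B : R) (fk : nat -> R -> C) (f : R -> C)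
  (lk : nat -> C) (eps : nat -> R) :
  (0 <= B)%R -> (forall x, (-1 <= x <= 1)%R -> (Rabs (W x) <= B)%R) ->
  (forall k, wint W (fk k) (lk k)) ->
  (forall k x, (-1 <= x <= 1)%R -> (Cmod (fk k x - f x) <= eps k)%R) ->
  Un_cv eps 0 ->
  exists l, Ccv lk l /\ wint W f l.
Proof.
intros HB HW Hk Hf He.
(* [filterlim_RInt] asks for uniform convergence on the whole line, so the integrands are cut off
   outside [-1,1]. *)
set (I := fun (g : R -> C) (x : R) => if Rle_dec (-1) x then if Rle_dec x 1 then g x * RtoC (W x) else 0 else 0).
assert (HI : forall g x, (-1 <= x <= 1)%R -> I g x = g x * RtoC (W x)).
{ intros g x [H1 H2]. unfold I. destruct (Rle_dec (-1) x); [|contradiction].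
  destruct (Rle_dec x 1); [auto|contradiction]. }
assert (HIint : forall g l, wint W g l <-> is_RInt (V := C_R_NormedModule) (I g) (-1) 1 l).
{ intros g l. split; apply is_RInt_ext; intros x Hx;
   rewrite Rmin_left, Rmax_right in Hx by lra; rewrite HI; auto; lra. }
assert (HID : forall k x, (Cmod (I (fk k) x - I f x) <= eps k * B)%R).
{ assert (Hpos : forall k, (0 <= eps k)%R).
  { intros k. eapply Rle_trans; [|apply (Hf k 0%R); lra]. apply Cmod_ge_0. }
  intros k x. unfold I.
  assert (H0 : (Cmod (0 - 0) <= eps k * B)%R).
  { replace (0 - 0) with (RtoC 0) by ring. rewrite Cmod_0. apply Rmult_le_pos; auto. }
  destruct (Rle_dec (-1) x); auto. destruct (Rle_dec x 1); auto.
  replace (fk k x * RtoC (W x) - f x * RtoC (W x)) with ((fk k x - f x) * RtoC (W x)) by ring.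
  rewrite Cmod_mult, Cmod_R. apply Rmult_le_compat; auto using Cmod_ge_0, Rabs_pos. }
assert (HN : forall e, (0 < e)%R -> exists N, forall k, (N <= k)%nat -> (eps k * B < e)%R).
{ intros e Hpos. destruct (He (e / (B + 1))%R) as [N HN].
  { apply Rdiv_lt_0_compat; lra. }
  exists N. intros k Hk0. specialize (HN k Hk0). unfold Rdist in HN. rewrite Rminus_0_r in HN.
  assert (H0 : (0 <= eps k)%R).
  { eapply Rle_trans; [|apply (Hf k 0%R); lra]. apply Cmod_ge_0. }
  rewrite Rabs_pos_eq in HN by auto.
  apply Rle_lt_trans with (eps k * (B + 1))%R; [apply Rmult_le_compat_l; lra|].
  apply (Rmult_lt_compat_r (B + 1)) in HN; [|lra].
  unfold Rdiv in HN. rewrite Rmult_assoc, Rinv_l in HN; lra. }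
destruct (filterlim_RInt (V := C_R_CompleteNormedModule) (fun k => I (fk k)) (-1) 1 Hierarchy.eventually _ (I f) lk) as [l [Hl1 Hl2]].
- intros k. apply (HIint (fk k) (lk k)). apply Hk.
- apply filterlim_locally. intros e. destruct (HN e (cond_pos e)) as [N HN0].
  exists N. intros k Hk0 x. specialize (HN0 k Hk0).
  assert (H : (Cmod (I (fk k) x - I f x) < e)%R) by (eapply Rle_lt_trans; [apply HID|]; auto).
  split.
  + change (Rabs (Re (I (fk k) x) - Re (I f x)) < e)%R.
    eapply Rle_lt_trans; [|exact H].
    replace (Re (I (fk k) x) - Re (I f x))%R with (Re (I (fk k) x - I f x)) by (unfold Cminus, Re; simpl; ring).
    apply re_le_Cmod.
  + change (Rabs (Im (I (fk k) x) - Im (I f x)) < e)%R.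
    eapply Rle_lt_trans; [|exact H].
    replace (Im (I (fk k) x) - Im (I f x))%R with (Im (I (fk k) x - I f x)) by (unfold Cminus, Im; simpl; ring).
    apply im_le_Cmod.
- exists l. split; [|apply HIint; exact Hl2].
  intros e Hpos.
  assert (He2 : (0 < e / 2)%R) by lra.
  destruct (proj1 (filterlim_locally lk l) Hl1 (mkposreal _ He2)) as [N HN0].
  exists N. intros k Hk0. destruct (HN0 k Hk0) as [H1 H2].
  eapply Rle_lt_trans; [apply Cmod_le_Rabs|].
  change (Rabs (Re (lk k) - Re l) < e / 2)%R in H1.
  change (Rabs (Im (lk k) - Im l) < e / 2)%R in H2.
  replace (Re (lk k - l)) with (Re (lk k) - Re l)%R by (unfold Cminus, Re; simpl; ring).
  replace (Im (lk k - l)) with (Im (lk k) - Im l)%R by (unfold Cminus, Im; simpl; ring).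
  lra.
Qed.

(** * Continuous q-Hermite polynomials *)

Lemma summable_remainder (M : nat -> R) : summable M ->
  exists e : nat -> R, Un_cv e 0 /\ forall K m, (rsum (fun k => M (K + k)%nat) m <= e K)%R.
Proof.
intros [HM [B HB]].
assert (Hg : Un_growing (rsum M)) by (intros n; simpl; specialize (HM n); lra).
assert (Hb : has_ub (rsum M)) by (exists B; intros x [i ->]; apply HB).
destruct (growing_cv (rsum M) Hg Hb) as [l Hl].
exists (fun K => (l - rsum M K)%R). split.
- intros eps He. destruct (Hl eps He) as [N HN]. exists N. intros n Hn.
  specialize (HN n Hn). unfold Rdist in *. rewrite Rabs_minus_sym in HN.
  replace (l - rsum M n - 0)%R with (l - rsum M n)%R by ring. auto.
- intros K m. assert (T := growing_ineq (rsum M) l Hg Hl (K + m)%nat).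
  rewrite rsum_split in T. lra.
Qed.

Lemma summable_linear_pow (r : R) : (0 <= r < 1)%R ->
  summable (fun m => (INR (S m) * r ^ m)%R).
Proof.
intros Hr. split.
- intros k. apply Rmult_le_pos; [apply pos_INR | apply pow_le; lra].
- exists (/ ((1 - r) * (1 - r)))%R. intros n.
  assert (E : (rsum (fun m => INR (S m) * r ^ m) n
     = (1 - r ^ n * (1 + INR n * (1 - r))) * / ((1 - r) * (1 - r)))%R).
  { induction n as [|n IH].
    - simpl. field. lra.
    - rewrite rsum_S, IH, S_INR. simpl pow. field. lra. }
  rewrite E. rewrite <- (Rmult_1_l (/ ((1 - r) * (1 - r)))) at 2.
  apply Rmult_le_compat_r.
  + left. apply Rinv_0_lt_compat. apply Rmult_lt_0_compat; lra.
  + assert (0 <= r ^ n * (1 + INR n * (1 - r)))%R; [|lra].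
    apply Rmult_le_pos; [apply pow_le; lra|].
    assert (0 <= INR n * (1 - r))%R; [|lra]. apply Rmult_le_pos; [apply pos_INR|lra].
Qed.

Definition hermite_term (q z z' : C) (m k : nat) : C :=
  / qpoch q q k * / qpoch q q (m - k) * (z ^ k * z' ^ (m - k)).

(* The continuous q-Hermite polynomial divided by (q;q)_m, for z = e^(i theta), z' = 1/z. *)
Definition hermite (q z z' : C) (m : nat) : C := csum (hermite_term q z z' m) (S m).

Lemma hermite_weighted (q z z' : C) (m : nat) : (forall k, 1 - q * q ^ k <> 0) ->
  csum (fun k => (1 - q ^ k) * hermite_term q z z' (S m) k) (S (S m)) = z * hermite q z z' m.
Proof.
intros Hq. assert (Pq : forall k, qpoch q q k <> 0) by (intros; apply qpoch_neq0; auto).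
rewrite csum_Sl. unfold hermite. rewrite <- csum_scal.
replace ((1 - q ^ 0) * hermite_term q z z' (S m) 0) with (RtoC 0) by (simpl; ring).
rewrite Cplus_0_l. apply csum_ext. intros k _. unfold hermite_term.
replace (S m - S k)%nat with (m - k)%nat by lia.
rewrite qpoch_S, !Cpow_S. field. auto.
Qed.

(** From 1 - q^(m+1) = (1 - q^k) + q^k (1 - q^(m+1-k)): the two parts cancel the last factor of (q;
    q)_k and of (q; q)_(m+1-k) respectively. *)
Lemma hermite_succ (q z z' : C) (m : nat) : (forall k, 1 - q * q ^ k <> 0) ->
  (1 - q ^ S m) * hermite q z z' (S m)
  = z * hermite q z z' m
    + z' * (hermite q z z' m - csum (fun k => (1 - q ^ k) * hermite_term q z z' m k) (S m)).
Proof.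
intros Hq. assert (Pq : forall k, qpoch q q k <> 0) by (intros; apply qpoch_neq0; auto).
rewrite <- (hermite_weighted q z z' m Hq) at 1.
transitivity (csum (fun k => (1 - q ^ k) * hermite_term q z z' (S m) k) (S (S m))
  + csum (fun k => q ^ k * (1 - q ^ (S m - k)) * hermite_term q z z' (S m) k) (S (S m))).
- rewrite <- csum_plus. unfold hermite. rewrite <- csum_scal. apply csum_ext. intros k Hk.
  replace (q ^ S m) with (q ^ k * q ^ (S m - k)) by (rewrite <- Cpow_add_r; f_equal; lia).
  ring.
- f_equal. rewrite csum_S, Nat.sub_diag.
  transitivity (z' * csum (fun k => q ^ k * hermite_term q z z' m k) (S m)).
  + rewrite <- csum_scal. transitivity (csum (fun k => q ^ k * (1 - q ^ (S m - k)) * hermite_term q z z' (S m) k) (S m)).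
    { simpl (q ^ 0). ring. }
    apply csum_ext. intros k Hk. unfold hermite_term.
    replace (S m - k)%nat with (S (m - k)) by lia.
    rewrite qpoch_S, !Cpow_S. field. auto.
  + f_equal. unfold hermite.
    replace (csum (hermite_term q z z' m) (S m) - csum (fun k => (1 - q ^ k) * hermite_term q z z' m k) (S m))
     with (csum (hermite_term q z z' m) (S m) + csum (fun k => (-1) * ((1 - q ^ k) * hermite_term q z z' m k)) (S m))
     by (rewrite csum_scal; ring).
    rewrite <- csum_plus. apply csum_ext. intros; ring.
Qed.

Lemma hermite_rec0 (q z z' : C) : (forall k, 1 - q * q ^ k <> 0) ->
  (1 - q ^ 1) * hermite q z z' 1 = z + z'.
Proof.
intros Hq. rewrite hermite_succ by auto. unfold hermite, hermite_term. simpl. field.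
Qed.

Lemma hermite_rec (q z z' : C) (m : nat) : (forall k, 1 - q * q ^ k <> 0) -> z * z' = 1 ->
  (1 - q ^ S (S m)) * hermite q z z' (S (S m))
  = (z + z') * hermite q z z' (S m) - hermite q z z' m.
Proof.
intros Hq Hz. rewrite hermite_succ, hermite_weighted by auto.
transitivity ((z + z') * hermite q z z' (S m) - z * z' * hermite q z z' m); [ring|].
rewrite Hz; ring.
Qed.

Lemma Cmod_pow_one (z : C) (k : nat) : Cmod z = 1%R -> Cmod (z ^ k) = 1%R.
Proof. intros H. rewrite Cmod_pow, H. apply pow1. Qed.

Lemma hermite_bound (q z z' : C) (m : nat) : (Cmod q < 1)%R -> Cmod z = 1%R -> Cmod z' = 1%R ->
  (Cmod (hermite q z z' m)
   <= / qpoch_lower (Cmod q) q * / qpoch_lower (Cmod q) q * INR (S m))%R.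
Proof.
intros Hq Hz Hz'. set (L := qpoch_lower (Cmod q) q).
assert (HL : (0 < L)%R) by apply qpoch_lower_pos.
assert (Hb : forall k, (Cmod (/ qpoch q q k) <= / L)%R).
{ intros k. assert (T := qpoch_lower_bound (Cmod q) q q k Hq (Rle_refl _) Hq). fold L in T.
  rewrite Cmod_inv. 2:{ apply Cmod_gt_0. lra. }
  apply Rinv_le_contravar; auto. }
unfold hermite. eapply Rle_trans; [apply (Cmod_csum _ (fun _ => / L * / L)%R)|].
- intros k. unfold hermite_term. rewrite !Cmod_mult, !Cmod_pow_one, !Rmult_1_r by auto.
  apply Rmult_le_compat; auto using Cmod_ge_0.
- right. induction m as [|m IH].
  + simpl. ring.
  + rewrite S_INR, rsum_S, IH. ring.
Qed.

(** The three-term recurrence turned into the q-difference equation g(qt) = (1 - tz)(1 - tz') g(t)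
    of the generating function, at the level of partial sums. *)
Lemma hermite_series_shift (q z z' t : C) (N : nat) :
  (forall k, 1 - q * q ^ k <> 0) -> z * z' = 1 ->
  csum (fun m => hermite q z z' m * (q * t) ^ m) (S (S N))
  = csum (fun m => hermite q z z' m * t ^ m) (S (S N))
    - (z + z') * t * csum (fun m => hermite q z z' m * t ^ m) (S N)
    + t * t * csum (fun m => hermite q z z' m * t ^ m) N.
Proof.
intros Hq Hz. induction N as [|N IH].
- rewrite !csum_S. rewrite <- (hermite_rec0 q z z' Hq).
  assert (E : hermite q z z' 0 = 1).
  { unfold hermite, hermite_term; simpl. field. }
  rewrite E. simpl. ring.
- rewrite csum_S, IH.
  rewrite (csum_S _ (S (S N))), (csum_S _ (S N)), (csum_S _ N).
  rewrite !Cpow_mult_l.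
  replace (hermite q z z' (S (S N)) * (q ^ S (S N) * t ^ S (S N)))
    with (hermite q z z' (S (S N)) * t ^ S (S N) - (1 - q ^ S (S N)) * hermite q z z' (S (S N)) * t ^ S (S N)) by ring.
  rewrite hermite_rec by auto. rewrite !Cpow_S. ring.
Qed.

Lemma hermite_summable (q t : C) : (Cmod t < 1)%R ->
  summable (fun m => (/ qpoch_lower (Cmod q) q * / qpoch_lower (Cmod q) q * (INR (S m) * Cmod t ^ m))%R).
Proof.
intros Ht. apply summable_scal.
- assert (T := Rinv_0_lt_compat _ (qpoch_lower_pos (Cmod q) q)).
  apply Rmult_le_pos; lra.
- apply summable_linear_pow. split; auto. apply Cmod_ge_0.
Qed.

Lemma hermite_term_bound (q z z' t : C) (m : nat) :
  (Cmod q < 1)%R -> Cmod z = 1%R -> Cmod z' = 1%R ->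
  (Cmod (hermite q z z' m * t ^ m)
   <= / qpoch_lower (Cmod q) q * / qpoch_lower (Cmod q) q * (INR (S m) * Cmod t ^ m))%R.
Proof.
intros Hq Hz Hz'. rewrite Cmod_mult, Cmod_pow, <- Rmult_assoc.
apply Rmult_le_compat_r; [apply pow_le, Cmod_ge_0|]. apply hermite_bound; auto.
Qed.

(** Iterating the q-difference equation gives g(t q^N) = (tz, tz'; q)_N g(t). As N grows the left
    side tends to g(0) = 1, which determines g(t). *)
Lemma hermite_generating (q z z' t : C) :
  (Cmod q < 1)%R -> z * z' = 1 -> Cmod z = 1%R -> Cmod z' = 1%R -> (Cmod t < 1)%R ->
  Ccv (csum (fun m => hermite q z z' m * t ^ m))
      (/ (qpoch_inf (t * z) q * qpoch_inf (t * z') q)).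
Proof.
intros Hq Hz H1 H1' Ht.
assert (Hqn := one_minus_pow_neq0 q q Hq Hq).
set (beta := (/ qpoch_lower (Cmod q) q * / qpoch_lower (Cmod q) q)%R).
assert (Hbeta : (0 <= beta)%R).
{ assert (T := Rinv_0_lt_compat _ (qpoch_lower_pos (Cmod q) q)). apply Rmult_le_pos; lra. }
assert (Hg : forall u, (Cmod u < 1)%R -> exists l, Ccv (csum (fun m => hermite q z z' m * u ^ m)) l).
{ intros u Hu. apply (csum_cv _ _ (hermite_summable q u Hu)).
  intros k. apply hermite_term_bound; auto. }
assert (Hg' : forall u, exists l, (Cmod u < 1)%R -> Ccv (csum (fun m => hermite q z z' m * u ^ m)) l).
{ intros u. destruct (Rlt_dec (Cmod u) 1) as [Hu|Hu].
  - destruct (Hg u Hu) as [l Hl]. exists l; auto.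
  - exists 0; intros; contradiction. }
destruct (functional_choice _ Hg') as [g Hgg]. clear Hg Hg'.
assert (Hpow : forall N, (Cmod (t * q ^ N) < 1)%R).
{ intros N. eapply Rle_lt_trans; [apply Cmod_mul_pow_le|]; auto. }
assert (Hstep : forall u, (Cmod u < 1)%R -> g (q * u) = (1 - u * z) * (1 - u * z') * g u).
{ intros u Hu. assert (Hqu : (Cmod (q * u) < 1)%R).
  { rewrite Cmod_mult. assert (T := Cmod_ge_0 u). assert (T' := Cmod_ge_0 q). nra. }
  apply (Ccv_unique (fun N => csum (fun m => hermite q z z' m * (q * u) ^ m) (S (S N)))).
  - apply (Ccv_S (fun N => csum _ (S N))), Ccv_S, Hgg; auto.
  - apply (Ccv_ext _ _ _ (fun N => eq_sym (hermite_series_shift q z z' u N Hqn Hz))).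
    replace ((1 - u * z) * (1 - u * z') * g u)
      with (g u - (z + z') * u * g u + u * u * g u + u * u * (z * z' - 1) * g u) by ring.
    rewrite Hz. replace (u * u * (1 - 1) * g u) with (RtoC 0) by ring. rewrite Cplus_0_r.
    specialize (Hgg u Hu).
    apply Ccv_plus; [apply Ccv_minus|].
    + apply (Ccv_S (fun N => csum _ (S N))), Ccv_S; auto.
    + apply Ccv_scal, Ccv_S; auto.
    + apply Ccv_scal; auto. }
assert (Hiter : forall N, g (t * q ^ N) = qpoch (t * z) q N * qpoch (t * z') q N * g t).
{ induction N as [|N IH].
  - simpl. replace (t * 1) with t by ring. ring.
  - replace (t * q ^ S N) with (q * (t * q ^ N)) by (rewrite Cpow_S; ring).
    rewrite Hstep, IH by auto. simpl. ring. }
assert (Hlim : Ccv (fun N => g (t * q ^ N)) 1).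
{ destruct (hermite_summable q t Ht) as [Hpos [B HB]]. fold beta in Hpos, HB.
  (* Every term of positive degree gains at least a factor |q|^N over the majorant at t, whose
     partial sums are at most [B]. *)
  assert (Hu : forall N, (Cmod (g (t * q ^ N)%C - 1)%C <= B * Cmod q ^ N)%R).
  { intros N. apply (Ccv_Cmod_le (fun K => csum (fun m => hermite q z z' m * (t * q ^ N) ^ m) (S K) - 1)).
    - intros K. rewrite csum_Sl.
      replace (hermite q z z' 0) with (RtoC 1) by (unfold hermite, hermite_term; simpl; field).
      replace (1 * (t * q ^ N) ^ 0 + csum (fun k => hermite q z z' (S k) * (t * q ^ N) ^ S k) K - 1)
        with (csum (fun k => hermite q z z' (S k) * (t * q ^ N) ^ S k) K) by (simpl; ring).
      eapply Rle_trans; [apply (Cmod_csum _ (fun k => Cmod q ^ N * (beta * (INR (S (S k)) * Cmod t ^ S k)))%R)|].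
      + intros k. eapply Rle_trans; [apply hermite_term_bound; auto|]. fold beta.
        rewrite Cmod_mult, Cmod_pow, Rpow_mult_distr.
        replace (Cmod q ^ N * (beta * (INR (S (S k)) * Cmod t ^ S k)))%R
          with (beta * (INR (S (S k)) * (Cmod t ^ S k * Cmod q ^ N)))%R by ring.
        apply Rmult_le_compat_l; auto. apply Rmult_le_compat_l; [apply pos_INR|].
        apply Rmult_le_compat_l; [apply pow_le, Cmod_ge_0|].
        simpl. apply Rle_trans with (Cmod q ^ N * 1)%R; [|lra].
        assert (T := Cmod_ge_0 q).
        apply Rmult_le_compat_l; [apply pow_le; auto|].
        assert (T0 : (0 <= Cmod q ^ N <= 1)%R).
        { split; [apply pow_le; auto|]. rewrite <- (pow1 N). apply pow_incr; lra. }
        rewrite <- (pow1 k). apply pow_incr; auto.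
      + rewrite rsum_scal, Rmult_comm. apply Rmult_le_compat_r; [apply pow_le, Cmod_ge_0|].
        eapply Rle_trans; [|apply (HB (1 + K)%nat)].
        rewrite rsum_split.
        lazymatch goal with |- (?u <= ?v + ?w)%R => change w with u end.
        assert (T := Hpos O). rewrite rsum_S. change (rsum _ 0) with 0%R. lra.
    - apply Ccv_minus; [|apply Ccv_const]. apply Ccv_S, Hgg; auto. }
  apply (Ccv_squeeze _ _ _ Hu).
  replace 0%R with (B * 0)%R by ring. apply CV_mult.
  - intros e He. exists O. intros. unfold Rdist. rewrite Rminus_diag, Rabs_R0. auto.
  - intros e He. destruct (pow_lt_1_zero (Cmod q)) with (y := e) as [N HN]; auto.
    { rewrite Rabs_pos_eq; auto using Cmod_ge_0. }
    exists N. intros n Hn. unfold Rdist. rewrite Rminus_0_r. auto. }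
assert (E : qpoch_inf (t * z) q * qpoch_inf (t * z') q * g t = 1).
{ apply (Ccv_unique (fun N => g (t * q ^ N))); auto.
  apply (Ccv_ext _ _ _ (fun N => eq_sym (Hiter N))).
  apply Ccv_mult; [|apply Ccv_const]. apply Ccv_mult; apply qpoch_cv; auto. }
assert (Hz1 : qpoch_inf (t * z) q <> 0).
{ apply qpoch_inf_neq0; auto. rewrite Cmod_mult, H1, Rmult_1_r; auto. }
assert (Hz2 : qpoch_inf (t * z') q <> 0).
{ apply qpoch_inf_neq0; auto. rewrite Cmod_mult, H1', Rmult_1_r; auto. }
replace (/ (qpoch_inf (t * z) q * qpoch_inf (t * z') q)) with (g t); auto.
apply (Cmult_cancel (qpoch_inf (t * z) q * qpoch_inf (t * z') q)).
{ apply Cmult_neq_0; auto. }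
rewrite E. field. auto.
Qed.

(** * The Askey-Wilson basis *)

Lemma Cexpi_mul_opp (u : R) : Cexpi u * Cexpi (- u) = 1.
Proof.
unfold Cexpi. rewrite cos_neg, sin_neg. unfold Cmult, RtoC; simpl.
assert (T := sin2_cos2 u). unfold Rsqr in T. f_equal; lra.
Qed.

Lemma Cexpi_plus_opp (u : R) : Cexpi u + Cexpi (- u) = RtoC (2 * cos u).
Proof.
unfold Cexpi. rewrite cos_neg, sin_neg. unfold Cplus, RtoC; simpl. f_equal; ring.
Qed.

Lemma Cmod_Cexpi (u : R) : Cmod (Cexpi u) = 1%R.
Proof.
unfold Cmod, Cexpi; simpl. transitivity (sqrt 1); [f_equal | apply sqrt_1].
assert (T := sin2_cos2 u). unfold Rsqr in T. lra.
Qed.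

Definition aw_base (a q : C) (k : nat) (x : R) : C :=
  qpoch (a * Cexpi (acos x)) q k * qpoch (a * Cexpi (- acos x)) q k.

Lemma aw_base_S (a q : C) (k : nat) (x : R) : (-1 <= x <= 1)%R ->
  aw_base a q (S k) x
  = (1 + a * a * q ^ k * q ^ k) * aw_base a q k x
    + - (2 * a * q ^ k) * (RtoC x * aw_base a q k x).
Proof.
intros Hx. unfold aw_base. rewrite !qpoch_S.
assert (E1 := Cexpi_mul_opp (acos x)). assert (E2 := Cexpi_plus_opp (acos x)).
rewrite cos_acos in E2 by auto. rewrite RtoC_mult in E2.
set (z := Cexpi (acos x)) in *. set (z' := Cexpi (- acos x)) in *.
transitivity ((1 + (z * z') * (a * a * q ^ k * q ^ k) - (z + z') * (a * q ^ k))
  * (qpoch (a * z) q k * qpoch (a * z') q k)); [ring|].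
rewrite E1, E2. ring.
Qed.

Lemma Ccv_eventually_const (u : nat -> C) (l : C) (N : nat) :
  (forall n, (N <= n)%nat -> u n = l) -> Ccv u l.
Proof.
intros H eps He. exists N. intros n Hn. rewrite H by auto.
replace (l - l) with (RtoC 0) by ring. rewrite Cmod_0. auto.
Qed.

Lemma CSeries_finite (u : nat -> C) (N : nat) :
  (forall k, (N <= k)%nat -> u k = 0) -> CSeries u = csum u N.
Proof.
intros H. apply CSeries_eq. apply (Ccv_eventually_const _ _ N).
intros n Hn. replace n with (N + (n - N))%nat by lia.
rewrite csum_split, (csum_zero (fun k => u (N + k)%nat)).
- ring.
- intros k _. apply H. lia.
Qed.

Lemma askey_wilson_sum (n : nat) (x : R) (a b c d q : C) : q <> 0 ->
  askey_wilson n x a b c d q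
  = csum (fun k => aw_base_coeff a b c d q n k * aw_base a q k x) (S n).
Proof.
intros Hq0. unfold askey_wilson, qphi. rewrite (CSeries_finite _ (S n)).
- rewrite <- csum_scal. apply csum_ext. intros k _. cbv zeta.
  set (u := (-1) ^ k * q ^ (k * (k - 1) / 2)).
  assert (Hu : u <> 0).
  { apply Cmult_neq_0; apply Cpow_nz; auto.
    intros E. apply (f_equal Re) in E. simpl in E. lra. }
  unfold aw_base_coeff, aw_base, qpochs. cbn [fold_right length].
  change (1 + 3)%nat with 4%nat.
  replace (u ^ 4 / u ^ 4) with (RtoC 1) by (field; auto).
  unfold Cdiv.
  replace (qpoch q q k * (qpoch (a * b) q k * (qpoch (a * c) q k * (qpoch (a * d) q k * 1))))
    with (qpoch q q k * (qpoch (a * b) q k * qpoch (a * c) q k * qpoch (a * d) q k)) by ring.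
  ring.
- intros k Hk. unfold qpochs. cbn [fold_right].
  rewrite qpoch_inv_pow_zero by (auto; lia). unfold Cdiv. ring.
Qed.

(** Linear combinations of the basis, up to equality on [-1,1]. Only the existence of integrals is
    drawn from membership, so no coefficients are recorded. *)
Inductive base_span (a q : C) : (R -> C) -> Prop :=
| base_span_base k : base_span a q (aw_base a q k)
| base_span_scal c f : base_span a q f -> base_span a q (fun x => c * f x)
| base_span_plus f g : base_span a q f -> base_span a q g -> base_span a q (fun x => f x + g x)
| base_span_ext f g : (forall x, (-1 <= x <= 1)%R -> f x = g x) ->
    base_span a q f -> base_span a q g.

(** On a basis element, [aw_base_S] is solved for the product by x, dividing by 2 a q^k. Stability
    under x makes every polynomial multiplier given by a recurrence in x available. *)
Lemma base_span_mulx (a q : C) (f : R -> C) : a <> 0 -> q <> 0 ->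
  base_span a q f -> base_span a q (fun x => RtoC x * f x).
Proof.
intros Ha Hq. induction 1 as [k|c f Hf IH|f g Hf IHf Hg IHg|f g E Hf IH].
- apply (base_span_ext _ _ (fun x => (1 + a * a * q ^ k * q ^ k) / (2 * a * q ^ k) * aw_base a q k x
     + (- / (2 * a * q ^ k)) * aw_base a q (S k) x)).
  + intros x Hx. rewrite aw_base_S by auto.
    assert (q ^ k <> 0) by (apply Cpow_nz; auto).
    assert (RtoC 2 <> 0) by (intros E; apply RtoC_inj in E; lra).
    field. auto.
  + apply base_span_plus; apply base_span_scal, base_span_base.
- apply (base_span_ext _ _ (fun x => c * (RtoC x * f x))); [intros; ring|].
  apply base_span_scal; auto.
- apply (base_span_ext _ _ (fun x => RtoC x * f x + RtoC x * g x)); [intros; ring|].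
  apply base_span_plus; auto.
- apply (base_span_ext _ _ (fun x => RtoC x * f x)); auto.
  intros x Hx. rewrite E; auto.
Qed.

Lemma base_span_aw_base_mult (a q s : C) (N : nat) (f : R -> C) : a <> 0 -> q <> 0 ->
  base_span a q f -> base_span a q (fun x => aw_base s q N x * f x).
Proof.
intros Ha Hq Hf. induction N as [|N IH].
- apply (base_span_ext _ _ f); auto. intros x _. unfold aw_base; simpl. ring.
- apply (base_span_ext _ _ (fun x => (1 + s * s * q ^ N * q ^ N) * (aw_base s q N x * f x)
    + - (2 * s * q ^ N) * (RtoC x * (aw_base s q N x * f x)))).
  + intros x Hx. rewrite (aw_base_S s) by auto. ring.
  + apply base_span_plus; apply base_span_scal; auto. apply base_span_mulx; auto.
Qed.

Lemma base_span_hermite (a q : C) (m : nat) : a <> 0 -> q <> 0 -> (Cmod q < 1)%R ->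
  base_span a q (fun x => hermite q (Cexpi (acos x)) (Cexpi (- acos x)) m).
Proof.
intros Ha Hq Hq1. assert (Hqn := one_minus_pow_neq0 q q Hq1 Hq1).
assert (Hqn' : forall k, 1 - q ^ S k <> 0) by (intros; rewrite Cpow_S; auto).
enough (H : base_span a q (fun x => hermite q (Cexpi (acos x)) (Cexpi (- acos x)) m)
   /\ base_span a q (fun x => hermite q (Cexpi (acos x)) (Cexpi (- acos x)) (S m))) by apply H.
assert (H0 : base_span a q (fun x => hermite q (Cexpi (acos x)) (Cexpi (- acos x)) 0)).
{ apply (base_span_ext _ _ (aw_base a q 0)); [|apply base_span_base].
  intros x _. unfold aw_base, hermite, hermite_term; simpl. field. }
assert (E2 : forall x, (-1 <= x <= 1)%R -> Cexpi (acos x) + Cexpi (- acos x) = 2 * RtoC x).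
{ intros x Hx. rewrite Cexpi_plus_opp, cos_acos, RtoC_mult by auto. auto. }
induction m as [|m [IH1 IH2]].
- split; auto.
  apply (base_span_ext _ _ (fun x => 2 / (1 - q ^ 1) * (RtoC x * hermite q (Cexpi (acos x)) (Cexpi (- acos x)) 0))).
  + intros x Hx. apply (Cmult_cancel (1 - q ^ 1)); auto.
    rewrite hermite_rec0, E2 by auto. unfold hermite, hermite_term; simpl. field.
    intros E. apply (Hqn' O). rewrite Cpow_1_r. exact E.
  + apply base_span_scal, base_span_mulx; auto.
- split; auto.
  apply (base_span_ext _ _ (fun x => 2 / (1 - q ^ S (S m)) * (RtoC x * hermite q (Cexpi (acos x)) (Cexpi (- acos x)) (S m))
     + - / (1 - q ^ S (S m)) * hermite q (Cexpi (acos x)) (Cexpi (- acos x)) m)).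
  + intros x Hx. apply (Cmult_cancel (1 - q ^ S (S m))); auto.
    rewrite hermite_rec, E2 by (auto using Cexpi_mul_opp). field. apply Hqn'.
  + apply base_span_plus; apply base_span_scal; auto. apply base_span_mulx; auto.
Qed.

Definition base_inf (s q : C) (x : R) : C :=
  qpoch_inf (s * Cexpi (acos x)) q * qpoch_inf (s * Cexpi (- acos x)) q.

Lemma Cmod_mul_Cexpi (s : C) (u : R) : Cmod (s * Cexpi u) = Cmod s.
Proof. rewrite Cmod_mult, Cmod_Cexpi. ring. Qed.

Lemma qpoch_inf_bound1 (w q : C) : (Cmod q < 1)%R -> (Cmod w <= 1)%R ->
  (Cmod (qpoch_inf w q) <= exp (1 / (1 - Cmod q)))%R.
Proof.
intros Hq Hw. eapply Rle_trans; [apply qpoch_inf_bound; auto|]. apply exp_le.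
apply Rmult_le_compat_r; auto. left. apply Rinv_0_lt_compat. lra.
Qed.

Lemma qpoch_bound1 (w q : C) (n : nat) : (Cmod q < 1)%R -> (Cmod w <= 1)%R ->
  (Cmod (qpoch w q n) <= exp (1 / (1 - Cmod q)))%R.
Proof.
intros Hq Hw. eapply Rle_trans; [apply qpoch_bound; auto|]. apply exp_le.
apply Rmult_le_compat_r; auto. left. apply Rinv_0_lt_compat. lra.
Qed.

Lemma qpoch_inf_near_one1 (w q : C) : (Cmod q < 1)%R -> (Cmod w <= 1)%R ->
  (Cmod (qpoch_inf w q - 1) <= exp (1 / (1 - Cmod q)) / (1 - Cmod q) * Cmod w)%R.
Proof.
intros Hq Hw. eapply Rle_trans; [apply qpoch_inf_near_one; auto|].
assert (H : (0 < / (1 - Cmod q))%R) by (apply Rinv_0_lt_compat; lra).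
apply Rle_trans with (exp (1 / (1 - Cmod q)) * (Cmod w / (1 - Cmod q)))%R; [|right; field; lra].
apply Rmult_le_compat_r; [apply Rmult_le_pos; [apply Cmod_ge_0|lra]|].
apply exp_le. apply Rmult_le_compat_r; lra.
Qed.

Lemma qpoch_inf_rate (w q : C) (N : nat) : (Cmod q < 1)%R -> (Cmod w <= 1)%R ->
  (Cmod (qpoch w q N - qpoch_inf w q)
   <= exp (1 / (1 - Cmod q)) * (exp (1 / (1 - Cmod q)) / (1 - Cmod q)) * Cmod q ^ N)%R.
Proof.
intros Hq Hw. rewrite (qpoch_inf_split w q N Hq).
replace (qpoch w q N - qpoch w q N * qpoch_inf (w * q ^ N) q)
  with (- (qpoch w q N * (qpoch_inf (w * q ^ N) q - 1))) by ring.
rewrite Cmod_opp, Cmod_mult, Rmult_assoc.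
apply Rmult_le_compat; auto using Cmod_ge_0, qpoch_bound1.
assert (H := Cmod_mul_pow_le w q N Hq).
eapply Rle_trans; [apply qpoch_inf_near_one1; auto; lra|].
apply Rmult_le_compat_l.
- apply Rmult_le_pos; [left; apply exp_pos | left; apply Rinv_0_lt_compat; lra].
- rewrite Cmod_mult, Cmod_pow. rewrite <- (Rmult_1_l (Cmod q ^ N)) at 2.
  apply Rmult_le_compat_r; auto. apply pow_le, Cmod_ge_0.
Qed.

Lemma Cmod_prod_diff (u v u' v' : C) (B e : R) :
  (Cmod u <= B)%R -> (Cmod v' <= B)%R -> (Cmod (u - u') <= e)%R -> (Cmod (v - v') <= e)%R ->
  (Cmod (u * v - u' * v') <= 2 * B * e)%R.
Proof.
intros H1 H2 H3 H4.
replace (u * v - u' * v') with (u * (v - v') + (u - u') * v') by ring.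
eapply Rle_trans; [apply Cmod_triangle|]. rewrite !Cmod_mult.
assert (Cmod u * Cmod (v - v') <= B * e)%R by (apply Rmult_le_compat; auto using Cmod_ge_0).
assert (Cmod (u - u') * Cmod v' <= e * B)%R by (apply Rmult_le_compat; auto using Cmod_ge_0).
lra.
Qed.

Lemma base_inf_rate (q : C) : (Cmod q < 1)%R -> exists K, (0 <= K)%R /\
  forall s N x, (Cmod s <= 1)%R -> (Cmod (aw_base s q N x - base_inf s q x) <= K * Cmod q ^ N)%R.
Proof.
intros Hq. set (E := exp (1 / (1 - Cmod q))).
assert (HE : (0 < E)%R) by apply exp_pos.
assert (HQ : (0 < / (1 - Cmod q))%R) by (apply Rinv_0_lt_compat; lra).
exists (2 * E * (E * (E / (1 - Cmod q))))%R. split.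
- unfold Rdiv. repeat apply Rmult_le_pos; lra.
- intros s N x Hs. rewrite Rmult_assoc. unfold aw_base, base_inf.
  apply Cmod_prod_diff.
  + apply qpoch_bound1; auto. rewrite Cmod_mul_Cexpi; auto.
  + apply qpoch_inf_bound1; auto. rewrite Cmod_mul_Cexpi; auto.
  + apply qpoch_inf_rate; auto. rewrite Cmod_mul_Cexpi; auto.
  + apply qpoch_inf_rate; auto. rewrite Cmod_mul_Cexpi; auto.
Qed.

Lemma base_inf_near_one (q : C) : (Cmod q < 1)%R -> exists K, (0 <= K)%R /\
  forall s x, (Cmod s <= 1)%R -> (Cmod (base_inf s q x - 1) <= K * Cmod s)%R.
Proof.
intros Hq. set (E := exp (1 / (1 - Cmod q))).
assert (HE : (0 < E)%R) by apply exp_pos.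
assert (HE1 : (1 <= E)%R).
{ apply Rle_trans with (exp 0); [rewrite exp_0; lra|]. apply exp_le. apply Rmult_le_pos; [lra|]. left; apply Rinv_0_lt_compat; lra. }
assert (HQ : (0 < / (1 - Cmod q))%R) by (apply Rinv_0_lt_compat; lra).
exists (2 * E * (E / (1 - Cmod q)))%R. split.
- unfold Rdiv. repeat apply Rmult_le_pos; lra.
- intros s x Hs. rewrite Rmult_assoc. unfold base_inf.
  replace (RtoC 1) with (1 * 1) by ring. 
  apply Cmod_prod_diff.
  + apply qpoch_inf_bound1; auto. rewrite Cmod_mul_Cexpi; auto.
  + rewrite Cmod_1; auto.
  + rewrite <- (Cmod_mul_Cexpi s (acos x)). apply qpoch_inf_near_one1; auto. rewrite Cmod_mul_Cexpi; auto.
  + rewrite <- (Cmod_mul_Cexpi s (- acos x)). apply qpoch_inf_near_one1; auto. rewrite Cmod_mul_Cexpi; auto.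
Qed.

Lemma aw_base_bounded (a q : C) (k : nat) (x : R) : (Cmod q < 1)%R ->
  (Cmod (aw_base a q k x) <= exp (Cmod a / (1 - Cmod q)) * exp (Cmod a / (1 - Cmod q)))%R.
Proof.
intros Hq. unfold aw_base. rewrite Cmod_mult.
apply Rmult_le_compat; auto using Cmod_ge_0.
- eapply Rle_trans; [apply qpoch_bound; auto|]. rewrite Cmod_mul_Cexpi. lra.
- eapply Rle_trans; [apply qpoch_bound; auto|]. rewrite Cmod_mul_Cexpi. lra.
Qed.

Lemma askey_wilson_bounded (n : nat) (a b c d q : C) : q <> 0 -> (Cmod q < 1)%R ->
  exists K, (0 <= K)%R /\ forall x, (Cmod (askey_wilson n x a b c d q) <= K)%R.
Proof.
intros Hq0 Hq.
set (E := (exp (Cmod a / (1 - Cmod q)) * exp (Cmod a / (1 - Cmod q)))%R).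
assert (HE : (0 <= E)%R) by (apply Rmult_le_pos; left; apply exp_pos).
exists (rsum (fun k => Cmod (aw_base_coeff a b c d q n k) * E)%R (S n)). split.
- apply rsum_ge0. intros k. apply Rmult_le_pos; auto. apply Cmod_ge_0.
- intros x. rewrite askey_wilson_sum by auto. apply Cmod_csum. intros k.
  rewrite Cmod_mult. apply Rmult_le_compat_l; [apply Cmod_ge_0|]. apply aw_base_bounded; auto.
Qed.

Lemma Cinv_neq0 (x : C) : x <> 0 -> / x <> 0.
Proof. intros H E. apply C1_nz. rewrite <- (Cinv_l x H), E. ring. Qed.

(** * Integrals against p_n derived from the orthogonality relation *)

Section AskeyWilsonFunctional.

Context (a b c d q : C) (W : R -> R) (h : nat -> C).
Context (hq0 : q <> 0) (hq : (Cmod q < 1)%R) (ha0 : a <> 0).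
Context (ha : (Cmod a < 1)%R) (hb : (Cmod b < 1)%R) (hc : (Cmod c < 1)%R) (hd : (Cmod d < 1)%R).
Context (horth : forall m n, wint W
  (fun x => askey_wilson m x a b c d q * askey_wilson n x a b c d q)
  (if Nat.eqb m n then h n else 0)).

Lemma Cmod_mult_lt1 (x y : C) : (Cmod x < 1)%R -> (Cmod y < 1)%R -> (Cmod (x * y) < 1)%R.
Proof.
intros Hx Hy. rewrite Cmod_mult. assert (T := Cmod_ge_0 x). assert (T' := Cmod_ge_0 y). nra.
Qed.

Lemma wint_zero : wint W (fun _ => 0) 0.
Proof.
assert (T := wint_scal W 0 _ _ (horth 0 0)). rewrite Cmult_0_l in T.
revert T. apply wint_ext. intros; ring.
Qed.

(** Strong induction on k: p_k is a combination of the basis elements up to k with nonzero leading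
    coefficient, so the k-th integral follows from orthogonality and the earlier ones.
    [aw_inversion] identifies the value. *)
Lemma aw_moment (n k : nat) :
  wint W (fun x => aw_base a q k x * askey_wilson n x a b c d q)
    (h n * aw_inverse_coeff a b c d q k n).
Proof.
assert (Hq := one_minus_pow_neq0 q q hq hq).
assert (Hb := one_minus_pow_neq0 (a * b) q hq (Cmod_mult_lt1 _ _ ha hb)).
assert (Hc := one_minus_pow_neq0 (a * c) q hq (Cmod_mult_lt1 _ _ ha hc)).
assert (Hd := one_minus_pow_neq0 (a * d) q hq (Cmod_mult_lt1 _ _ ha hd)).
assert (HD := one_minus_pow_neq0 (a * b * c * d) q hq
  (Cmod_mult_lt1 _ _ (Cmod_mult_lt1 _ _ (Cmod_mult_lt1 _ _ ha hb) hc) hd)).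
induction k as [k IH] using lt_wf_ind.
assert (HB : aw_base_coeff a b c d q k k <> 0).
{ assert (Hp : forall n, q ^ n <> 0) by (intros; apply Cpow_nz; auto).
  assert (Pq : qpoch q q k <> 0) by (apply qpoch_neq0; auto).
  assert (Pb : qpoch (a * b) q k <> 0) by (intros; apply qpoch_neq0; auto).
  assert (Pc : qpoch (a * c) q k <> 0) by (intros; apply qpoch_neq0; auto).
  assert (Pd : qpoch (a * d) q k <> 0) by (intros; apply qpoch_neq0; auto).
  assert (Pi := qpoch_inv_pow_neq0 q k hq0 Hq).
  assert (PD : qpoch (a * b * c * d * (q ^ k / q)) q k <> 0).
  { destruct k as [|k']; [apply C1_nz|]. apply qpoch_neq0. intros i _.
    rewrite Cpow_S. intros E. apply (HD (k' + i)%nat). rewrite Cpow_add_r, <- E. field. auto. }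
  assert (Pa : a ^ k <> 0) by (apply Cpow_nz; auto).
  unfold aw_base_coeff, Cdiv. repeat first [apply Cmult_neq_0 | apply Cinv_neq0]; auto. }
set (v := fun j => h n * aw_inverse_coeff a b c d q j n) in *.
set (B := aw_base_coeff a b c d q k) in *.
change (h n * aw_inverse_coeff a b c d q k n) with (v k).
apply (wint_ext _ (fun x => / B k * (askey_wilson k x a b c d q * askey_wilson n x a b c d q
   + csum (fun j => - B j * (aw_base a q j x * askey_wilson n x a b c d q)) k))).
- intros x _. rewrite (askey_wilson_sum k) by auto. rewrite csum_S. fold B.
  replace (csum (fun j => - B j * (aw_base a q j x * askey_wilson n x a b c d q)) k)
   with (- askey_wilson n x a b c d q * csum (fun j => B j * aw_base a q j x) k).
  + field. auto.
  + rewrite <- csum_scal. apply csum_ext; intros; ring.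
- replace (v k) with (/ B k * ((if Nat.eqb k n then h n else 0) + csum (fun j => - B j * v j) k)).
  + apply wint_scal, wint_plus; [apply horth|].
    apply (wint_csum W (fun j x => - B j * (aw_base a q j x * askey_wilson n x a b c d q))); [apply wint_zero|].
    intros j Hj. apply wint_scal. apply IH; auto.
  + assert (S1 := aw_inversion a b c d q k n hq0 ha0 Hq Hb Hc Hd HD).
    rewrite csum_S in S1. fold B in S1.
    replace (if Nat.eqb k n then h n else 0) with (h n * (if Nat.eqb k n then 1 else 0))
      by (destruct (Nat.eqb k n); ring).
    rewrite <- S1.
    replace (csum (fun j => - B j * v j) k) with (- h n * csum (fun j => B j * aw_inverse_coeff a b c d q j n) k).
    * unfold v. field. auto.
    * rewrite <- csum_scal. apply csum_ext. intros j _. unfold v. ring.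
Qed.

Lemma wint_weight : wint W (fun _ => 1) (h O).
Proof.
apply (wint_ext _ (fun x => askey_wilson 0 x a b c d q * askey_wilson 0 x a b c d q)); [|apply (horth 0 0)].
intros x _. rewrite askey_wilson_sum by auto. unfold aw_base_coeff, aw_base; simpl. field.
Qed.

Lemma wint_aw_base (n N : nat) (s : C) :
  wint W (fun x => aw_base s q N x * askey_wilson n x a b c d q)
    (h n * csum (fun k => connection_coeff s a q N k * aw_inverse_coeff a b c d q k n) (S N)).
Proof.
assert (Hq := one_minus_pow_neq0 q q hq hq).
apply (wint_ext _ (fun x => csum (fun k => connection_coeff s a q N k
    * (aw_base a q k x * askey_wilson n x a b c d q)) (S N))).
- intros x _. unfold aw_base at 2.
  rewrite (base_connection s a q _ _ N ha0 (Cexpi_mul_opp (acos x)) Hq).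
  rewrite Cmult_comm, <- csum_scal. apply csum_ext. intros k _. unfold aw_base. ring.
- rewrite <- csum_scal.
  rewrite (csum_ext _ (fun k => connection_coeff s a q N k * (h n * aw_inverse_coeff a b c d q k n)))
    by (intros; ring).
  apply (wint_csum W (fun k x => connection_coeff s a q N k * (aw_base a q k x * askey_wilson n x a b c d q))).
  + apply wint_zero.
  + intros k _. apply wint_scal, aw_moment.
Qed.

Lemma wint_base_span (n : nat) (f : R -> C) : base_span a q f ->
  exists l, wint W (fun x => f x * askey_wilson n x a b c d q) l.
Proof.
induction 1 as [k|e f Hf [l IH]|f g Hf [l IHf] Hg [m IHg]|f g E Hf [l IH]].
- eexists. apply aw_moment.
- exists (e * l). apply (wint_ext _ (fun x => e * (f x * askey_wilson n x a b c d q))); [intros; ring|].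
  apply wint_scal; auto.
- exists (l + m). apply (wint_ext _ (fun x => f x * askey_wilson n x a b c d q + g x * askey_wilson n x a b c d q)); [intros; ring|].
  apply wint_plus; auto.
- exists l. apply (wint_ext _ (fun x => f x * askey_wilson n x a b c d q)); auto.
  intros x Hx. rewrite E; auto.
Qed.

Lemma Un_cv_scal0 (K : R) (e : nat -> R) : Un_cv e 0 -> Un_cv (fun n => (K * e n)%R) 0.
Proof.
intros H. replace 0%R with (K * 0)%R by ring. apply CV_mult; auto.
intros eps He. exists O. intros. unfold Rdist. rewrite Rminus_diag, Rabs_R0. auto.
Qed.

Lemma Un_cv_pow0 (r : R) : (0 <= r < 1)%R -> Un_cv (fun n => (r ^ n)%R) 0.
Proof.
intros Hr e He. destruct (pow_lt_1_zero r) with (y := e) as [N HN]; auto.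
{ rewrite Rabs_pos_eq; lra. }
exists N. intros n Hn. unfold Rdist. rewrite Rminus_0_r. auto.
Qed.

(** [y m] is the integral of (s e^(i theta), s e^(-i theta); q)_oo p_n against the m-th q-Hermite
    polynomial over (q; q)_m. Its linear growth makes the series in t converge in the unit disc, and
    uniform convergence in x justifies termwise integration. *)
Lemma generating_integral (n : nat) (s : C) : (Cmod s <= 1)%R ->
  exists (y : nat -> C) (K : R), (0 <= K)%R /\ (forall m, (Cmod (y m) <= K * INR (S m))%R) /\
  forall t, (Cmod t < 1)%R -> exists Y, Ccv (csum (fun m => y m * t ^ m)) Y /\
    wint W (fun x => base_inf s q x / base_inf t q x * askey_wilson n x a b c d q) Y.
Proof.
intros Hs.
destruct (wint_weight_bounded W (h O) wint_weight) as [B [HB0 HB]].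
destruct (askey_wilson_bounded n a b c d q hq0 hq) as [P [HP0 HP]].
destruct (base_inf_rate q hq) as [K1 [HK10 HK1]].
set (beta := (/ qpoch_lower (Cmod q) q * / qpoch_lower (Cmod q) q)%R).
assert (Hbeta : (0 <= beta)%R).
{ assert (T := Rinv_0_lt_compat _ (qpoch_lower_pos (Cmod q) q)). apply Rmult_le_pos; lra. }
set (A := fun m x => hermite q (Cexpi (acos x)) (Cexpi (- acos x)) m).
assert (HA : forall m x, (Cmod (A m x) <= beta * INR (S m))%R).
{ intros. apply hermite_bound; auto using Cmod_Cexpi. }
set (E := exp (1 / (1 - Cmod q))).
assert (HE : (0 < E)%R) by apply exp_pos.
assert (HS : forall x, (Cmod (base_inf s q x) <= E * E)%R).
{ intros x. unfold base_inf. rewrite Cmod_mult. apply Rmult_le_compat; auto using Cmod_ge_0;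
   apply qpoch_inf_bound1; auto; rewrite Cmod_mul_Cexpi; auto. }
(* The infinite product is not in the span; its truncations are, and they converge to it uniformly
   at the rate |q|^N. *)
assert (Hy : forall m, exists l, wint W (fun x => base_inf s q x * A m x * askey_wilson n x a b c d q) l).
{ intros m.
  assert (Hk : forall N, exists l, wint W (fun x => aw_base s q N x * A m x * askey_wilson n x a b c d q) l).
  { intros N. apply wint_base_span. apply base_span_aw_base_mult; auto. apply base_span_hermite; auto. }
  destruct (functional_choice _ Hk) as [l Hl].
  destruct (wint_uniform_limit W B _ (fun x => base_inf s q x * A m x * askey_wilson n x a b c d q) l
    (fun N => (K1 * (beta * INR (S m)) * P * Cmod q ^ N)%R) HB0 HB Hl) as [y [_ Hy]].
  - intros N x _.
    replace (aw_base s q N x * A m x * askey_wilson n x a b c d q -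
      base_inf s q x * A m x * askey_wilson n x a b c d q)
      with ((aw_base s q N x - base_inf s q x) * A m x * askey_wilson n x a b c d q) by ring.
    rewrite !Cmod_mult.
    apply Rle_trans with ((K1 * Cmod q ^ N) * (beta * INR (S m)) * P)%R; [|right; ring].
    repeat apply Rmult_le_compat; auto using Cmod_ge_0.
    apply Rmult_le_pos; apply Cmod_ge_0.
  - apply Un_cv_scal0, Un_cv_pow0. split; auto. apply Cmod_ge_0.
  - exists y; auto. }
destruct (functional_choice _ Hy) as [y Hy']. clear Hy.
(* Length of the interval, then the bounds for the two infinite products, the q-Hermite factor
   without its growth m + 1, p_n and the weight. *)
exists y, (2 * (E * E * beta * P * B))%R. repeat split.
- assert (0 <= E * E * beta * P * B)%R; [|lra].
  apply Rmult_le_pos; auto. apply Rmult_le_pos; auto. apply Rmult_le_pos; auto.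
  apply Rmult_le_pos; lra.
- intros m. apply Rle_trans with (2 * ((E * E * (beta * INR (S m)) * P) * B))%R; [|right; ring].
  apply (wint_bound W B _ _ _ HB) with (2 := Hy' m).
  intros x _. rewrite !Cmod_mult. repeat apply Rmult_le_compat; auto using Cmod_ge_0.
  apply Rmult_le_pos; apply Cmod_ge_0.
- intros t Ht.
  destruct (summable_remainder _ (hermite_summable q t Ht)) as [e [He Hrem]].
  destruct (wint_uniform_limit W B
    (fun N x => csum (fun m => t ^ m * (base_inf s q x * A m x * askey_wilson n x a b c d q)) N)
    (fun x => base_inf s q x / base_inf t q x * askey_wilson n x a b c d q)
    (fun N => csum (fun m => t ^ m * y m) N)
    (fun N => (E * E * P * e N)%R) HB0 HB) as [Y [HY1 HY2]].
  + intros N. apply (wint_csum W (fun m x => t ^ m * (base_inf s q x * A m x * askey_wilson n x a b c d q))).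
    * apply wint_zero.
    * intros m _. apply wint_scal; auto.
  + intros N x _.
    replace (csum (fun m => t ^ m * (base_inf s q x * A m x * askey_wilson n x a b c d q)) N)
      with (base_inf s q x * askey_wilson n x a b c d q * csum (fun m => A m x * t ^ m) N)
      by (rewrite <- csum_scal; apply csum_ext; intros; ring).
    replace (base_inf s q x * askey_wilson n x a b c d q * csum (fun m => A m x * t ^ m) N -
       base_inf s q x / base_inf t q x * askey_wilson n x a b c d q)
      with (- (base_inf s q x * askey_wilson n x a b c d q * (/ base_inf t q x - csum (fun m => A m x * t ^ m) N)))
      by (unfold Cdiv; ring).
    rewrite Cmod_opp, !Cmod_mult.
    repeat apply Rmult_le_compat; auto using Cmod_ge_0.
    { apply Rmult_le_pos; apply Cmod_ge_0. }
    eapply csum_limit_tail.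
    * intros m. apply hermite_term_bound; auto using Cmod_Cexpi.
    * apply hermite_generating; auto using Cmod_Cexpi, Cexpi_mul_opp.
    * intros m. apply Hrem.
  + apply Un_cv_scal0; auto.
  + exists Y. split; auto. apply (Ccv_ext (fun N => csum (fun m => t ^ m * y m) N)); auto.
    intros N. apply csum_ext; intros; ring.
Qed.

End AskeyWilsonFunctional.

(** * The very-well-poised series as a function of t *)

Lemma Cmod_inv_le (x : C) (L : R) : (0 < L)%R -> (L <= Cmod x)%R -> (Cmod (/ x) <= / L)%R.
Proof.
intros HL Hx. rewrite Cmod_inv by (apply Cmod_gt_0; lra). apply Rinv_le_contravar; auto.
Qed.

Lemma l1_analytic_bound (r M : R) (f : C -> C) (t : C) :
  l1_analytic r M f -> (Cmod t <= r)%R -> (Cmod (f t) <= M)%R.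
Proof.
intros [u [H1 H2]] Ht. apply (Ccv_Cmod_le (csum (fun m => u m * t ^ m))); auto.
intros n. eapply Rle_trans; [|apply (H1 n)]. apply Cmod_csum. intros m.
rewrite Cmod_mult, Cmod_pow. apply Rmult_le_compat_l; [apply Cmod_ge_0|].
apply pow_incr. split; auto. apply Cmod_ge_0.
Qed.

(** Taking |e| r out of each factor leaves 1 + (|v| / (|e| r)) |q|^k, whose product is bounded
    independently of n. The bound thus grows only like (|e| r)^n, which is summable in the
    application e = a4. *)
Lemma l1_analytic_qprod (r : R) (e v q : C) (n : nat) :
  (0 < r)%R -> e <> 0 -> (Cmod q < 1)%R ->
  l1_analytic r ((Cmod e * r) ^ n * exp (Cmod v / (Cmod e * r) / (1 - Cmod q)))
    (fun t => qprod (e * t) v q n).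
Proof.
intros Hr He Hq. assert (Hq0 := Cmod_ge_0 q). assert (Hv := Cmod_ge_0 v).
assert (He' : (0 < Cmod e)%R) by (apply Cmod_gt_0; auto).
set (x := (Cmod e * r)%R). assert (Hx : (0 < x)%R) by (apply Rmult_lt_0_compat; auto).
assert (Hvx : (0 <= Cmod v / x)%R) by (apply Rdiv_le_0_compat; auto).
apply l1_analytic_weaken with (x ^ n * exp (Cmod v / x * rsum (fun k => Cmod q ^ k) n))%R.
{ apply Rmult_le_compat_l; [apply pow_le; lra|]. apply exp_le, geometric_weight_le; auto. }
induction n as [|n IH]; simpl.
- rewrite Rmult_0_r, exp_0. apply (l1_analytic_weaken _ (Cmod 1)); [rewrite Cmod_1; lra | apply l1_analytic_const].
- rewrite Rmult_plus_distr_l, exp_plus.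
  replace (x * x ^ n * (exp (Cmod v / x * rsum (fun k => Cmod q ^ k) n) * exp (Cmod v / x * Cmod q ^ n)))%R
    with (x ^ n * exp (Cmod v / x * rsum (fun k => Cmod q ^ k) n) * (x * exp (Cmod v / x * Cmod q ^ n)))%R by ring.
  apply l1_analytic_mult; auto.
  { apply Rmult_le_pos; [lra | left; apply exp_pos]. }
  apply l1_analytic_weaken with (Cmod (- (v * q ^ n)) + Cmod e * r)%R.
  + rewrite Cmod_opp, Cmod_mult, Cmod_pow. fold x.
    apply Rle_trans with (x * (1 + Cmod v / x * Cmod q ^ n))%R.
    * right. field. lra.
    * apply Rmult_le_compat_l; [lra | apply exp_ineq1_le].
  + apply (l1_analytic_ext _ _ (fun t => - (v * q ^ n) + e * t)); [intros; ring|].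
    apply l1_analytic_affine; lra.
Qed.

Lemma Ccv_qpoch (u : nat -> C) (l q : C) (n : nat) :
  Ccv u l -> Ccv (fun j => qpoch (u j) q n) (qpoch l q n).
Proof.
intros H. induction n as [|n IH]; simpl; [apply Ccv_const|].
apply Ccv_mult; auto. apply Ccv_minus; [apply Ccv_const|]. apply Ccv_mult; auto. apply Ccv_const.
Qed.

Lemma Ccv_qprod (t e q : C) (u : nat -> C) (l : C) (n : nat) :
  Ccv u l -> Ccv (fun j => qprod t (e * u j) q n) (qprod t (e * l) q n).
Proof.
intros H. induction n as [|n IH]; simpl; [apply Ccv_const|].
apply Ccv_mult; auto. apply Ccv_minus; [apply Ccv_const|]. apply Ccv_mult; [|apply Ccv_const].
apply Ccv_scal; auto.
Qed.

Lemma qpoch_inf_0 (q : C) : (Cmod q < 1)%R -> qpoch_inf 0 q = 1.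
Proof.
intros Hq. apply Cminus_eq0, Cmod_eq_0. apply Rle_antisym; [|apply Cmod_ge_0].
eapply Rle_trans; [apply qpoch_inf_near_one; auto|]. rewrite Cmod_0. right. unfold Rdiv. ring.
Qed.

Lemma Ccv_qpoch_inf_0 (e q : C) (u : nat -> C) : (Cmod q < 1)%R -> (Cmod e <= 1)%R ->
  (forall n, (Cmod (u n) <= 1)%R) -> Ccv u 0 -> Ccv (fun j => qpoch_inf (e * u j) q) 1.
Proof.
intros Hq He Hu H eps Heps.
set (K := (exp (1 / (1 - Cmod q)) / (1 - Cmod q))%R).
assert (HK : (0 < K)%R) by (apply Rdiv_lt_0_compat; [apply exp_pos | lra]).
destruct (H (eps / K)%R) as [N HN]; [apply Rdiv_lt_0_compat; auto|].
exists N. intros n Hn. specialize (HN n Hn). replace (u n - 0) with (u n) in HN by ring.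
assert (H1 : (Cmod (e * u n) <= Cmod (u n))%R).
{ rewrite Cmod_mult. rewrite <- (Rmult_1_l (Cmod (u n))) at 2. apply Rmult_le_compat_r; auto. apply Cmod_ge_0. }
assert (T := Hu n).
eapply Rle_lt_trans; [apply qpoch_inf_near_one1; auto; lra|]. fold K.
apply Rle_lt_trans with (K * Cmod (u n))%R; [apply Rmult_le_compat_l; lra|].
replace eps with (K * (eps / K))%R by (field; lra). apply Rmult_lt_compat_l; auto.
Qed.

(** * Comparison of the two sides for fixed nonzero s *)

Section RightHandSide.

Context (n : nat) (a b c d q : C).
Context (hq0 : q <> 0) (hq : (Cmod q < 1)%R) (ha0 : a <> 0) (hd0 : d <> 0).
Context (ha : (Cmod a < 1)%R) (hb : (Cmod b < 1)%R) (hc : (Cmod c < 1)%R) (hd : (Cmod d < 1)%R).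

(** The j-th term of Phi_n times (q^n abc t; q)_oo. The product absorbs the only denominator
    containing t apart from s, and [qprod] replaces (d t)^j (q^n beta; q)_j, so the term is entire
    in t for fixed s. *)
Definition rhs_term (s t : C) (j : nat) : C :=
  vwp_coeff n s a b c d q j * qprod (d * t) (d * q ^ n * s) q j
  * qpoch_inf (a * b * c * q ^ (n + j) * t) q.

Definition rhs_prefactor (s : C) : C :=
  qpoch_inf (a * q ^ n * s) q * qpoch_inf (b * q ^ n * s) q * qpoch_inf (c * q ^ n * s) q
  / (qpoch q q n * qpoch (a * b * c * d * (q ^ n / q)) q n
     * qpoch_inf (a * b * c * q ^ (2 * n) * s) q).

Definition vwp_base (s : C) : C := q ^ (2 * n) / q * (a * b * c * s).

Lemma Cmod_pow_le1 (k : nat) : (Cmod (q ^ k) <= 1)%R.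
Proof. rewrite Cmod_pow, <- (pow1 k). apply pow_incr. assert (T := Cmod_ge_0 q). lra. Qed.

Lemma Cmod_mult_le (x y : C) (u v : R) : (Cmod x <= u)%R -> (Cmod y <= v)%R -> (Cmod (x * y) <= u * v)%R.
Proof. intros. rewrite Cmod_mult. apply Rmult_le_compat; auto using Cmod_ge_0. Qed.

Lemma Cmod_mult_le1 (x y : C) (u : R) : (Cmod x <= u)%R -> (Cmod y <= 1)%R -> (Cmod (x * y) <= u)%R.
Proof. intros. rewrite <- (Rmult_1_r u). apply Cmod_mult_le; auto. Qed.

Lemma vwp_base_bound (s : C) : (Cmod (vwp_base s) <= Cmod s / Cmod q)%R.
Proof.
assert (Hq0 : (0 < Cmod q)%R) by (apply Cmod_gt_0; auto).
unfold vwp_base. replace (q ^ (2 * n) / q * (a * b * c * s)) with (s / q * (a * b * c) * q ^ (2 * n)) by (field; auto).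
apply Cmod_mult_le1; [|apply Cmod_pow_le1].
apply Cmod_mult_le1.
- rewrite Cmod_div by auto. lra.
- assert (T := Cmod_mult_lt1 _ _ (Cmod_mult_lt1 _ _ ha hb) hc). lra.
Qed.

(** Uniformity in s as well as in j serves the later limit s -> 0. The only factor that may
    degenerate is 1 - A, kept away from 0 by [eta]; A itself is only known to satisfy |A| <=
    1/|q|. *)
Lemma vwp_coeff_bound (eta : R) : (0 < eta)%R -> exists K, (0 <= K)%R /\
  forall s, (Cmod s <= 1)%R -> (eta <= Cmod (1 - vwp_base s))%R ->
  forall j, (Cmod (vwp_coeff n s a b c d q j) <= K)%R.
Proof.
intros Heta. assert (Hq0 : (0 < Cmod q)%R) by (apply Cmod_gt_0; auto).
assert (Hd0 : (0 < Cmod d)%R) by (apply Cmod_gt_0; auto).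
assert (HQ : (0 < / (1 - Cmod q))%R) by (apply Rinv_0_lt_compat; lra).
set (L := fun x => qpoch_lower (Cmod x) q).
assert (HL : forall x, (0 < L x)%R) by (intros; apply qpoch_lower_pos).
assert (HL' : forall x, (0 < / L x)%R) by (intros; apply Rinv_0_lt_compat; auto).
set (X1 := ((1 + / Cmod q) * / eta)%R). set (X2 := exp (/ Cmod q / (1 - Cmod q))).
set (X3 := exp (1 / (1 - Cmod q))). set (X4 := exp (/ Cmod d / (1 - Cmod q))).
exists (X1 * X2 * X3 * X3 * X3 * X4 * (/ L q * / L c * / L b * / L a * / L (a * b * c * d)%C))%R.
assert (HX1 : (0 <= X1)%R).
{ apply Rmult_le_pos; [|left; apply Rinv_0_lt_compat; auto].
  assert (T := Rinv_0_lt_compat _ Hq0). lra. }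
assert (HX : (0 < X2 /\ 0 < X3 /\ 0 < X4)%R) by (repeat split; apply exp_pos).
split.
- repeat match goal with |- (0 <= _ * _)%R => apply Rmult_le_pos end; auto; solve [lra | apply Rlt_le; auto].
- intros s Hs Heta' j.
  assert (HA := vwp_base_bound s).
  assert (HA1 : (Cmod (vwp_base s) <= / Cmod q)%R).
  { eapply Rle_trans; [exact HA|]. unfold Rdiv. rewrite <- (Rmult_1_l (/ Cmod q)) at 2.
    apply Rmult_le_compat_r; auto. left; apply Rinv_0_lt_compat; auto. }
  assert (Hp : forall x y, (Cmod x < 1)%R -> (Cmod y < 1)%R -> (Cmod (qpoch (x * y * q ^ n) q j) <= X3)%R).
  { intros x y H1 H2. apply qpoch_bound1; auto. apply Cmod_mult_le1; [|apply Cmod_pow_le1].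
    assert (T := Cmod_mult_lt1 _ _ H1 H2). lra. }
  assert (Hl : forall x y m, (Cmod x < 1)%R -> (Cmod y <= 1)%R -> (Cmod (/ qpoch (x * y * q ^ m) q j) <= / L x)%R).
  { intros x y m H1 H2. apply Cmod_inv_le; auto. apply qpoch_lower_bound; auto.
    apply Cmod_mult_le1; [|apply Cmod_pow_le1]. apply Cmod_mult_le1; auto. lra. }
  assert (HD : (Cmod (a * b * c * d) < 1)%R) by (repeat apply Cmod_mult_lt1; auto).
  unfold vwp_coeff. fold (vwp_base s). cbv zeta. unfold Cdiv at 1. apply Cmod_mult_le.
  + apply Cmod_mult_le; [apply Cmod_mult_le; [apply Cmod_mult_le; [apply Cmod_mult_le; [apply Cmod_mult_le|]|]|]|]; auto.
    * unfold Cdiv. apply Cmod_mult_le.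
      -- eapply Rle_trans; [apply Cmod_triangle|]. rewrite Cmod_1, Cmod_opp.
         apply Rplus_le_compat_l. apply Cmod_mult_le1; auto. apply Cmod_pow_le1.
      -- apply Cmod_inv_le; auto.
    * eapply Rle_trans; [apply qpoch_bound; auto|]. apply exp_le. apply Rmult_le_compat_r; auto. lra.
    * eapply Rle_trans; [apply qpoch_bound; auto|]. apply exp_le. apply Rmult_le_compat_r; [lra|].
      rewrite Cmod_div by auto. rewrite <- (Rmult_1_l (/ Cmod d)).
      apply Rmult_le_compat_r; auto. left; apply Rinv_0_lt_compat; auto.
  (* The inserted factor 1 gives the abcd denominator the three-factor form of [Hl]. *)
  + replace (/ (qpoch q q j * qpoch (c * s * q ^ n) q j * qpoch (b * s * q ^ n) q j *
        qpoch (a * s * q ^ n) q j * qpoch (a * b * c * d * q ^ (2 * n)) q j))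
      with (/ qpoch q q j * / qpoch (c * s * q ^ n) q j * / qpoch (b * s * q ^ n) q j *
        / qpoch (a * s * q ^ n) q j * / qpoch (a * b * c * d * 1 * q ^ (2 * n)) q j).
    * apply Cmod_mult_le; [apply Cmod_mult_le; [apply Cmod_mult_le; [apply Cmod_mult_le|]|]|]; auto.
      -- apply Cmod_inv_le; auto. apply qpoch_lower_bound; auto. lra.
      -- apply Hl; auto. rewrite Cmod_1; lra.
    * replace (a * b * c * d * 1 * q ^ (2 * n)) with (a * b * c * d * q ^ (2 * n)) by ring.
      assert (Hnz : forall x y m, (Cmod x < 1)%R -> (Cmod y <= 1)%R -> qpoch (x * y * q ^ m) q j <> 0).
      { intros x y m H1 H2. apply qpoch_neq0. intros i _. apply one_minus_pow_neq0; auto.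
        eapply Rle_lt_trans; [apply Cmod_mult_le1; [|apply Cmod_pow_le1]; apply Cmod_mult_le1; [apply Rle_refl|auto]|]; auto. }
      field. repeat split; auto.
      -- replace (a * b * c * d * q ^ (2 * n)) with (a * b * c * d * 1 * q ^ (2 * n)) by ring.
         apply Hnz; auto. rewrite Cmod_1; lra.
      -- apply qpoch_neq0. intros i _. apply one_minus_pow_neq0; auto.
Qed.

Lemma rhs_term_analytic (eta r : R) : (0 < eta)%R -> (0 < r < 1)%R ->
  exists M : nat -> R, summable M /\
  forall s, (Cmod s <= 1)%R -> (eta <= Cmod (1 - vwp_base s))%R ->
  forall j, l1_analytic r (M j) (fun t => rhs_term s t j).
Proof.
intros Heta Hr.
destruct (vwp_coeff_bound eta Heta) as [K [HK0 HK]].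
assert (HQ : (0 < / (1 - Cmod q))%R) by (apply Rinv_0_lt_compat; lra).
assert (Hd0 : (0 < Cmod d)%R) by (apply Cmod_gt_0; auto).
set (E := exp (1 / r / (1 - Cmod q))).
set (Z := (1 + exp (1 / (1 - Cmod q)) * (1 / (1 - Cmod q)))%R).
assert (HE : (0 < E)%R) by apply exp_pos.
assert (HZ : (0 < Z)%R).
{ assert (T := exp_pos (1 / (1 - Cmod q))).
  assert (0 <= exp (1 / (1 - Cmod q)) * (1 / (1 - Cmod q)))%R; [|unfold Z; lra].
  apply Rmult_le_pos; lra. }
exists (fun j => (K * E * Z * (Cmod d * r) ^ j)%R). split.
- apply summable_scal; [repeat apply Rmult_le_pos; lra|]. apply summable_pow.
  split; [apply Rmult_le_pos; lra|]. nra.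
- intros s Hs Heta' j. unfold rhs_term.
  apply l1_analytic_weaken with (Cmod (vwp_coeff n s a b c d q j) * ((Cmod d * r) ^ j * E) * Z)%R.
  + apply Rle_trans with (K * ((Cmod d * r) ^ j * E) * Z)%R; [|right; ring].
    apply Rmult_le_compat_r; [lra|]. apply Rmult_le_compat_r; auto.
    apply Rmult_le_pos; [apply pow_le; apply Rmult_le_pos|]; lra.
  + apply l1_analytic_mult; [lra | lra | apply l1_analytic_scal |].
    * eapply l1_analytic_weaken; [|apply l1_analytic_qprod; auto; lra].
      apply Rmult_le_compat_l; [apply pow_le, Rmult_le_pos; lra|]. apply exp_le.
      apply Rmult_le_compat_r; [lra|].
      apply Rle_trans with (Cmod d / (Cmod d * r))%R; [|right; field; lra].
      apply Rmult_le_compat_r; [left; apply Rinv_0_lt_compat; apply Rmult_lt_0_compat; lra|].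
      apply Cmod_mult_le1; auto. apply Cmod_mult_le1; [lra | apply Cmod_pow_le1].
    * eapply l1_analytic_weaken; [|apply l1_analytic_qpoch_inf; auto; lra].
      assert (Hx : (Cmod (a * b * c * q ^ (n + j)) * r / (1 - Cmod q) <= 1 / (1 - Cmod q))%R).
      { apply Rmult_le_compat_r; [lra|].
        assert (T : (Cmod (a * b * c * q ^ (n + j)) <= 1)%R).
        { apply Cmod_mult_le1; [|apply Cmod_pow_le1].
          assert (T := Cmod_mult_lt1 _ _ (Cmod_mult_lt1 _ _ ha hb) hc). lra. }
        assert (T' := Cmod_ge_0 (a * b * c * q ^ (n + j))). nra. }
      apply Rplus_le_compat_l. apply Rmult_le_compat; auto.
      -- left; apply exp_pos.
      -- apply Rmult_le_pos; [apply Rmult_le_pos; [apply Cmod_ge_0 | lra] | lra].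
      -- apply exp_le; auto.
Qed.

Lemma rhs_series (s t : C) : (Cmod s <= 1)%R -> 1 - vwp_base s <> 0 -> (Cmod t < 1)%R ->
  Ccv (csum (rhs_term s t)) (CSeries (rhs_term s t)).
Proof.
intros Hs HA Ht. assert (T := Cmod_ge_0 t).
destruct (rhs_term_analytic (Cmod (1 - vwp_base s)) ((1 + Cmod t) / 2)) as [M [HM HM']].
- apply Cmod_gt_0; auto.
- lra.
- destruct (csum_cv (rhs_term s t) M HM) as [l Hl].
  + intros j. apply (l1_analytic_bound _ _ _ _ (HM' s Hs (Rle_refl _) j)). lra.
  + rewrite (CSeries_eq _ _ Hl). auto.
Qed.

(** At t = s q^(n+M) one has (q^n a s; q)_M = (q^n a s; q)_oo / (a t; q)_oo, likewise for b and c.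
    This converts the finite products of [connection_sum] into the prefactor and accounts for the
    multiplication by (at, bt, ct; q)_oo. *)
Lemma rhs_at_node (s : C) (M : nat) : (Cmod s < 1)%R -> 1 - vwp_base s <> 0 -> s <> 0 ->
  let t := s * q ^ (n + M) in
  csum (fun k => connection_coeff s a q (n + M) k * aw_inverse_coeff a b c d q k n) (S (n + M))
  * (qpoch_inf (a * t) q * qpoch_inf (b * t) q * qpoch_inf (c * t) q)
  = rhs_prefactor s * qprod t s q n * CSeries (rhs_term s t).
Proof.
intros Hs HA Hs0 t.
assert (Habc := Cmod_mult_lt1 _ _ (Cmod_mult_lt1 _ _ ha hb) hc).
assert (Hne : forall x, (Cmod x < 1)%R -> forall k, 1 - x * q ^ k <> 0)
  by (intros; apply one_minus_pow_neq0; auto).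
rewrite (connection_sum n M s a b c d q); auto using Cmod_mult_lt1.
fold t. fold (vwp_base s). set (A := vwp_base s) in *.
assert (Hp : forall k, q ^ k <> 0) by (intros; apply Cpow_nz; auto).
assert (EA : A * q = a * b * c * q ^ (2 * n) * s) by (unfold A, vwp_base; field; auto).
assert (HAq : (Cmod (A * q) < 1)%R).
{ rewrite EA. replace (a * b * c * q ^ (2 * n) * s) with (s * (a * b * c) * q ^ (2 * n)) by ring.
  eapply Rle_lt_trans; [apply Cmod_mult_le1; [apply Rle_refl | apply Cmod_pow_le1]|].
  apply Cmod_mult_lt1; auto. }
assert (HAqM : forall m, (Cmod (A * q * q ^ m) < 1)%R).
{ intros m. eapply Rle_lt_trans; [apply Cmod_mult_le1; [apply Rle_refl | apply Cmod_pow_le1]|auto]. }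
assert (ES : CSeries (rhs_term s t) = qpoch_inf (A * q * q ^ M) q * csum (fun j => vwp_coeff n s a b c d q j
                     * ((d * t) ^ j * qpoch (/ q ^ M) q j / qpoch (A * q * q ^ M) q j)) (S M)).
(* At the node q^n s = t q^(-M), so the terms with j > M vanish and the series is a finite sum. *)
{ assert (Eq : forall j, qprod (d * t) (d * q ^ n * s) q j = (d * t) ^ j * qpoch (/ q ^ M) q j).
  { intros j. rewrite <- qprod_scaled. f_equal. unfold t. rewrite Cpow_add_r. field. auto. }
  rewrite (CSeries_finite _ (S M)).
  - rewrite <- csum_scal. apply csum_ext. intros j _. unfold rhs_term.
    rewrite Eq, (qpoch_inf_split (A * q * q ^ M) q j hq).
    replace (a * b * c * q ^ (n + j) * t) with (A * q * q ^ M * q ^ j).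
    2:{ rewrite EA. unfold t. replace (2 * n)%nat with (n + n)%nat by lia. rewrite !Cpow_add_r. ring. }
    field. apply qpoch_neq0. intros; apply Hne; auto.
  - intros j Hj. unfold rhs_term. rewrite Eq, qpoch_inv_pow_zero by (auto; lia). ring. }
rewrite ES. unfold rhs_prefactor.
assert (Ex : forall x, qpoch_inf (x * q ^ n * s) q = qpoch (x * s * q ^ n) q M * qpoch_inf (x * t) q).
{ intros x. replace (x * q ^ n * s) with (x * s * q ^ n) by ring.
  rewrite (qpoch_inf_split _ q M hq). do 2 f_equal. unfold t. rewrite Cpow_add_r. ring. }
rewrite !Ex, <- EA, (qpoch_inf_split (A * q) q M hq).
assert (H1 : qpoch (A * q) q M <> 0) by (apply qpoch_neq0; intros; apply Hne; auto).
assert (H2 : qpoch_inf (A * q * q ^ M) q <> 0) by (apply qpoch_inf_neq0; auto).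
assert (H3 : qpoch q q n <> 0) by (apply qpoch_neq0; intros; apply Hne; auto).
assert (H4 : qpoch (a * b * c * d * (q ^ n / q)) q n <> 0).
{ destruct n as [|n']; [apply C1_nz|]. apply qpoch_neq0. intros i _.
  rewrite Cpow_S. replace (a * b * c * d * (q * q ^ n' / q) * q ^ i) with (a * b * c * d * q ^ (n' + i))
    by (rewrite Cpow_add_r; field; auto).
  apply Hne. apply Cmod_mult_lt1; auto. }
field. auto.
Qed.

Context (W : R -> R) (h : nat -> C).
Context (horth : forall m n, wint W
  (fun x => askey_wilson m x a b c d q * askey_wilson n x a b c d q)
  (if Nat.eqb m n then h n else 0)).

Lemma base_inf_neq0 (t : C) (x : R) : (Cmod t < 1)%R -> base_inf t q x <> 0.
Proof.
intros Ht. unfold base_inf. apply Cmult_neq_0; apply qpoch_inf_neq0; auto; rewrite Cmod_mul_Cexpi; auto.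
Qed.

Definition rhs_value (s t : C) : C := h n * (rhs_prefactor s * qprod t s q n * CSeries (rhs_term s t)).

Lemma generating_integral_nonzero (s t : C) :
  (Cmod s < 1)%R -> 1 - vwp_base s <> 0 -> s <> 0 -> (Cmod t < 1)%R ->
  exists Y, wint W (fun x => base_inf s q x / base_inf t q x * askey_wilson n x a b c d q) Y /\
    Y * (qpoch_inf (a * t) q * qpoch_inf (b * t) q * qpoch_inf (c * t) q) = rhs_value s t.
Proof.
intros Hs HA Hs0 Ht.
destruct (generating_integral a b c d q W h hq0 hq ha0 ha hb hc hd horth n s (Rlt_le _ _ Hs)) as [y [K [HK [Hy HY]]]].
assert (HY' : forall u, exists Y, (Cmod u < 1)%R -> Ccv (csum (fun m => y m * u ^ m)) Y /\
    wint W (fun x => base_inf s q x / base_inf u q x * askey_wilson n x a b c d q) Y).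
{ intros u. destruct (Rlt_dec (Cmod u) 1) as [Hu|Hu].
  - destruct (HY u Hu) as [Y H]. exists Y; auto.
  - exists 0; intros; contradiction. }
destruct (functional_choice _ HY') as [Y HYY]. clear HY HY'.
exists (Y t). split; [apply HYY; auto|].
(* The disc of radius r contains t and all the nodes s q^(n+N), and stays inside the unit disc. *)
set (r := Rmax (Cmod s) (Cmod t)).
assert (Hr1 : (Cmod s <= r)%R) by apply Rmax_l.
assert (Hr2 : (Cmod t <= r)%R) by apply Rmax_r.
assert (Hr3 : (r < 1)%R) by (apply Rmax_lub_lt; auto).
assert (Hr0 : (0 < r)%R) by (assert (T : (0 < Cmod s)%R) by (apply Cmod_gt_0; auto); lra).
assert (AY : exists M, (0 <= M)%R /\ l1_analytic r M Y).
{ destruct (summable_scal K _ HK (summable_linear_pow r ltac:(lra))) as [HM0 [M HM]].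
  exists M. split; [apply (HM O)|]. exists y. split.
  - intros k. eapply Rle_trans; [|apply (HM k)]. apply rsum_le. intros m.
    rewrite <- Rmult_assoc. apply Rmult_le_compat_r; auto. apply pow_le; lra.
  - intros u Hu. apply HYY. lra. }
destruct AY as [MY [HMY AY]].
destruct (rhs_term_analytic (Cmod (1 - vwp_base s)) r) as [M [[HM0 [B HB]] HM]].
{ apply Cmod_gt_0; auto. } { lra. }
assert (AR : l1_analytic r B (fun u => CSeries (rhs_term s u))).
{ apply (l1_analytic_series r B M (fun j u => rhs_term s u j)); auto.
  - intros j. apply HM; lra.
  - intros u Hu. apply rhs_series; auto; lra. }
assert (Hpos : forall e, (0 <= 1 + exp (Cmod e * r / (1 - Cmod q)) * (Cmod e * r / (1 - Cmod q)))%R).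
{ intros e. assert (T := exp_pos (Cmod e * r / (1 - Cmod q))).
  assert (T' : (0 <= Cmod e * r / (1 - Cmod q))%R).
  { apply Rdiv_le_0_compat; [|lra]. apply Rmult_le_pos; [apply Cmod_ge_0|lra]. }
  assert (0 <= exp (Cmod e * r / (1 - Cmod q)) * (Cmod e * r / (1 - Cmod q)))%R by (apply Rmult_le_pos; lra). lra. }
assert (AP : exists MP, (0 <= MP)%R /\ l1_analytic r MP (fun u => qpoch_inf (a * u) q * qpoch_inf (b * u) q * qpoch_inf (c * u) q)).
{ assert (Aq := fun e => l1_analytic_qpoch_inf r e q Hr0 hq).
  exact (ex_intro _ _ (conj (Rmult_le_pos _ _ (Rmult_le_pos _ _ (Hpos a) (Hpos b)) (Hpos c))
    (l1_analytic_mult r _ _ _ _ Hr0 (Hpos c)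
      (l1_analytic_mult r _ _ _ _ Hr0 (Hpos b) (Aq a) (Aq b)) (Aq c)))). }
destruct AP as [MP [HMP AP]].
assert (AQ : exists MQ, l1_analytic r MQ (fun u => qprod u s q n)).
{ eexists. apply (l1_analytic_ext _ _ (fun u => qprod (1 * u) s q n)); [intros; f_equal; ring|].
  apply l1_analytic_qprod; auto. apply C1_nz. }
destruct AQ as [MQ AQ].
assert (HB0 : (0 <= B)%R) by (apply (HB O)).
apply Cminus_eq0.
(* The difference of the two sides as one power series, to which the identity theorem is applied. *)
assert (AF := l1_analytic_plus r _ _ _ _ (l1_analytic_mult r _ _ _ _ Hr0 HMP AY AP)
  (l1_analytic_scal r _ (- (h n * rhs_prefactor s)) _ (l1_analytic_mult r _ _ _ _ Hr0 HB0 AQ AR))).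
assert (Hnode : forall M, (Cmod (s * q ^ (n + M)) <= r)%R).
{ intros M0. eapply Rle_trans; [apply Cmod_mul_pow_le|]; auto. }
transitivity (Y t * (qpoch_inf (a * t) q * qpoch_inf (b * t) q * qpoch_inf (c * t) q)
   + - (h n * rhs_prefactor s) * (qprod t s q n * CSeries (rhs_term s t))); [unfold rhs_value; ring|].
refine (l1_analytic_identity r _ _ (fun M => s * q ^ (n + M)) Hr0 AF Hnode _ _ _ t Hr2).
- intros N. apply Cmult_neq_0; auto. apply Cpow_nz; auto.
- apply (Ccv_squeeze _ _ (fun N => (Cmod q ^ N)%R)).
  + intros N. replace (s * q ^ (n + N) - 0) with (s * q ^ n * q ^ N) by (rewrite Cpow_add_r; ring).
    rewrite Cmod_mult, Cmod_pow. rewrite <- (Rmult_1_l (Cmod q ^ N)) at 2.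
    apply Rmult_le_compat_r; [apply pow_le, Cmod_ge_0|].
    eapply Rle_trans; [apply Cmod_mul_pow_le; auto|lra].
  + apply Un_cv_pow0. split; auto. apply Cmod_ge_0.
- intros N. set (u := s * q ^ (n + N)).
  assert (Hu : (Cmod u < 1)%R) by (eapply Rle_lt_trans; [apply Hnode|auto]).
  assert (EY : Y u = h n * csum (fun k => connection_coeff s a q (n + N) k * aw_inverse_coeff a b c d q k n) (S (n + N))).
  { apply (wint_unique W (fun x => base_inf s q x / base_inf u q x * askey_wilson n x a b c d q)); [apply HYY; auto|].
    apply (wint_ext _ (fun x => aw_base s q (n + N) x * askey_wilson n x a b c d q)).
    - intros x _. f_equal.
      assert (E : base_inf s q x = aw_base s q (n + N) x * base_inf u q x).
      { unfold base_inf, aw_base. rewrite (qpoch_inf_split (s * Cexpi (acos x)) q (n + N) hq),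
          (qpoch_inf_split (s * Cexpi (- acos x)) q (n + N) hq).
        replace (s * Cexpi (acos x) * q ^ (n + N)) with (u * Cexpi (acos x)) by (unfold u; ring).
        replace (s * Cexpi (- acos x) * q ^ (n + N)) with (u * Cexpi (- acos x)) by (unfold u; ring).
        ring. }
      rewrite E. field. apply base_inf_neq0; auto.
    - apply wint_aw_base; auto. }
  assert (T := rhs_at_node s N Hs HA Hs0). cbv zeta in T. fold u in T.
  rewrite EY.
  transitivity (h n * (csum (fun k => connection_coeff s a q (n + N) k * aw_inverse_coeff a b c d q k n) (S (n + N))
     * (qpoch_inf (a * u) q * qpoch_inf (b * u) q * qpoch_inf (c * u) q)
     - rhs_prefactor s * qprod u s q n * CSeries (rhs_term s u))); [ring|].
  rewrite T. ring.
Qed.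

End RightHandSide.

Lemma Ccv_div (u v : nat -> C) (l m : C) : m <> 0 -> (forall n, v n <> 0) ->
  Ccv u l -> Ccv v m -> Ccv (fun n => u n / v n) (l / m).
Proof. intros Hm Hv Hu Hv'. apply Ccv_mult; auto. apply Ccv_inv; auto. Qed.

(** * The limit s -> 0 *)

Section SmallParameter.

Context (n : nat) (a b c d q : C).
Context (hq0 : q <> 0) (hq : (Cmod q < 1)%R) (ha0 : a <> 0) (hd0 : d <> 0).
Context (ha : (Cmod a < 1)%R) (hb : (Cmod b < 1)%R) (hc : (Cmod c < 1)%R) (hd : (Cmod d < 1)%R).

Lemma qpoch_mul_pow_neq0 (x y : C) (m j : nat) :
  (Cmod x < 1)%R -> (Cmod y <= 1)%R -> qpoch (x * y * q ^ m) q j <> 0.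
Proof.
intros Hx Hy. apply qpoch_neq0. intros i _. apply one_minus_pow_neq0; auto.
apply Rle_lt_trans with (Cmod x); auto.
apply Cmod_mult_le1; [apply Cmod_mult_le1; [lra|auto] | apply Cmod_pow_le1; auto].
Qed.

Lemma Ccv_vwp_coeff (u : nat -> C) (j : nat) :
  (forall k, (Cmod (u k) <= 1)%R) -> (forall k, 1 - vwp_base n a b c q (u k) <> 0) -> Ccv u 0 ->
  Ccv (fun k => vwp_coeff n (u k) a b c d q j) (vwp_coeff n 0 a b c d q j).
Proof.
intros Hu HA H.
assert (H0 : (Cmod 0 <= 1)%R) by (rewrite Cmod_0; lra).
assert (HA0 : Ccv (fun k => vwp_base n a b c q (u k)) (vwp_base n a b c q 0)).
{ apply Ccv_scal, Ccv_scal; auto. }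
assert (Hl : forall x m, Ccv (fun k => qpoch (x * u k * q ^ m) q j) (qpoch (x * 0 * q ^ m) q j)).
{ intros x m. apply Ccv_qpoch. apply Ccv_mult; [apply Ccv_scal; auto | apply Ccv_const]. }
assert (Hden : forall s, (Cmod s <= 1)%R -> qpoch q q j * qpoch (c * s * q ^ n) q j * qpoch (b * s * q ^ n) q j
     * qpoch (a * s * q ^ n) q j * qpoch (a * b * c * d * q ^ (2 * n)) q j <> 0).
{ intros s Hs. repeat apply Cmult_neq_0; auto using qpoch_mul_pow_neq0.
  - apply qpoch_neq0. intros; apply one_minus_pow_neq0; auto.
  - apply qpoch_mul_pow_neq0; [|lra]. repeat apply Cmod_mult_lt1; auto. }
unfold vwp_coeff. fold (vwp_base n a b c q 0). cbv zeta.
apply Ccv_div; auto.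
- repeat apply Ccv_mult; try apply Ccv_const.
  + apply Ccv_minus; [apply Ccv_const|]. apply Ccv_mult; [exact HA0 | apply Ccv_const].
  + apply (Ccv_inv (fun k => 1 - vwp_base n a b c q (u k))); auto.
    * unfold vwp_base. replace (q ^ (2 * n) / q * (a * b * c * 0)) with (RtoC 0) by ring.
      replace (1 - 0) with (RtoC 1) by ring. apply C1_nz.
    * apply Ccv_minus; auto. apply Ccv_const.
  + apply Ccv_qpoch. exact HA0.
  + apply Ccv_qpoch. apply Ccv_mult; auto. apply Ccv_const.
- repeat apply Ccv_mult; try apply Ccv_const; apply Hl.
Qed.

Context (W : R -> R) (h : nat -> C).
Context (horth : forall m n, wint W
  (fun x => askey_wilson m x a b c d q * askey_wilson n x a b c d q)
  (if Nat.eqb m n then h n else 0)).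

Lemma generating_integral_value (s t : C) :
  (Cmod s < 1)%R -> 1 - vwp_base n a b c q s <> 0 -> (Cmod t < 1)%R ->
  exists Y, wint W (fun x => base_inf s q x / base_inf t q x * askey_wilson n x a b c d q) Y /\
    Y * (qpoch_inf (a * t) q * qpoch_inf (b * t) q * qpoch_inf (c * t) q)
    = rhs_value n a b c d q h s t.
Proof.
intros Hs HA Ht.
destruct (Req_dec (Cmod s) 0) as [Es|Es].
2:{ apply generating_integral_nonzero; auto. intros E. apply Es. rewrite E. apply Cmod_0. }
apply Cmod_eq_0 in Es. subst s.
assert (Hq0 : (0 < Cmod q)%R) by (apply Cmod_gt_0; auto).
(* The offset 2 gives |u_k| / |q| <= |q|, so 1 - A at u_k has modulus at least 1 - |q| for every k,
   although A may contain 1/q. *)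
set (u := fun k => q ^ (2 + k)).
assert (Hu0 : forall k, u k <> 0) by (intros; apply Cpow_nz; auto).
assert (Hub : forall k, (Cmod (u k) <= Cmod q * Cmod q)%R).
{ intros k. unfold u. rewrite Cpow_add_r. apply Rle_trans with (Cmod (q ^ 2)).
  - apply Cmod_mult_le1; [lra | apply Cmod_pow_le1; auto].
  - rewrite Cmod_pow. simpl. lra. }
assert (Hu1 : forall k, (Cmod (u k) < 1)%R) by (intros k; specialize (Hub k); nra).
assert (Hu1' : forall k, (Cmod (u k) <= 1)%R) by (intros k; left; auto).
assert (HuA : forall k, (1 - Cmod q <= Cmod (1 - vwp_base n a b c q (u k)))%R).
{ intros k. assert (T := vwp_base_bound n a b c q hq0 hq ha hb hc (u k)).
  assert (T' : (Cmod (u k) / Cmod q <= Cmod q)%R).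
  { apply Rmult_le_reg_r with (Cmod q); auto. unfold Rdiv. rewrite Rmult_assoc, Rinv_l by lra.
    specialize (Hub k). lra. }
  assert (T2 := Cmod_le_diff 1 (1 - vwp_base n a b c q (u k))).
  replace (1 - (1 - vwp_base n a b c q (u k))) with (vwp_base n a b c q (u k)) in T2 by ring.
  rewrite Cmod_1 in T2. lra. }
assert (HuA' : forall k, 1 - vwp_base n a b c q (u k) <> 0).
{ intros k. apply Cmod_gt_0. specialize (HuA k). lra. }
assert (Huc : Ccv u 0).
{ apply (Ccv_squeeze _ _ (fun k => (Cmod q ^ k)%R)); [|apply Un_cv_pow0; lra].
  intros k. replace (u k - 0) with (q ^ k * q ^ 2) by (unfold u; rewrite Cpow_add_r; ring).
  rewrite <- Cmod_pow. apply Cmod_mult_le1; [lra | apply Cmod_pow_le1; auto]. }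
assert (HY : forall k, exists Y, wint W (fun x => base_inf (u k) q x / base_inf t q x * askey_wilson n x a b c d q) Y /\
    Y * (qpoch_inf (a * t) q * qpoch_inf (b * t) q * qpoch_inf (c * t) q)
    = rhs_value n a b c d q h (u k) t).
{ intros k. apply generating_integral_nonzero; auto. }
destruct (functional_choice _ HY) as [Yk HYk]. clear HY.
assert (HW1 : wint W (fun _ => 1) (h O)) by exact (wint_weight a b c d q W h hq0 horth).
destruct (wint_weight_bounded W (h O) HW1) as [B [HB0 HB]].
destruct (askey_wilson_bounded n a b c d q hq0 hq) as [P [HP0 HP]].
destruct (base_inf_near_one q hq) as [K [HK0 HK]].
set (L := qpoch_lower (Cmod t) q). assert (HL : (0 < L)%R) by apply qpoch_lower_pos.
assert (HLi : (0 < / L)%R) by (apply Rinv_0_lt_compat; auto).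
assert (Ht' : forall x, (Cmod (/ base_inf t q x) <= / L * / L)%R).
{ intros x. unfold base_inf. rewrite <- Rinv_mult. apply Cmod_inv_le; [apply Rmult_lt_0_compat; auto|].
  rewrite Cmod_mult. apply Rmult_le_compat; try lra;
   apply qpoch_inf_lower_bound; auto; rewrite Cmod_mul_Cexpi; lra. }
assert (E0 : forall x, base_inf 0 q x = 1).
{ intros x. unfold base_inf. rewrite !Cmult_0_l, qpoch_inf_0 by auto. ring. }
destruct (wint_uniform_limit W B
  (fun k x => base_inf (u k) q x / base_inf t q x * askey_wilson n x a b c d q)
  (fun x => base_inf 0 q x / base_inf t q x * askey_wilson n x a b c d q)
  Yk (fun k => (K * (/ L * / L) * P * Cmod q ^ k)%R) HB0 HB (fun k => proj1 (HYk k))) as [Y [HY1 HY2]].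
{ intros k x _. rewrite E0. unfold Cdiv.
  replace (base_inf (u k) q x * / base_inf t q x * askey_wilson n x a b c d q
     - 1 * / base_inf t q x * askey_wilson n x a b c d q)
    with ((base_inf (u k) q x - 1) * / base_inf t q x * askey_wilson n x a b c d q) by ring.
  apply Rle_trans with (K * Cmod q ^ k * (/ L * / L) * P)%R; [|right; ring].
  apply Cmod_mult_le; auto. apply Cmod_mult_le; auto.
  eapply Rle_trans; [apply HK; auto|]. apply Rmult_le_compat_l; auto.
  unfold u. replace (q ^ (2 + k)) with (q ^ k * q ^ 2) by (rewrite Cpow_add_r; ring).
  rewrite <- Cmod_pow. apply Cmod_mult_le1; [lra | apply Cmod_pow_le1; auto]. }
{ apply Un_cv_scal0, Un_cv_pow0. lra. }
exists Y. split; auto.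
apply (Ccv_unique (fun k => rhs_value n a b c d q h (u k) t)).
- apply (Ccv_ext (fun k => Yk k * (qpoch_inf (a * t) q * qpoch_inf (b * t) q * qpoch_inf (c * t) q))).
  + intros k. apply HYk.
  + apply Ccv_mult; auto. apply Ccv_const.
- unfold rhs_value. apply Ccv_scal. apply Ccv_mult; [apply Ccv_mult|].
  + unfold rhs_prefactor. rewrite !Cmult_0_r, !qpoch_inf_0 by auto.
    assert (Habc := Cmod_mult_lt1 _ _ (Cmod_mult_lt1 _ _ ha hb) hc).
    assert (Hx : forall x m, (Cmod x < 1)%R -> Ccv (fun k => qpoch_inf (x * q ^ m * u k) q) 1).
    { intros x m Hx. apply Ccv_qpoch_inf_0; auto. apply Cmod_mult_le1; [lra | apply Cmod_pow_le1; auto]. }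
    assert (H3 : qpoch q q n <> 0).
    { apply qpoch_neq0; intros; apply one_minus_pow_neq0; auto. }
    assert (H4 : qpoch (a * b * c * d * (q ^ n / q)) q n <> 0).
    { clear - hq0 hq ha hb hc hd Habc. destruct n as [|n']; [apply C1_nz|]. apply qpoch_neq0. intros i _.
      rewrite Cpow_S. replace (a * b * c * d * (q * q ^ n' / q) * q ^ i) with (a * b * c * d * q ^ (n' + i))
        by (rewrite Cpow_add_r; field; auto).
      apply one_minus_pow_neq0; auto. apply Cmod_mult_lt1; auto. }
    apply Ccv_div.
    * repeat apply Cmult_neq_0; auto. apply C1_nz.
    * intros k. repeat apply Cmult_neq_0; auto. apply qpoch_inf_neq0; auto.
      replace (a * b * c * q ^ (2 * n) * u k) with (u k * (a * b * c) * q ^ (2 * n)) by ring.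
      eapply Rle_lt_trans; [apply Cmod_mult_le1; [apply Rle_refl | apply Cmod_pow_le1; auto]|].
      apply Cmod_mult_lt1; auto.
    * repeat apply Ccv_mult; auto.
    * apply Ccv_mult; [apply Ccv_const|]. auto.
  + apply (Ccv_ext (fun k => qprod t (1 * u k) q n)); [intros; f_equal; ring|].
    replace (qprod t 0 q n) with (qprod t (1 * 0) q n) by (f_equal; ring).
    apply Ccv_qprod; auto.
  + assert (Tt := Cmod_ge_0 t).
    (* With eta = 1 - |q| one majorant serves all u_k at once, as Tannery's theorem requires. *)
    destruct (rhs_term_analytic n a b c d q hq0 hq hd0 ha hb hc hd (1 - Cmod q) ((1 + Cmod t) / 2))
      as [M [HM HM']]; [lra | lra |].
    destruct (tannery (fun k => rhs_term n a b c d q (u k) t) (rhs_term n a b c d q 0 t)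
      (fun k => CSeries (rhs_term n a b c d q (u k) t)) M HM) as [V [HV1 HV2]].
    * intros k j. apply (l1_analytic_bound _ _ _ _ (HM' (u k) (Hu1' k) (HuA k) j)). lra.
    * intros j. unfold rhs_term. apply Ccv_mult; [|apply Ccv_const].
      apply Ccv_mult; [apply Ccv_vwp_coeff; auto|]. apply Ccv_qprod; auto.
    * intros k. apply rhs_series; auto.
    * rewrite (CSeries_eq _ _ HV1). auto.
Qed.

End SmallParameter.

(** * The 8-phi-7 of the statement *)

Lemma qpoch_opp_pair (w q : C) (k : nat) :
  qpoch w q k * qpoch (- w) q k = qpoch (w * w) (q * q) k.
Proof.
induction k as [|k IH]; simpl; [ring|]. rewrite <- IH, Cpow_mult_l. ring.
Qed.

(** By [qpoch_opp_pair] a pair w, -w enters only through w^2, so the choice of square roots is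
    immaterial. The upper pair has w^2 = A q^2 and the lower one w^2 = A; their quotient is the
    very-well-poised factor. *)
Lemma qpoch_sqr_ratio (A q : C) (k : nat) : (forall i, 1 - A * (q * q) ^ i <> 0) ->
  qpoch (A * (q * q)) (q * q) k / qpoch A (q * q) k = (1 - A * q ^ (2 * k)) / (1 - A).
Proof.
intros H. assert (E := qpoch_Sl A (q * q) k). rewrite qpoch_S in E.
assert (H1 : qpoch A (q * q) k <> 0) by (apply qpoch_neq0; auto).
assert (H2 : 1 - A <> 0).
{ specialize (H O). simpl in H. rewrite Cmult_1_r in H. auto. }
replace (q ^ (2 * k)) with ((q * q) ^ k).
- apply (Cmult_cancel ((1 - A) * qpoch A (q * q) k)); [apply Cmult_neq_0; auto|].
  transitivity ((1 - A) * qpoch (A * (q * q)) (q * q) k); [field; auto|].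
  rewrite <- E. field. auto.
- rewrite Cpow_mult_l, <- Cpow_add_r. f_equal. lia.
Qed.

Lemma Phi_eq (n : nat) (beta t a b c d q : C) :
  q <> 0 -> (Cmod q < 1)%R -> d <> 0 ->
  (Cmod a < 1)%R -> (Cmod b < 1)%R -> (Cmod c < 1)%R -> (Cmod d < 1)%R ->
  (Cmod t < 1)%R -> (Cmod (t * beta) < 1)%R ->
  1 - vwp_base n a b c q (t * beta) <> 0 ->
  Phi n beta t a b c d q * qpoch_inf (a * b * c * q ^ n * t) q
  = CSeries (rhs_term n a b c d q (t * beta) t).
Proof.
intros hq0 hq hd0 ha hb hc hd Ht Hs HA.
set (s := t * beta) in *. set (A := vwp_base n a b c q s) in *.
set (X := qpoch_inf (a * b * c * q ^ n * t) q).
assert (Habc := Cmod_mult_lt1 _ _ (Cmod_mult_lt1 _ _ ha hb) hc).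
assert (HXl : (Cmod (a * b * c * q ^ n * t) < 1)%R).
{ apply Cmod_mult_lt1; auto. eapply Rle_lt_trans; [apply Cmod_mult_le1; [apply Rle_refl | apply Cmod_pow_le1; auto]|auto]. }
assert (HX : X <> 0) by (apply qpoch_inf_neq0; auto).
assert (HR := rhs_series n a b c d q hq0 hq hd0 ha hb hc hd s t (Rlt_le _ _ Hs) HA Ht).
set (R0 := CSeries (rhs_term n a b c d q s t)) in *.
enough (E : Phi n beta t a b c d q = R0 / X) by (rewrite E; field; auto).
unfold Phi, qphi. cbv zeta. apply CSeries_eq.
apply (Ccv_ext (fun K => csum (rhs_term n a b c d q s t) K * / X)); [|apply Ccv_mult; auto; apply Ccv_const].
intros K. rewrite Cmult_comm, <- csum_scal. apply csum_ext. intros k _.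
set (u := (-1) ^ k * q ^ (k * (k - 1) / 2)).
assert (Hu : u <> 0).
{ apply Cmult_neq_0; apply Cpow_nz; auto.
  intros E. apply (f_equal Re) in E. simpl in E. lra. }
set (v := Csqrt (a * b * c * beta * t)). set (rq := Csqrt q).
assert (Ev : v * v = a * b * c * s) by (unfold v, s; rewrite Csqrt_sqr; ring).
assert (Er : rq * rq = q) by apply Csqrt_sqr.
assert (Hr0 : rq <> 0) by (intros E; apply hq0; rewrite <- Er, E; ring).
assert (Hp : forall k, q ^ k <> 0) by (intros; apply Cpow_nz; auto).
assert (E2n : q ^ (2 * n) = q ^ n * q ^ n).
{ replace (2 * n)%nat with (n + n)%nat by lia. apply Cpow_add_r. }
assert (EA1 : q ^ n * rq * v * (q ^ n * rq * v) = A * (q * q)).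
{ transitivity (q ^ n * q ^ n * (rq * rq) * (v * v)); [ring|]. rewrite Er, Ev.
  unfold A, vwp_base. rewrite E2n. field. auto. }
assert (EA2 : q ^ n / rq * v * (q ^ n / rq * v) = A).
{ transitivity (q ^ n * q ^ n / (rq * rq) * (v * v)); [field; auto|]. rewrite Er, Ev.
  unfold A, vwp_base. rewrite E2n. reflexivity. }
assert (HAi : forall i, 1 - A * (q * q) ^ i <> 0).
(* Only the factor i = 0 depends on the assumption on A: from i = 1 on, A q^(2i) is abcs times a
   nonnegative power of q. *)
{ intros [|i].
  - simpl. rewrite Cmult_1_r. auto.
  - rewrite Cpow_mult_l, Cpow_S.
    replace (A * (q * q ^ i * (q * q ^ i))) with (s * (a * b * c) * q ^ (2 * n + i + S i)).
    + apply one_minus_pow_neq0; auto. apply Cmod_mult_lt1; auto.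
    + unfold A, vwp_base. rewrite !Cpow_add_r, Cpow_S. field. auto. }
assert (P1 := qpoch_opp_pair (q ^ n * rq * v) q k). rewrite EA1 in P1.
assert (P2 := qpoch_opp_pair (q ^ n / rq * v) q k). rewrite EA2 in P2.
assert (P3 := qpoch_sqr_ratio A q k HAi).
assert (HAk : qpoch A (q * q) k <> 0) by (apply qpoch_neq0; auto).
assert (P3' : qpoch (A * (q * q)) (q * q) k = (1 - A * q ^ (2 * k)) / (1 - A) * qpoch A (q * q) k).
{ rewrite <- P3. field. auto. }
unfold qpochs. cbn [fold_right length].
change (1 + 7)%nat with 8%nat.
assert (Hw1 : qpoch (q ^ n / rq * v) q k <> 0).
{ intros E. apply HAk. rewrite <- P2, E. ring. }
assert (Hw2 : qpoch (- (q ^ n / rq * v)) q k <> 0).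
{ intros E. apply HAk. rewrite <- P2, E. ring. }
unfold rhs_term, vwp_coeff. fold (vwp_base n a b c q s). fold A. cbv zeta.
replace (d * q ^ n * s) with (d * t * (q ^ n * beta)) by (unfold s; ring).
rewrite qprod_scaled.
unfold X. rewrite (qpoch_inf_split (a * b * c * q ^ n * t) q k hq).
replace (a * b * c * q ^ n * t * q ^ k) with (a * b * c * q ^ (n + k) * t) by (rewrite Cpow_add_r; ring).
assert (HXk : qpoch_inf (a * b * c * q ^ (n + k) * t) q <> 0).
{ apply qpoch_inf_neq0; auto. apply Cmod_mult_lt1; auto.
  eapply Rle_lt_trans; [apply Cmod_mult_le1; [apply Rle_refl | apply Cmod_pow_le1; auto]|auto]. }
assert (Hnz : forall x m, (Cmod x < 1)%R -> qpoch (x * q ^ m) q k <> 0).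
{ intros x m Hx. apply qpoch_neq0. intros i _. apply one_minus_pow_neq0; auto.
  eapply Rle_lt_trans; [apply Cmod_mult_le1; [apply Rle_refl | apply Cmod_pow_le1; auto]|auto]. }
assert (N1 : qpoch (a * b * c * q ^ n * t) q k <> 0).
{ replace (a * b * c * q ^ n * t) with (a * b * c * t * q ^ n) by ring. apply Hnz, Cmod_mult_lt1; auto. }
assert (N2 := Hnz _ n (Cmod_mult_lt1 _ _ ha Hs)).
assert (N3 := Hnz _ n (Cmod_mult_lt1 _ _ hb Hs)).
assert (N4 := Hnz _ n (Cmod_mult_lt1 _ _ hc Hs)).
assert (N5 := Hnz _ (2 * n)%nat (Cmod_mult_lt1 _ _ Habc hd)).
assert (N6 : qpoch q q k <> 0) by (apply qpoch_neq0; intros; apply one_minus_pow_neq0; auto).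
replace (q ^ (2 * n) / q * (a * b * c * beta * t)) with A by (unfold A, vwp_base, s; field; auto).
replace (q ^ n * a * b) with (a * b * q ^ n) by ring.
replace (q ^ n * a * c) with (a * c * q ^ n) by ring.
replace (q ^ n * b * c) with (b * c * q ^ n) by ring.
replace (beta * t / d) with (s / d) by (unfold s; field; auto).
replace (q ^ n * a * beta * t) with (a * s * q ^ n) by (unfold s; ring).
replace (q ^ n * b * beta * t) with (b * s * q ^ n) by (unfold s; ring).
replace (q ^ n * c * beta * t) with (c * s * q ^ n) by (unfold s; ring).
replace (q ^ (2 * n) * a * b * c * d) with (a * b * c * d * q ^ (2 * n)) by ring.
replace (a * b * q ^ n * c * t) with (a * b * c * q ^ n * t) by ring.
assert (P4 : qpoch (q ^ n * rq * v) q k * qpoch (- (q ^ n * rq * v)) q k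
  = (1 - A * q ^ (2 * k)) / (1 - A) * (qpoch (q ^ n / rq * v) q k * qpoch (- (q ^ n / rq * v)) q k)).
{ rewrite P1, P2. exact P3'. }
lazymatch goal with |- context [qpoch (q ^ n * rq * v) q k * (qpoch (- (q ^ n * rq * v)) q k * ?z)] =>
  replace (qpoch (q ^ n * rq * v) q k * (qpoch (- (q ^ n * rq * v)) q k * z))
    with (qpoch (q ^ n * rq * v) q k * qpoch (- (q ^ n * rq * v)) q k * z) by ring end.
rewrite P4, Cpow_mult_l.
field. repeat split; auto.
Qed.

(** The conditions on a1, a4 and A = q^(2n-1) a1 a2 a3 beta t keep the formulas meaningful: p_n
    contains a1^(-n), Phi_n contains beta t / a4, and the lower pair with w^2 = A puts 1 - A in the
    denominators of Phi_n. The case A = 1 can arise only for n = 0, where A contains 1/q. *)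
Theorem corollary16 (n : nat) (q a1 a2 a3 a4 t : C) (beta : R)
  (hq : (0 < Cmod q < 1)%R)
  (hbeta : (-1 < beta < 1)%R)
  (ha1 : (Cmod a1 < 1)%R) (ha2 : (Cmod a2 < 1)%R)
  (ha3 : (Cmod a3 < 1)%R) (ha4 : (Cmod a4 < 1)%R)
  (ht : (Cmod t < 1)%R)
  (ha1_neq0 : a1 <> 0) (ha4_neq0 : a4 <> 0)
  (horth : aw_orthogonality a1 a2 a3 a4 q)
  (hPhi : q ^ (2 * n) / q * (a1 * a2 * a3 * beta * t) <> 1) :
  is_RInt (V := C_R_NormedModule)
    (fun x : R =>
       qpochs_inf [t * beta * Cexpi (acos x); t * beta * Cexpi (- acos x)] q
       / qpochs_inf [t * Cexpi (acos x); t * Cexpi (- acos x)] q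
       * askey_wilson n x a1 a2 a3 a4 q
       * RtoC (aw_weight x a1 a2 a3 a4 q / sqrt (1 - x ^ 2)))
    (-1) 1
    (RtoC (2 * PI) * aw_norm n a1 a2 a3 a4 q
     * aw_coeff n beta t a1 a2 a3 a4 q).
Proof.
destruct hq as [hq0' hq1].
assert (hq0 : q <> 0) by (apply Cmod_gt_0; auto).
assert (Hb : (Cmod beta < 1)%R) by (rewrite Cmod_R; apply Rabs_def1; lra).
set (s := t * beta). assert (Hs : (Cmod s < 1)%R) by (apply Cmod_mult_lt1; auto).
assert (HA : 1 - vwp_base n a1 a2 a3 q s <> 0).
{ intros E. apply hPhi. apply Cminus_eq0 in E. rewrite E. unfold vwp_base, s. ring. }
destruct (generating_integral_value n a1 a2 a3 a4 q hq0 hq1 ha1_neq0 ha4_neq0 ha1 ha2 ha3 ha4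
  (fun x => aw_weight x a1 a2 a3 a4 q / sqrt (1 - x ^ 2))%R
  (fun k => RtoC (2 * PI) * aw_norm k a1 a2 a3 a4 q)
  ltac:(intros i j; generalize (horth i j); destruct (Nat.eqb_spec i j); subst; auto)
  s t Hs HA ht) as [Y [HY1 HY2]].
assert (HP := Phi_eq n beta t a1 a2 a3 a4 q hq0 hq1 ha4_neq0 ha1 ha2 ha3 ha4 ht Hs HA).
fold s in HP.
replace (RtoC (2 * PI) * aw_norm n a1 a2 a3 a4 q * aw_coeff n beta t a1 a2 a3 a4 q) with Y.
- revert HY1. unfold wint. apply is_RInt_ext. intros x _.
  unfold qpochs_inf, base_inf. cbn [fold_right]. fold s. rewrite !Cmult_1_r. reflexivity.
- assert (Hnz : forall x, (Cmod x < 1)%R -> qpoch_inf (x * t) q <> 0).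
  { intros x Hx. apply qpoch_inf_neq0; auto. apply Cmod_mult_lt1; auto. }
  (* The integral is known only after multiplication by this product, which is nonzero because all
     |a_i t| < 1. *)
  apply (Cmult_cancel (qpoch_inf (a1 * t) q * qpoch_inf (a2 * t) q * qpoch_inf (a3 * t) q)).
  { repeat apply Cmult_neq_0; auto. }
  rewrite Cmult_comm, HY2. unfold rhs_value. rewrite <- HP.
  unfold rhs_prefactor, aw_coeff, qpochs, qpochs_inf. cbn [fold_right].
  replace (qprod t s q n) with (t ^ n * qpoch beta q n) by (symmetry; apply qprod_scaled).
  rewrite !Cmult_1_r.
  assert (Habc := Cmod_mult_lt1 _ _ (Cmod_mult_lt1 _ _ ha1 ha2) ha3).
  replace (q ^ n * a1 * beta * t) with (a1 * q ^ n * s) by (unfold s; ring).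
  replace (q ^ n * a2 * beta * t) with (a2 * q ^ n * s) by (unfold s; ring).
  replace (q ^ n * a3 * beta * t) with (a3 * q ^ n * s) by (unfold s; ring).
  replace (q ^ n * a1 * a2 * a3 * t) with (a1 * a2 * a3 * q ^ n * t) by ring.
  replace (q ^ (2 * n) * a1 * a2 * a3 * beta * t) with (a1 * a2 * a3 * q ^ (2 * n) * s) by (unfold s; ring).
  replace (q ^ n / q * a1 * a2 * a3 * a4) with (a1 * a2 * a3 * a4 * (q ^ n / q)) by ring.
  assert (H1 : qpoch_inf (a1 * a2 * a3 * q ^ (2 * n) * s) q <> 0).
  { apply qpoch_inf_neq0; auto. apply Cmod_mult_lt1; auto.
    eapply Rle_lt_trans; [apply Cmod_mult_le1; [apply Rle_refl | apply Cmod_pow_le1; auto]|auto]. }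
  assert (H2 : qpoch q q n <> 0) by (apply qpoch_neq0; intros; apply one_minus_pow_neq0; auto).
  assert (H3 : qpoch (a1 * a2 * a3 * a4 * (q ^ n / q)) q n <> 0).
  { clear - hq0 hq1 ha4 Habc. destruct n as [|n']; [apply C1_nz|]. apply qpoch_neq0. intros i _.
    rewrite Cpow_S. replace (a1 * a2 * a3 * a4 * (q * q ^ n' / q) * q ^ i) with (a1 * a2 * a3 * a4 * q ^ (n' + i))
      by (rewrite Cpow_add_r; field; auto).
    apply one_minus_pow_neq0; auto. apply Cmod_mult_lt1; auto. }
  assert (H4 := Hnz a1 ha1). assert (H5 := Hnz a2 ha2). assert (H6 := Hnz a3 ha3).
  field. repeat split; auto.
Qed.
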